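(* Consider the binary relay channel described in the context, with parameters $p,\delta,\epsilon\in[0,1]$, and let $R_0=\max_{p(x_1)} I(X_1;S)$ be the capacity of the binary symmetric channel from relay to destination (so $R_0=1-h(\epsilon)$). Then the capacity of this relay channel is $$C=\max_{p(u\mid y_1):\ I(U;Y_1)\le R_0}\ \bigl(1-H(Z\mid U)\bigr),$$ where the maximum is over all conditional distributions $p(u\mid y_1)$ on a finite alphabet $\mathcal U$, the joint law of $(Z,Y_1,U)$ being $p(z)p(y_1\mid z)p(u\mid y_1)$ with $Z\sim\mathrm{Ber}(p)$ and $Y_1=Z\oplus V$, $V\sim \mathrm{Ber}(\delta)$ independent of $Z$. Moreover, the maximization may be restricted to $U$ with $|\mathcal U|\le|\mathcal Y_1|+2=4$.
   Context: Binary relay channel: all alphabets are $\{0,1\}$ and $\oplus$ denotes addition mod 2. Let $Z_i$, $V_i$, $N_i$ ($i=1,2,\dots$) be mutually independent i.i.d. sequences with $Z_i\sim\mathrm{Ber}(p)$, $V_i\sim\mathrm{Ber}(\delta)$, $N_i\sim\mathrm{Ber}(\epsilon)$, independent of the message. The source sends $X_i$; the destination receives $Y_i=X_i\oplus Z_i$; the relay observes $Y_{1i}=Z_i\oplus V_i$ and sends $X_{1i}$ over a separate channel, the destination receiving $S_i=X_{1i}\oplus N_i$. An $(n,2^{nR})$ code consists of a message $W$ uniform on $\{1,\dots,2^{nR}\}$, an encoder $X^n=X^n(W)$, relay functions $X_{1i}=f_i(Y_{1}^{i-1})$, and a decoder $\hat W=g(Y^n,S^n)$. A rate $R$ is achievable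 if there are codes with $\Pr(\hat W\neq W)\to 0$ as $n\to\infty$; the capacity $C$ is the supremum of achievable rates. Entropies are in bits; $h(q)=-q\log_2q-(1-q)\log_2(1-q)$. *)

(* Defs.v *)
From Stdlib Require Import Reals Lra List.
Import ListNotations.
Open Scope R_scope.

Fixpoint bitseqs (n : nat) : list (list bool) :=
  match n with
  | O => [nil]
  | S k => flat_map (fun s => [false :: s; true :: s]) (bitseqs k)
  end.

Definition sumR {A : Type} (f : A -> R) (l : list A) : R :=
  fold_right (fun a acc => f a + acc) 0 l.

Definition ber (q : R) (b : bool) : R := if b then q else 1 - q.

Definition prodber (q : R) (s : list bool) : R :=
  fold_right (fun b acc => ber q b * acc) 1 s.

Definition log2 (x : R) : R := ln x / ln 2.

Definition xlog2 (x : R) : R := if Req_EM_T x 0 then 0 else x * log2 x.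

Definition h (q : R) : R := - xlog2 q - xlog2 (1 - q).

Definition plog (a b : R) : R := if Req_EM_T a 0 then 0 else a * log2 (a / b).

(** An (n, M) code, messages w in {0,...,M-1}:
    - enc w i   = X_i(w)            (i = 0..n-1)
    - relay i y = X_{1i} = f_i(Y_1^{i-1}),  applied to the first i relay
                  observations (0-indexed)
    - dec y s   = decoded message from (Y^n, S^n). *)
Record code : Type := mkCode {
  enc   : nat -> nat -> bool;
  relay : nat -> list bool -> bool;
  dec   : list bool -> list bool -> nat
}.

Definition err_ind (n : nat) (c : code) (w : nat) (z v nn : list bool) : R :=
  let y  := map (fun i => xorb (enc c w i) (nth i z false)) (seq 0 n) in
  let y1 := map (fun i => xorb (nth i z false) (nth i v false)) (seq 0 n) in
  let s  := map (fun i => xorb (relay c i (firstn i y1)) (nth i nn false))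
                (seq 0 n) in
  if Nat.eqb (dec c y s) w then 0 else 1.

Definition Perr (p delta eps : R) (n M : nat) (c : code) : R :=
  / INR M *
  sumR (fun w =>
    sumR (fun z =>
      sumR (fun v =>
        sumR (fun nn =>
          prodber p z * prodber delta v * prodber eps nn * err_ind n c w z v nn)
        (bitseqs n))
      (bitseqs n))
    (bitseqs n))
  (seq 0 M).

Definition achievable (p delta eps : R) (Rt : R) : Prop :=
  exists (M : nat -> nat) (c : nat -> code),
    (forall n, Rpower 2 (INR n * Rt) <= INR (M n)) /\
    Un_cv (fun n => Perr p delta eps n (M n) (c n)) 0.

(** q y u = p(u | y1), a conditional distribution on alphabet {0..k-1} *)
Definition kernel (k : nat) (q : bool -> nat -> R) : Prop :=
  (forall y u, (u < k)%nat -> 0 <= q y u) /\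
  (forall y, sumR (q y) (seq 0 k) = 1).

(** P(Z = z, Y1 = y, U = u) = p(z) p(y|z) p(u|y), with Y1 = Z xor V *)
Definition pZYU (p delta : R) (q : bool -> nat -> R) (z y : bool) (u : nat) : R :=
  ber p z * ber delta (xorb z y) * q y u.

Definition bools : list bool := [false; true].

Definition pZU p delta q z u : R := sumR (fun y => pZYU p delta q z y u) bools.
Definition pYU p delta q y u : R := sumR (fun z => pZYU p delta q z y u) bools.
Definition pU p delta q u : R := sumR (fun z => pZU p delta q z u) bools.
Definition pY p delta (k : nat) q y : R :=
  sumR (fun u => pYU p delta q y u) (seq 0 k).

Definition HZgU (p delta : R) (k : nat) (q : bool -> nat -> R) : R :=
  - sumR (fun u => sumR (fun z => plog (pZU p delta q z u) (pU p delta q u)) bools)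
         (seq 0 k).

Definition IUY1 (p delta : R) (k : nat) (q : bool -> nat -> R) : R :=
  sumR (fun u => sumR (fun y =>
          plog (pYU p delta q y u) (pY p delta k q y * pU p delta q u)) bools)
       (seq 0 k).

(** R0 = capacity of the BSC(eps) from relay to destination *)
Definition R0_bsc (eps : R) : R := 1 - h eps.

(* Main.v *)
(* Achievability. The relay quantizes its block [Y_1^m] to a codeword [U^m] of a random
   codebook of size slightly above [2^{m I(U;Y_1)}] and sends its index to the destination
   during the next block; since [I(U;Y_1) < R_0] the index is decoded, and then the source
   faces an additive noise channel with noise [Z^m] and side information [U^m], over which
   [1 - H(Z|U)] bits per use get through. The boundary case [I(U;Y_1) = R_0] is reached by
   erasing [U] with small probability.

   Converse. [S^n] is independent of the message, so Fano's inequality bounds the rate by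
   [n - H(Z^n | S^n)], while [I(Y_1^n; S^n) <= n R_0]. Both quantities single-letterize with
   [U_i = (Y_1^{i-1}, S^n)], because given [U_i] the past [Z^{i-1}] carries no
   further information on [Z_i]; averaging over [i] gives one admissible [U].

   Both functionals are sums over the values [u] of functions of [q(.|u)] that are
   homogeneous of degree one, so a conic Caratheodory argument with the four constraints
   (two normalizations, [I] and [H]) leaves at most four values, and compactness gives a
   maximizer. *)
Require Import Defs.
From Stdlib Require Import Reals Lra Lia ZArith List Bool Permutation ClassicalEpsilon.
Import ListNotations.
Open Scope R_scope.


(** The usual argument has the relay pick a codeword jointly typical with [Y_1^m] and then needs a
    Markov lemma to see that the unobserved [Z^m] is typical with it as well. Here the source code
    is fixed before the quantizer. Its error probability at side information [u] and noise [z]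
    becomes a cost with values in [0,1], and the relay picks the index of least conditional expected
    cost. A soft covering bound compares the result with the cost under the ideal product law of
    [(Z, U)]. It holds for every such cost, so no joint typicality of the triple [(Z, Y_1, U)]
    enters.

    The erasing trick needs [R_0 > 0]. If [R_0 = 0], a feasible [U] has [I(U;Y_1) = 0], the equality
    case of Gibbs' inequality makes it independent of [Z], and the relay sends zeros while the
    source uses a code for the plain channel with noise [Ber(p)].

    Random codes never appear as objects: an average over a finite list always yields one good
    element. *)

(** * Finite sums over lists *)

Lemma sumR_cons {A} (f : A -> R) a l : sumR f (a :: l) = f a + sumR f l.
Proof. reflexivity. Qed.

Lemma sumR_app {A} (f : A -> R) l1 l2 : sumR f (l1 ++ l2) = sumR f l1 + sumR f l2.
Proof. induction l1; [unfold sumR; simpl; lra|]. simpl app. rewrite !sumR_cons, IHl1; lra. Qed.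

Lemma sumR_ext {A} (f g : A -> R) l :
  (forall a, In a l -> f a = g a) -> sumR f l = sumR g l.
Proof.
  induction l as [|a l IH]; intros H; [reflexivity|].
  rewrite !sumR_cons, IH; [rewrite (H a (or_introl eq_refl)); reflexivity|].
  intros; apply H; right; assumption.
Qed.

Lemma sumR_plus {A} (f g : A -> R) l : sumR (fun a => f a + g a) l = sumR f l + sumR g l.
Proof. induction l; [unfold sumR; simpl; lra|]. rewrite !sumR_cons, IHl; lra. Qed.

Lemma sumR_scal {A} c (f : A -> R) l : sumR (fun a => c * f a) l = c * sumR f l.
Proof. induction l; [unfold sumR; simpl; lra|]. rewrite !sumR_cons, IHl; lra. Qed.

Lemma sumR_scal_r {A} c (f : A -> R) l : sumR (fun a => f a * c) l = sumR f l * c.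
Proof. induction l; [unfold sumR; simpl; lra|]. rewrite !sumR_cons, IHl; lra. Qed.

Lemma sumR_opp {A} (f : A -> R) l : sumR (fun a => - f a) l = - sumR f l.
Proof. induction l; [unfold sumR; simpl; lra|]. rewrite !sumR_cons, IHl; lra. Qed.

Lemma sumR_minus {A} (f g : A -> R) l : sumR (fun a => f a - g a) l = sumR f l - sumR g l.
Proof. induction l; [unfold sumR; simpl; lra|]. rewrite !sumR_cons, IHl; lra. Qed.

Lemma sumR_const {A} c (l : list A) : sumR (fun _ => c) l = INR (length l) * c.
Proof.
  induction l; [unfold sumR; simpl; lra|].
  rewrite sumR_cons, IHl. simpl length. rewrite S_INR; lra.
Qed.

Lemma sumR_0 {A} (f : A -> R) l : (forall a, In a l -> f a = 0) -> sumR f l = 0.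
Proof. intros H. rewrite (sumR_ext f (fun _ => 0)) by exact H. rewrite sumR_const; lra. Qed.

Lemma sumR_le {A} (f g : A -> R) l :
  (forall a, In a l -> f a <= g a) -> sumR f l <= sumR g l.
Proof.
  induction l as [|a l IH]; intros H; [right; reflexivity|].
  rewrite !sumR_cons. apply Rplus_le_compat; [apply H; left; reflexivity|].
  apply IH; intros; apply H; right; assumption.
Qed.

Lemma sumR_nonneg {A} (f : A -> R) l : (forall a, In a l -> 0 <= f a) -> 0 <= sumR f l.
Proof. intros H. rewrite <- (sumR_0 (fun _ : A => 0) l) by reflexivity. apply sumR_le, H. Qed.

Lemma sumR_term_le {A} (f : A -> R) l a :
  (forall b, In b l -> 0 <= f b) -> In a l -> f a <= sumR f l.
Proof.
  induction l as [|b l IH]; intros H Ha; [destruct Ha|].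
  rewrite sumR_cons. destruct Ha as [->|Ha].
  - assert (0 <= sumR f l) by (apply sumR_nonneg; intros; apply H; right; assumption). lra.
  - assert (0 <= f b) by (apply H; left; reflexivity).
    assert (f a <= sumR f l) by (apply IH; [intros; apply H; right|]; assumption). lra.
Qed.

Lemma sumR_eq_0 {A} (f : A -> R) l a :
  (forall b, In b l -> 0 <= f b) -> sumR f l = 0 -> In a l -> f a = 0.
Proof.
  intros H H0 Ha. apply Rle_antisym; [|apply H, Ha].
  rewrite <- H0. apply sumR_term_le; assumption.
Qed.

Lemma sumR_map {A B} (g : A -> B) (f : B -> R) l : sumR f (map g l) = sumR (fun a => f (g a)) l.
Proof. induction l; [reflexivity|]. simpl map. rewrite !sumR_cons, IHl; reflexivity. Qed.

Lemma sumR_flat_map {A B} (g : A -> list B) (f : B -> R) l :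
  sumR f (flat_map g l) = sumR (fun a => sumR f (g a)) l.
Proof. induction l; [reflexivity|]. simpl flat_map. rewrite sumR_app, sumR_cons, IHl; reflexivity. Qed.

Lemma sumR_swap {A B} (f : A -> B -> R) l1 l2 :
  sumR (fun a => sumR (f a) l2) l1 = sumR (fun b => sumR (fun a => f a b) l1) l2.
Proof.
  induction l1 as [|a l IH].
  - symmetry; apply sumR_0; reflexivity.
  - rewrite sumR_cons, IH, <- sumR_plus. apply sumR_ext; reflexivity.
Qed.

Lemma sumR_list_prod {A B} (f : A * B -> R) l1 l2 :
  sumR f (list_prod l1 l2) = sumR (fun a => sumR (fun b => f (a, b)) l2) l1.
Proof.
  induction l1; [reflexivity|].
  simpl list_prod. rewrite sumR_app, sumR_map, sumR_cons, IHl1; reflexivity.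
Qed.

Lemma sumR_perm {A} (f : A -> R) l1 l2 : Permutation l1 l2 -> sumR f l1 = sumR f l2.
Proof. induction 1; rewrite ?sumR_cons; lra. Qed.

Lemma sumR_bools (f : bool -> R) : sumR f bools = f false + f true.
Proof. unfold sumR; simpl; lra. Qed.

(** The derandomization step: it yields each new codeword of the source code and the whole
    quantization codebook. *)
Lemma sumR_average_exists {A} (P f : A -> R) l c :
  (forall a, In a l -> 0 <= P a) -> sumR P l = 1 ->
  sumR (fun a => P a * f a) l <= c -> exists a, In a l /\ f a <= c.
Proof.
  intros HP H1 Hc.
  destruct (Exists_dec (fun a => f a <= c) l) as [He|Hn].
  { intros a. destruct (Rle_dec (f a) c); [left|right]; assumption. }
  - apply Exists_exists in He. exact He.
  - exfalso.
    assert (Hlt : forall a, In a l -> c < f a).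
    { intros a Ha. apply Rnot_le_lt. intros Hle. apply Hn, Exists_exists.
      exists a; split; assumption. }
    assert (Hd : sumR (fun a => P a * (f a - c)) l = 0).
    { apply Rle_antisym.
      - rewrite (sumR_ext _ (fun a => P a * f a - P a * c)) by (intros; ring).
        rewrite sumR_minus, sumR_scal_r, H1. lra.
      - apply sumR_nonneg. intros a Ha. apply Rmult_le_pos; [apply HP, Ha|].
        apply Hlt in Ha; lra. }
    assert (H0 : sumR P l = 0).
    { apply sumR_0. intros a Ha.
      assert (Hz : P a * (f a - c) = 0).
      { apply (sumR_eq_0 (fun a => P a * (f a - c)) l a); [|exact Hd|exact Ha].
        intros b Hb. apply Rmult_le_pos; [apply HP, Hb|]. apply Hlt in Hb; lra. }
      apply Hlt in Ha. apply Rmult_integral in Hz. destruct Hz; lra. }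
    lra.
Qed.

(** * Words over a finite alphabet, product weights, translations of the cube *)

(** The recursion copies that of [bitseqs] over an arbitrary alphabet: later alphabets are pairs of
    bits, the values of [U], and even words themselves, a codebook being a word of codewords. *)
Fixpoint words {A} (l : list A) (n : nat) : list (list A) :=
  match n with
  | O => [nil]
  | S k => flat_map (fun s => map (fun a => a :: s) l) (words l k)
  end.

Lemma words_bools n : words bools n = bitseqs n.
Proof. induction n; simpl; [|rewrite IHn]; reflexivity. Qed.

Lemma sumR_words_0 {A} (F : list A -> R) l : sumR F (words l 0) = F nil.
Proof. unfold sumR; simpl; lra. Qed.

Lemma sumR_words_S {A} (F : list A -> R) l n :
  sumR F (words l (S n)) = sumR (fun a => sumR (fun w => F (a :: w)) (words l n)) l.
Proof.
  simpl words. rewrite sumR_flat_map, sumR_swap.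
  apply sumR_ext; intros; rewrite sumR_map; reflexivity.
Qed.

Lemma in_words {A} (l : list A) n w :
  In w (words l n) <-> length w = n /\ Forall (fun a => In a l) w.
Proof.
  revert w; induction n; intros w; simpl.
  - split.
    + intros [<-|[]]; split; [reflexivity|constructor].
    + intros [H _]. destruct w; [left; reflexivity|discriminate].
  - rewrite in_flat_map. split.
    + intros (s & Hs & Hw). apply in_map_iff in Hw. destruct Hw as (a & <- & Ha).
      apply IHn in Hs. destruct Hs; split; simpl; [congruence|constructor; assumption].
    + intros [Hl Hf]. destruct w as [|a w]; [discriminate|].
      inversion Hf; subst. exists w. split.
      * apply IHn; split; [simpl in Hl; congruence|assumption].
      * apply in_map_iff. exists a; split; [reflexivity|assumption].
Qed.

Lemma words_length {A} (l : list A) n w : In w (words l n) -> length w = n.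
Proof. intros H; apply in_words in H; apply H. Qed.

Lemma in_bitseqs n w : In w (bitseqs n) <-> length w = n.
Proof.
  rewrite <- words_bools, in_words. split; [tauto|]. intros H; split; [exact H|].
  apply Forall_forall. intros [] _; unfold bools; simpl; tauto.
Qed.

Definition wprod {A} (f : A -> R) (w : list A) : R := fold_right (fun a acc => f a * acc) 1 w.

Lemma wprod_cons {A} (f : A -> R) a w : wprod f (a :: w) = f a * wprod f w.
Proof. reflexivity. Qed.

Lemma prodber_wprod q w : prodber q w = wprod (ber q) w.
Proof. reflexivity. Qed.

Lemma wprod_ext {A} (f g : A -> R) w : (forall a, In a w -> f a = g a) -> wprod f w = wprod g w.
Proof.
  induction w as [|a w IH]; intros H; [reflexivity|].
  rewrite !wprod_cons, (H a), IH; try reflexivity; [|left; reflexivity].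
  intros; apply H; right; assumption.
Qed.

Lemma wprod_nonneg {A} (f : A -> R) w : (forall a, In a w -> 0 <= f a) -> 0 <= wprod f w.
Proof.
  induction w as [|a w IH]; intros H; [unfold wprod; simpl; lra|].
  rewrite wprod_cons. apply Rmult_le_pos; [apply H; left; reflexivity|].
  apply IH; intros; apply H; right; assumption.
Qed.

Lemma wprod_1 {A} (f : A -> R) w : (forall a, In a w -> f a = 1) -> wprod f w = 1.
Proof.
  induction w as [|a w IH]; intros H; [reflexivity|].
  rewrite wprod_cons, (H a), IH; [ring| |left; reflexivity].
  intros; apply H; right; assumption.
Qed.

Lemma sumR_wprod {A} (f : A -> R) l n : sumR (wprod f) (words l n) = sumR f l ^ n.
Proof.
  induction n; [rewrite sumR_words_0; reflexivity|].
  rewrite sumR_words_S. simpl pow. rewrite <- IHn, <- sumR_scal_r.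
  apply sumR_ext; intros. rewrite <- sumR_scal. apply sumR_ext; reflexivity.
Qed.

Definition wprod2 {A B} (f : A -> B -> R) (x : list A) (y : list B) : R :=
  wprod (fun ab => f (fst ab) (snd ab)) (combine x y).

Lemma wprod2_cons {A B} (f : A -> B -> R) a x b y :
  wprod2 f (a :: x) (b :: y) = f a b * wprod2 f x y.
Proof. reflexivity. Qed.

Lemma sumR_words_list_prod {A B} (F : list (A * B) -> R) l1 l2 n :
  sumR F (words (list_prod l1 l2) n) =
  sumR (fun x => sumR (fun y => F (combine x y)) (words l2 n)) (words l1 n).
Proof.
  revert F; induction n; intros F; [rewrite !sumR_words_0; reflexivity|].
  rewrite !sumR_words_S, sumR_list_prod.
  apply sumR_ext; intros a Ha.
  rewrite (sumR_ext _ (fun b => sumR (fun x =>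
    sumR (fun y => F ((a, b) :: combine x y)) (words l2 n)) (words l1 n)))
    by (intros b _; apply (IHn (fun w => F ((a, b) :: w)))).
  rewrite sumR_swap. apply sumR_ext; intros x _. rewrite sumR_words_S. reflexivity.
Qed.

Lemma sumR_wprod2_r {A B} (f : A -> B -> R) l n x : length x = n ->
  sumR (wprod2 f x) (words l n) = wprod (fun a => sumR (f a) l) x.
Proof.
  revert x; induction n; intros [|a x] H; try discriminate.
  - rewrite sumR_words_0. reflexivity.
  - rewrite sumR_words_S, wprod_cons, <- (IHn x) by (simpl in H; congruence).
    rewrite <- sumR_scal_r. apply sumR_ext; intros b _. rewrite <- sumR_scal.
    apply sumR_ext; intros; apply wprod2_cons.
Qed.

Lemma wprod2_flip {A B} (f : A -> B -> R) x y : wprod2 f x y = wprod2 (fun b a => f a b) y x.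
Proof.
  revert y; induction x as [|a x IH]; intros [|b y]; try reflexivity.
  rewrite !wprod2_cons, IH; reflexivity.
Qed.

Lemma sumR_wprod2_l {A B} (f : A -> B -> R) l n y : length y = n ->
  sumR (fun x => wprod2 f x y) (words l n) = wprod (fun b => sumR (fun a => f a b) l) y.
Proof.
  intros H. rewrite (sumR_ext _ (wprod2 (fun b a => f a b) y)) by (intros; apply wprod2_flip).
  apply sumR_wprod2_r, H.
Qed.

(** A cascade of memoryless channels is memoryless. The covering argument uses this to sum out
    [Y_1^m] between [Z^m] and [U^m], which produces the ideal product law of [(Z, U)]. *)
Lemma sumR_wprod2_comp {A B C} (f : A -> B -> R) (g : B -> C -> R) l n x z :
  length x = n -> length z = n ->
  sumR (fun y => wprod2 f x y * wprod2 g y z) (words l n) =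
  wprod2 (fun a c => sumR (fun b => f a b * g b c) l) x z.
Proof.
  revert x z; induction n; intros [|a x] [|c z] H H'; try discriminate.
  - rewrite sumR_words_0. unfold wprod2, wprod; simpl; ring.
  - rewrite sumR_words_S, wprod2_cons, <- (IHn x z) by (simpl in *; congruence).
    rewrite <- sumR_scal_r. apply sumR_ext; intros b _. rewrite <- sumR_scal.
    apply sumR_ext; intros y _. rewrite !wprod2_cons; ring.
Qed.

Lemma wprod2_ext {A B} (f g : A -> B -> R) x y :
  (forall a b, In a x -> In b y -> f a b = g a b) -> wprod2 f x y = wprod2 g x y.
Proof.
  intros H. apply wprod_ext. intros [a b] Hab. apply H; simpl;
  [eapply in_combine_l|eapply in_combine_r]; eassumption.
Qed.

Lemma wprod2_nonneg {A B} (f : A -> B -> R) x y :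
  (forall a b, In a x -> In b y -> 0 <= f a b) -> 0 <= wprod2 f x y.
Proof.
  intros H. apply wprod_nonneg. intros [a b] Hab. apply H; simpl;
  [eapply in_combine_l|eapply in_combine_r]; eassumption.
Qed.

Lemma wprod2_mult_r {A B} (f : A -> B -> R) (g : B -> R) x y : length x = length y ->
  wprod2 (fun a b => f a b * g b) x y = wprod2 f x y * wprod g y.
Proof.
  revert y; induction x as [|a x IH]; intros [|b y] H; try discriminate.
  - unfold wprod2, wprod; simpl; ring.
  - rewrite !wprod2_cons, wprod_cons, IH by (simpl in H; congruence). ring.
Qed.

Lemma wprod2_mult_l {A B} (f : A -> B -> R) (g : A -> R) x y : length x = length y ->
  wprod2 (fun a b => g a * f a b) x y = wprod g x * wprod2 f x y.
Proof.
  revert y; induction x as [|a x IH]; intros [|b y] H; try discriminate.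
  - unfold wprod2, wprod; simpl; ring.
  - rewrite !wprod2_cons, wprod_cons, IH by (simpl in H; congruence). ring.
Qed.

Fixpoint xorl (x y : list bool) : list bool :=
  match x, y with
  | a :: x', b :: y' => xorb a b :: xorl x' y'
  | _, _ => nil
  end.

Lemma xorl_length x y : length x = length y -> length (xorl x y) = length y.
Proof. revert y; induction x; intros [|b y] H; try discriminate; simpl; auto. Qed.

Lemma xorl_comm x y : xorl x y = xorl y x.
Proof.
  revert y; induction x; intros [|b y]; try reflexivity; simpl.
  rewrite xorb_comm, IHx; reflexivity.
Qed.

Lemma xorl_cancel x y : length x = length y -> xorl x (xorl x y) = y.
Proof.
  revert y; induction x; intros [|b y] H; try discriminate; simpl; [reflexivity|].
  rewrite IHx by (simpl in H; congruence). rewrite <- xorb_assoc, xorb_nilpotent, xorb_false_l.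
  reflexivity.
Qed.

(** Translation by a fixed word permutes the cube. This is the change of variables behind every
    passage between noises and received words, and behind the uniformity of a shifted random
    codeword. *)
Lemma sumR_bitseqs_xorl (F : list bool -> R) x n : length x = n ->
  sumR (fun y => F (xorl x y)) (bitseqs n) = sumR F (bitseqs n).
Proof.
  rewrite <- words_bools. revert F x; induction n; intros F [|a x] H; try discriminate.
  - rewrite !sumR_words_0; reflexivity.
  - rewrite !sumR_words_S, !sumR_bools. simpl.
    rewrite (IHn (fun w => F (xorb a false :: w)) x), (IHn (fun w => F (xorb a true :: w)) x)
      by (simpl in H; congruence).
    destruct a; simpl; lra.
Qed.

Lemma sumR_bitseqs_1 n : sumR (fun _ => 1) (bitseqs n) = 2 ^ n.
Proof.
  rewrite <- words_bools. rewrite (sumR_ext _ (wprod (fun _ => 1))).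
  - rewrite sumR_wprod, sumR_bools. f_equal; lra.
  - intros; symmetry; apply wprod_1; reflexivity.
Qed.

Lemma ber_nonneg q b : 0 <= q <= 1 -> 0 <= ber q b.
Proof. intros H; destruct b; simpl; lra. Qed.

Lemma prodber_nonneg q w : 0 <= q <= 1 -> 0 <= prodber q w.
Proof. intros H. rewrite prodber_wprod. apply wprod_nonneg. intros; apply ber_nonneg, H. Qed.

Lemma sumR_prodber q n : sumR (prodber q) (bitseqs n) = 1.
Proof.
  rewrite <- words_bools. change (prodber q) with (wprod (ber q)).
  rewrite sumR_wprod, sumR_bools. simpl. replace (1 - q + q) with 1 by ring. apply pow1.
Qed.


(** * Binary logarithms and divergence terms *)

Lemma ln2_pos : 0 < ln 2.
Proof. rewrite <- ln_1. apply ln_increasing; lra. Qed.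

Lemma log2_mult x y : 0 < x -> 0 < y -> log2 (x * y) = log2 x + log2 y.
Proof. intros. unfold log2. rewrite ln_mult by assumption. field. pose proof ln2_pos; lra. Qed.

Lemma log2_inv x : 0 < x -> log2 (/ x) = - log2 x.
Proof. intros. unfold log2. rewrite ln_Rinv by assumption. field. pose proof ln2_pos; lra. Qed.

Lemma log2_div x y : 0 < x -> 0 < y -> log2 (x / y) = log2 x - log2 y.
Proof.
  intros. unfold Rdiv. rewrite log2_mult, log2_inv by auto using Rinv_0_lt_compat. ring.
Qed.

Lemma log2_1 : log2 1 = 0.
Proof. unfold log2. rewrite ln_1. lra. Qed.

Lemma log2_2 : log2 2 = 1.
Proof. unfold log2. field. pose proof ln2_pos; lra. Qed.

Lemma log2_Rpower x : log2 (Rpower 2 x) = x.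
Proof. unfold log2, Rpower. rewrite ln_exp. field. pose proof ln2_pos; lra. Qed.

Lemma Rpower_log2 x : 0 < x -> Rpower 2 (log2 x) = x.
Proof.
  intros. unfold log2, Rpower. replace (ln x / ln 2 * ln 2) with (ln x).
  - apply exp_ln; assumption.
  - field. pose proof ln2_pos; lra.
Qed.

Lemma log2_le x y : 0 < x -> x <= y -> log2 x <= log2 y.
Proof.
  intros Hx [H|<-]; [|lra]. unfold log2, Rdiv. apply Rmult_le_compat_r.
  - left; apply Rinv_0_lt_compat, ln2_pos.
  - left; apply ln_increasing; assumption.
Qed.

Lemma Rpower2_pos x : 0 < Rpower 2 x.
Proof. apply exp_pos. Qed.

Lemma Rpower2_le x y : x <= y -> Rpower 2 x <= Rpower 2 y.
Proof. apply Rle_Rpower; lra. Qed.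

Lemma Rpower2_lt_log2 x y : Rpower 2 x < y -> x < log2 y.
Proof.
  intros H. destruct (Rlt_le_dec x (log2 y)) as [|Hle]; [assumption|].
  pose proof (Rpower2_pos x). apply Rpower2_le in Hle. rewrite Rpower_log2 in Hle; lra.
Qed.

Lemma log2_lt_Rpower2 x y : 0 < y -> y < Rpower 2 x -> log2 y < x.
Proof.
  intros Hy H. destruct (Rlt_le_dec (log2 y) x) as [|Hle]; [assumption|].
  apply Rpower2_le in Hle. rewrite Rpower_log2 in Hle; lra.
Qed.

Lemma log2_le_sub1 x : 0 < x -> log2 x <= (x - 1) / ln 2.
Proof.
  intros. unfold log2, Rdiv. apply Rmult_le_compat_r.
  - left; apply Rinv_0_lt_compat, ln2_pos.
  - pose proof (exp_ineq1_le (ln x)). rewrite exp_ln in *; lra.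
Qed.

Lemma log2_lt_sub1 x : 0 < x -> x <> 1 -> log2 x < (x - 1) / ln 2.
Proof.
  intros Hx Hn. unfold log2, Rdiv. apply Rmult_lt_compat_r.
  - apply Rinv_0_lt_compat, ln2_pos.
  - assert (Hl : ln x <> 0).
    { intros Hl. apply Hn. rewrite <- (exp_ln x Hx), Hl. apply exp_0. }
    pose proof (exp_ineq1 (ln x) Hl). rewrite exp_ln in *; lra.
Qed.

Lemma plog_0_l b : plog 0 b = 0.
Proof. unfold plog. destruct Req_EM_T; [reflexivity|lra]. Qed.

Lemma plog_mult_log2 a b : plog a b = a * log2 (a / b).
Proof. unfold plog. destruct Req_EM_T as [->|]; lra. Qed.

Lemma plog_refl a : plog a a = 0.
Proof.
  destruct (Req_dec a 0) as [->|H]; [apply plog_0_l|].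
  rewrite plog_mult_log2. unfold Rdiv. rewrite Rinv_r by assumption. rewrite log2_1; ring.
Qed.

(** The tangent bound on the logarithm at 1, in homogeneous form. Gibbs' inequality follows by
    summation, since the linear parts add up to the difference of the total masses. *)
Lemma plog_ge a b : 0 <= a -> 0 <= b -> (b = 0 -> a = 0) -> (a - b) / ln 2 <= plog a b.
Proof.
  intros Ha Hb H0. pose proof ln2_pos.
  destruct (Req_dec a 0) as [->|Hn].
  - rewrite plog_0_l. apply Rmult_le_reg_r with (ln 2); [assumption|].
    unfold Rdiv. rewrite Rmult_assoc, Rinv_l; lra.
  - assert (0 < b) by (destruct (Req_dec b 0); [tauto|lra]).
    rewrite plog_mult_log2, log2_div by lra.
    pose proof (log2_le_sub1 (b / a)) as Hl.
    rewrite log2_div in Hl by lra.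
    assert (Hp : 0 < b / a) by (apply Rdiv_lt_0_compat; lra).
    specialize (Hl Hp).
    apply Rmult_le_compat_l with (r := a) in Hl; [|lra].
    replace (a * ((b / a - 1) / ln 2)) with (- ((a - b) / ln 2)) in Hl by (field; lra).
    lra.
Qed.

(** The logarithm touches its tangent only at 1. This equality case is what turns zero mutual
    information into independence. *)
Lemma plog_le_eq a b : 0 <= a -> 0 <= b -> (b = 0 -> a = 0) -> plog a b <= (a - b) / ln 2 -> a = b.
Proof.
  intros Ha Hb H0 Hle. pose proof ln2_pos.
  destruct (Req_dec a 0) as [->|Hn].
  - rewrite plog_0_l in Hle. apply Rmult_le_compat_r with (r := ln 2) in Hle; [|lra].
    unfold Rdiv in Hle. rewrite Rmult_assoc, Rinv_l in Hle; lra.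
  - assert (0 < b) by (destruct (Req_dec b 0); [tauto|lra]).
    rewrite plog_mult_log2, log2_div in Hle by lra.
    destruct (Req_dec (b / a) 1) as [He|He].
    { apply Rmult_eq_compat_l with (r := a) in He. unfold Rdiv in He.
      rewrite (Rmult_comm b), <- Rmult_assoc, Rinv_r in He; lra. }
    pose proof (log2_lt_sub1 (b / a)) as Hl.
    rewrite log2_div in Hl by lra.
    assert (Hp : 0 < b / a) by (apply Rdiv_lt_0_compat; lra).
    specialize (Hl Hp He).
    apply Rmult_lt_compat_l with (r := a) in Hl; [|lra].
    replace (a * ((b / a - 1) / ln 2)) with (- ((a - b) / ln 2)) in Hl by (field; lra).
    lra.
Qed.

Lemma plog_homog c a b : 0 <= c -> plog (c * a) (c * b) = c * plog a b.
Proof.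
  intros Hc. destruct (Req_dec c 0) as [->|Hn]; [rewrite Rmult_0_l, plog_0_l; ring|].
  rewrite !plog_mult_log2.
  replace (c * a / (c * b)) with (a / b); [ring|].
  destruct (Req_dec b 0) as [->|]; [|field; split; assumption].
  rewrite Rmult_0_r. unfold Rdiv. rewrite Rinv_0; ring.
Qed.

Lemma plog_scale_r c a b : 0 < c -> 0 <= a -> 0 <= b -> (b = 0 -> a = 0) ->
  plog a (c * b) = plog a b - a * log2 c.
Proof.
  intros Hc Ha Hb H0. destruct (Req_dec a 0) as [->|Hn]; [rewrite !plog_0_l; ring|].
  assert (0 < b) by (destruct (Req_dec b 0); [tauto|lra]).
  assert (0 < c * b) by (apply Rmult_lt_0_compat; assumption).
  rewrite !plog_mult_log2, !log2_div, log2_mult by lra. ring.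
Qed.

Lemma plog_trans a b c : 0 <= a -> 0 < b -> 0 < c ->
  plog a c = plog a b + a * log2 (b / c).
Proof.
  intros Ha Hb Hc. destruct (Req_dec a 0) as [->|Hn]; [rewrite !plog_0_l; ring|].
  rewrite !plog_mult_log2, !log2_div by lra. ring.
Qed.

(** With the second arguments scaled by the ratio [c] of the totals, the tangent bounds of the two
    terms have linear parts that cancel. The inequality later expresses that conditioning reduces
    entropy. *)
Lemma plog_logsum a1 a2 b1 b2 : 0 <= a1 -> 0 <= a2 -> 0 <= b1 -> 0 <= b2 ->
  (b1 = 0 -> a1 = 0) -> (b2 = 0 -> a2 = 0) ->
  plog (a1 + a2) (b1 + b2) <= plog a1 b1 + plog a2 b2.
Proof.
  intros H1 H2 H3 H4 H5 H6.
  destruct (Req_dec (a1 + a2) 0) as [E|E].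
  { assert (a1 = 0) by lra. assert (a2 = 0) by lra. subst. rewrite E, !plog_0_l. lra. }
  assert (Hb : 0 < b1 + b2).
  { destruct (Req_dec b1 0); destruct (Req_dec b2 0); lra. }
  set (c := (a1 + a2) / (b1 + b2)).
  assert (Hc : 0 < c) by (apply Rdiv_lt_0_compat; lra).
  assert (Hg : forall a b, 0 <= a -> 0 <= b -> (b = 0 -> a = 0) ->
            (a - c * b) / ln 2 <= plog a b - a * log2 c).
  { intros a b Ha Hb' H0. rewrite <- plog_scale_r by assumption.
    apply plog_ge; try assumption.
    - apply Rmult_le_pos; lra.
    - intros Hz. apply H0. apply Rmult_integral in Hz. lra. }
  pose proof (Hg a1 b1 H1 H3 H5). pose proof (Hg a2 b2 H2 H4 H6).
  assert (Hz : (a1 - c * b1) / ln 2 + (a2 - c * b2) / ln 2 = 0).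
  { unfold c. field. pose proof ln2_pos; lra. }
  rewrite plog_mult_log2. fold c. lra.
Qed.

Lemma xlog2_mult_log2 a : xlog2 a = a * log2 a.
Proof. unfold xlog2. destruct Req_EM_T as [->|]; lra. Qed.

Lemma plog_xlog2 a b : 0 <= a -> 0 <= b -> (b = 0 -> a = 0) -> plog a b = xlog2 a - a * log2 b.
Proof.
  intros Ha Hb H0. rewrite plog_mult_log2, xlog2_mult_log2.
  destruct (Req_dec a 0) as [->|Hn]; [ring|].
  assert (0 < b) by (destruct (Req_dec b 0); [tauto|lra]).
  rewrite log2_div by lra. ring.
Qed.

(** * Weak law of large numbers *)

Definition ind_lt (a b : R) : R := if Rlt_dec a b then 1 else 0.

Lemma ind_lt_bounds a b : 0 <= ind_lt a b <= 1.
Proof. unfold ind_lt. destruct Rlt_dec; lra. Qed.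

Lemma sumR_pow_1 {A} (P : A -> R) l n : sumR P l = 1 -> sumR (wprod P) (words l n) = 1.
Proof. intros H. rewrite sumR_wprod, H. apply pow1. Qed.

Lemma iid_mean {A} (P f : A -> R) l n : sumR P l = 1 ->
  sumR (fun w => wprod P w * sumR f w) (words l n) = INR n * sumR (fun a => P a * f a) l.
Proof.
  intros H1. induction n.
  - rewrite sumR_words_0. unfold sumR; simpl; ring.
  - rewrite sumR_words_S.
    rewrite (sumR_ext _ (fun a => P a * f a + P a * (INR n * sumR (fun a => P a * f a) l))).
    + rewrite sumR_plus, sumR_scal_r, H1, S_INR. ring.
    + intros a _.
      rewrite (sumR_ext _ (fun w => P a * f a * wprod P w + P a * (wprod P w * sumR f w)))
        by (intros; rewrite wprod_cons, sumR_cons; ring).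
      rewrite sumR_plus, !sumR_scal, IHn, sumR_pow_1 by assumption. ring.
Qed.

Lemma iid_centered_variance {A} (P g : A -> R) l n :
  sumR P l = 1 -> sumR (fun a => P a * g a) l = 0 ->
  sumR (fun w => wprod P w * (sumR g w) ^ 2) (words l n)
  = INR n * sumR (fun a => P a * g a ^ 2) l.
Proof.
  intros H1 H0. induction n.
  - rewrite sumR_words_0. unfold sumR; simpl; ring.
  - rewrite sumR_words_S.
    rewrite (sumR_ext _ (fun a => P a * g a ^ 2 + P a * (INR n * sumR (fun a => P a * g a ^ 2) l))).
    + rewrite sumR_plus, sumR_scal_r, H1, S_INR. ring.
    + intros a _.
      rewrite (sumR_ext _ (fun w => P a * g a ^ 2 * wprod P w
         + (2 * P a * g a * (wprod P w * sumR g w) + P a * (wprod P w * sumR g w ^ 2))))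
        by (intros; rewrite wprod_cons, sumR_cons; ring).
      rewrite !sumR_plus, !sumR_scal, IHn, sumR_pow_1, iid_mean, H0 by assumption. ring.
Qed.

Lemma wprod_words_nonneg {A} (P : A -> R) l n w :
  (forall a, In a l -> 0 <= P a) -> In w (words l n) -> 0 <= wprod P w.
Proof.
  intros HP Hw. apply in_words in Hw. destruct Hw as [_ Hf]. rewrite Forall_forall in Hf.
  apply wprod_nonneg. intros a Ha. apply HP, Hf, Ha.
Qed.

Lemma weak_lln {A} (P f : A -> R) l gam eta :
  (forall a, In a l -> 0 <= P a) -> sumR P l = 1 -> 0 < gam -> 0 < eta ->
  exists N, forall n, (N <= n)%nat ->
    sumR (fun w => wprod P w *
            ind_lt (INR n * (sumR (fun a => P a * f a) l + gam)) (sumR f w)) (words l n) <= eta.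
Proof.
  intros HP H1 Hg He.
  set (mu := sumR (fun a => P a * f a) l).
  set (g := fun a => f a - mu).
  set (V := sumR (fun a => P a * g a ^ 2) l).
  assert (HV : 0 <= V).
  { apply sumR_nonneg; intros. apply Rmult_le_pos; [apply HP; assumption|]. apply pow2_ge_0. }
  (* Chebyshev's bound is [V / (n gam^2)]; the [+ 1] keeps the denominator positive when the
     variance vanishes. *)
  destruct (archimed_cor1 (eta * gam ^ 2 / (V + 1))) as (N & HN & HN0).
  { apply Rdiv_lt_0_compat; [|lra]. apply Rmult_lt_0_compat; [lra|].
    apply pow_lt; assumption. }
  exists N. intros n Hn.
  assert (HNp : 0 < INR N) by (apply lt_0_INR; lia).
  assert (Hnp : INR N <= INR n) by (apply le_INR; assumption).
  assert (Hg2 : 0 < gam ^ 2) by (apply pow_lt; assumption).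
  apply Rle_trans with
    (/ (INR n * gam) ^ 2 * sumR (fun w => wprod P w * (sumR g w) ^ 2) (words l n)).
  - rewrite <- sumR_scal. apply sumR_le. intros w Hw.
    pose proof (wprod_words_nonneg P l n w HP Hw) as Hwp.
    rewrite <- Rmult_assoc, (Rmult_comm (/ _)), Rmult_assoc.
    apply Rmult_le_compat_l; [assumption|].
    assert (Hngp : 0 < INR n * gam) by (apply Rmult_lt_0_compat; lra).
    assert (Hsq : 0 < (INR n * gam) ^ 2) by (apply pow_lt; assumption).
    unfold ind_lt. destruct Rlt_dec as [Hlt|].
    + assert (Hs : sumR g w = sumR f w - INR n * mu).
      { unfold g. rewrite sumR_minus, sumR_const, (words_length l n w Hw). reflexivity. }
      apply Rmult_le_reg_l with ((INR n * gam) ^ 2); [assumption|].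
      rewrite <- Rmult_assoc, Rinv_r, Rmult_1_l, Rmult_1_r by lra.
      apply pow_incr. lra.
    + apply Rmult_le_pos; [left; apply Rinv_0_lt_compat; assumption|apply pow2_ge_0].
  - rewrite iid_centered_variance; [|assumption|].
    + fold V. apply Rlt_le.
      assert (Hq : / INR n <= / INR N) by (apply Rinv_le_contravar; lra).
      replace (/ (INR n * gam) ^ 2 * (INR n * V)) with (V / gam ^ 2 * / INR n)
        by (field; lra).
      apply Rle_lt_trans with (V / gam ^ 2 * (eta * gam ^ 2 / (V + 1))).
      * apply Rmult_le_compat_l; [|lra].
        apply Rmult_le_pos; [lra|]. left; apply Rinv_0_lt_compat; lra.
      * replace (V / gam ^ 2 * (eta * gam ^ 2 / (V + 1))) with (eta * (V / (V + 1)))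
          by (field; lra).
        rewrite <- (Rmult_1_r eta) at 2. apply Rmult_lt_compat_l; [assumption|].
        apply Rmult_lt_reg_r with (V + 1); [lra|]. unfold Rdiv.
        rewrite Rmult_assoc, Rinv_l; lra.
    + unfold g. rewrite (sumR_ext _ (fun a => P a * f a - P a * mu)) by (intros; ring).
      rewrite sumR_minus, sumR_scal_r, H1. fold mu. ring.
Qed.

Lemma wprod_log2 {A} (P k : A -> R) l w :
  (forall a, In a l -> P a <> 0 -> 0 < k a) -> Forall (fun a => In a l) w ->
  wprod P w <> 0 -> 0 < wprod k w /\ log2 (wprod k w) = sumR (fun a => log2 (k a)) w.
Proof.
  intros Hk Hw Hn. induction Hw as [|a w Ha Hw IH].
  - split; [unfold wprod; simpl; lra|apply log2_1].
  - rewrite wprod_cons in Hn. destruct IH as [IH1 IH2]; [intros E; rewrite E in Hn; lra|].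
    assert (0 < k a) by (apply Hk; [assumption|]; intros E; rewrite E in Hn; lra).
    rewrite wprod_cons, sumR_cons, <- IH2. split.
    + apply Rmult_lt_0_compat; assumption.
    + apply log2_mult; assumption.
Qed.

(** [k] need not be [P] itself: it will be the density ratio of [Y_1] given [U] here, and the
    conditional probability of [Z] given [U] in the companion lower bound. Positivity on the support
    of [P] is enough, because a word leaving the support has weight 0. *)
Lemma aep_upper {A} (P k : A -> R) l mu gam eta :
  (forall a, In a l -> 0 <= P a) -> sumR P l = 1 ->
  (forall a, In a l -> P a <> 0 -> 0 < k a) ->
  mu = sumR (fun a => P a * log2 (k a)) l -> 0 < gam -> 0 < eta ->
  exists N, forall n, (N <= n)%nat ->
    sumR (fun w => wprod P w * ind_lt (Rpower 2 (INR n * (mu + gam))) (wprod k w))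
      (words l n) <= eta.
Proof.
  intros HP H1 Hk -> Hg He.
  destruct (weak_lln P (fun a => log2 (k a)) l gam eta HP H1 Hg He) as [N HN].
  exists N. intros n Hn. eapply Rle_trans; [|apply HN, Hn].
  apply sumR_le. intros w Hw.
  destruct (Req_dec (wprod P w) 0) as [E|E]; [rewrite E; lra|].
  apply Rmult_le_compat_l; [eapply wprod_words_nonneg; eassumption|].
  apply in_words in Hw. destruct (wprod_log2 P k l w Hk (proj2 Hw) E) as [Hpos Hlog].
  unfold ind_lt at 1. destruct Rlt_dec as [Hlt|]; [|apply ind_lt_bounds].
  apply Rpower2_lt_log2 in Hlt. rewrite Hlog in Hlt.
  unfold ind_lt. destruct Rlt_dec; [lra|contradiction].
Qed.

Lemma aep_lower {A} (P k : A -> R) l mu gam eta :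
  (forall a, In a l -> 0 <= P a) -> sumR P l = 1 ->
  (forall a, In a l -> P a <> 0 -> 0 < k a) ->
  mu = sumR (fun a => P a * log2 (k a)) l -> 0 < gam -> 0 < eta ->
  exists N, forall n, (N <= n)%nat ->
    sumR (fun w => wprod P w * ind_lt (wprod k w) (Rpower 2 (INR n * (mu - gam))))
      (words l n) <= eta.
Proof.
  intros HP H1 Hk -> Hg He.
  destruct (weak_lln P (fun a => - log2 (k a)) l gam eta HP H1 Hg He) as [N HN].
  exists N. intros n Hn. eapply Rle_trans; [|apply HN, Hn].
  apply sumR_le. intros w Hw.
  destruct (Req_dec (wprod P w) 0) as [E|E]; [rewrite E; lra|].
  apply Rmult_le_compat_l; [eapply wprod_words_nonneg; eassumption|].
  apply in_words in Hw. destruct (wprod_log2 P k l w Hk (proj2 Hw) E) as [Hpos Hlog].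
  unfold ind_lt at 1. destruct Rlt_dec as [Hlt|]; [|apply ind_lt_bounds].
  apply log2_lt_Rpower2 in Hlt; [|assumption]. rewrite Hlog in Hlt.
  rewrite (sumR_ext (fun a => P a * - log2 (k a)) (fun a => - (P a * log2 (k a))))
    by (intros; ring).
  rewrite !sumR_opp. unfold ind_lt. destruct Rlt_dec; lra.
Qed.


(** * Atoms of a conditional distribution *)

Definition jZY (p d : R) (z y : bool) : R := ber p z * ber d (xorb z y).
Definition mY (p d : R) (y : bool) : R := sumR (fun z => jZY p d z y) bools.

(** For the column [g = q(.|u)], [atU] is [P(U = u)] and [atZ] is [P(Z = z, U = u)]; [atomI] and
    [atomH] are the shares of the value [u] in [I(U;Y_1)] and [H(Z|U)]. *)
Definition atU (p d : R) (g : bool -> R) : R := sumR (fun y => mY p d y * g y) bools.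
Definition atZ (p d : R) (g : bool -> R) (z : bool) : R := sumR (fun y => jZY p d z y * g y) bools.

Definition atomI (p d : R) (g : bool -> R) : R :=
  sumR (fun y => plog (mY p d y * g y) (mY p d y * atU p d g)) bools.
Definition atomH (p d : R) (g : bool -> R) : R :=
  - sumR (fun z => plog (atZ p d g z) (atU p d g)) bools.

(* The column [u] of a kernel [q] is the atom [fun y => q y u]; as both functionals are
   homogeneous of degree one in the atoms, kernels are handled as lists of atoms. *)
Definition atoms (m : R) (gs : list (bool -> R)) : Prop :=
  (forall g, In g gs -> forall y, 0 <= g y) /\ (forall y, sumR (fun g => g y) gs = m).

Section Params.
Variables p d : R.
Hypothesis Hp : 0 <= p <= 1.
Hypothesis Hd : 0 <= d <= 1.

Lemma jZY_nonneg z y : 0 <= jZY p d z y.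
Proof. apply Rmult_le_pos; apply ber_nonneg; assumption. Qed.

Lemma jZY_sum_y z : sumR (jZY p d z) bools = ber p z.
Proof. rewrite sumR_bools. unfold jZY. destruct z; simpl; ring. Qed.

Lemma mY_nonneg y : 0 <= mY p d y.
Proof. apply sumR_nonneg; intros; apply jZY_nonneg. Qed.

Lemma mY_sum : sumR (mY p d) bools = 1.
Proof. unfold mY. rewrite sumR_swap, !sumR_bools. unfold jZY; simpl. ring. Qed.

Lemma jZY_mY_0 z y : mY p d y = 0 -> jZY p d z y = 0.
Proof.
  intros H. apply (sumR_eq_0 (fun z => jZY p d z y) bools z); [intros; apply jZY_nonneg|exact H|].
  destruct z; simpl; tauto.
Qed.

Lemma atU_nonneg g : (forall y, 0 <= g y) -> 0 <= atU p d g.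
Proof. intros H. apply sumR_nonneg; intros. apply Rmult_le_pos; [apply mY_nonneg|apply H]. Qed.

Lemma atZ_nonneg g z : (forall y, 0 <= g y) -> 0 <= atZ p d g z.
Proof. intros H. apply sumR_nonneg; intros. apply Rmult_le_pos; [apply jZY_nonneg|apply H]. Qed.

Lemma atZ_sum g : sumR (atZ p d g) bools = atU p d g.
Proof.
  unfold atZ, atU, mY. rewrite sumR_swap. apply sumR_ext; intros y _.
  rewrite <- sumR_scal_r. reflexivity.
Qed.

Lemma atZ_le_atU g z : (forall y, 0 <= g y) -> atZ p d g z <= atU p d g.
Proof.
  intros H. rewrite <- atZ_sum. apply sumR_term_le; [intros; apply atZ_nonneg, H|].
  destruct z; simpl; tauto.
Qed.

Lemma atU_0 g y : (forall y, 0 <= g y) -> atU p d g = 0 -> mY p d y * g y = 0.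
Proof.
  intros H H0. apply (sumR_eq_0 (fun y => mY p d y * g y) bools y); [|exact H0|destruct y; simpl; tauto].
  intros; apply Rmult_le_pos; [apply mY_nonneg|apply H].
Qed.

Lemma atZ_0 g z : (forall y, 0 <= g y) -> atU p d g = 0 -> atZ p d g z = 0.
Proof.
  intros H H0. apply Rle_antisym; [|apply atZ_nonneg, H].
  rewrite <- H0. apply atZ_le_atU, H.
Qed.

Lemma atU_scal c g : atU p d (fun y => c * g y) = c * atU p d g.
Proof. unfold atU. rewrite <- sumR_scal. apply sumR_ext; intros; ring. Qed.

Lemma atZ_scal c g z : atZ p d (fun y => c * g y) z = c * atZ p d g z.
Proof. unfold atZ. rewrite <- sumR_scal. apply sumR_ext; intros; ring. Qed.

Lemma atomI_scal c g : 0 <= c -> atomI p d (fun y => c * g y) = c * atomI p d g.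
Proof.
  intros Hc. unfold atomI. rewrite <- sumR_scal. apply sumR_ext; intros y _.
  rewrite atU_scal, <- plog_homog by assumption. f_equal; ring.
Qed.

Lemma atomH_scal c g : 0 <= c -> atomH p d (fun y => c * g y) = c * atomH p d g.
Proof.
  intros Hc. unfold atomH. rewrite <- Ropp_mult_distr_r, <- sumR_scal. f_equal.
  apply sumR_ext; intros y _. rewrite atU_scal, atZ_scal, plog_homog by assumption. reflexivity.
Qed.

Lemma atomI_ext g g' : (forall y, g y = g' y) -> atomI p d g = atomI p d g'.
Proof.
  intros H. assert (E : atU p d g = atU p d g')
    by (unfold atU; apply sumR_ext; intros; rewrite H; reflexivity).
  unfold atomI. apply sumR_ext; intros; rewrite H, E; reflexivity.
Qed.

Lemma atomH_ext g g' : (forall y, g y = g' y) -> atomH p d g = atomH p d g'.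
Proof.
  intros H. assert (E : atU p d g = atU p d g')
    by (unfold atU; apply sumR_ext; intros; rewrite H; reflexivity).
  unfold atomH. f_equal. apply sumR_ext; intros z _. rewrite E. f_equal.
  unfold atZ; apply sumR_ext; intros; rewrite H; reflexivity.
Qed.

(** The quotients inside [plog] are awkward where an atom vanishes. Splitting the logarithm leaves
    [xlog2], continuous up to 0, and a part linear in [g], which is the form used for
    compactness. *)
Lemma atomI_xlog2 g : (forall y, 0 <= g y) -> atomI p d g =
  sumR (fun y => xlog2 (mY p d y * g y) - mY p d y * g y * log2 (mY p d y)) bools
  - xlog2 (atU p d g).
Proof.
  intros H.
  assert (E : xlog2 (atU p d g) = sumR (fun y => mY p d y * g y * log2 (atU p d g)) bools).
  { rewrite sumR_scal_r. fold (atU p d g). apply xlog2_mult_log2. }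
  rewrite E, <- sumR_minus. apply sumR_ext; intros y _.
  destruct (Req_dec (mY p d y * g y) 0) as [E0|E0].
  { rewrite E0, plog_0_l, xlog2_mult_log2. ring. }
  assert (mY p d y <> 0) by (intros E1; rewrite E1 in E0; lra).
  assert (atU p d g <> 0) by (intros E1; apply E0, atU_0; assumption).
  pose proof (mY_nonneg y). pose proof (atU_nonneg g H).
  rewrite plog_xlog2.
  - rewrite log2_mult by lra. ring.
  - apply Rmult_le_pos; [lra|apply H].
  - apply Rmult_le_pos; lra.
  - intros E1. apply Rmult_integral in E1. tauto.
Qed.

Lemma atomH_xlog2 g : (forall y, 0 <= g y) -> atomH p d g =
  xlog2 (atU p d g) - sumR (fun z => xlog2 (atZ p d g z)) bools.
Proof.
  intros H.
  assert (E : xlog2 (atU p d g) = sumR (fun z => atZ p d g z * log2 (atU p d g)) bools).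
  { rewrite sumR_scal_r, atZ_sum. apply xlog2_mult_log2. }
  unfold atomH. rewrite E, <- sumR_minus, <- sumR_opp. apply sumR_ext; intros z _.
  rewrite plog_xlog2; [ring|apply atZ_nonneg, H|apply atU_nonneg, H|].
  intros; apply atZ_0; assumption.
Qed.

Lemma atomH_nonneg g : (forall y, 0 <= g y) -> 0 <= atomH p d g.
Proof.
  intros H. unfold atomH. rewrite <- sumR_opp. apply sumR_nonneg; intros z _.
  destruct (Req_dec (atZ p d g z) 0) as [E|E]; [rewrite E, plog_0_l; lra|].
  pose proof (atZ_nonneg g z H). pose proof (atZ_le_atU g z H).
  rewrite plog_mult_log2, log2_div by lra.
  pose proof (log2_le (atZ p d g z) (atU p d g)). nra.
Qed.

Lemma pY_kernel k q y : kernel k q -> pY p d k q y = mY p d y.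
Proof.
  intros [_ H]. unfold pY, pYU, pZYU.
  rewrite (sumR_ext _ (fun u => mY p d y * q y u)).
  - rewrite sumR_scal, H; ring.
  - intros u _. unfold mY. rewrite <- sumR_scal_r. reflexivity.
Qed.

Lemma pYU_at q y u : pYU p d q y u = mY p d y * q y u.
Proof. unfold pYU, pZYU, mY. rewrite <- sumR_scal_r. reflexivity. Qed.

Lemma pZU_at q z u : pZU p d q z u = atZ p d (fun y => q y u) z.
Proof. reflexivity. Qed.

Lemma pU_at q u : pU p d q u = atU p d (fun y => q y u).
Proof. unfold pU. rewrite <- atZ_sum. reflexivity. Qed.

Lemma IUY1_atoms k q : kernel k q ->
  IUY1 p d k q = sumR (fun u => atomI p d (fun y => q y u)) (seq 0 k).
Proof.
  intros H. unfold IUY1, atomI. apply sumR_ext; intros u _. apply sumR_ext; intros y _.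
  rewrite (pY_kernel k q y H), pYU_at, pU_at. reflexivity.
Qed.

Lemma HZgU_atoms k q :
  HZgU p d k q = sumR (fun u => atomH p d (fun y => q y u)) (seq 0 k).
Proof.
  unfold HZgU, atomH. rewrite sumR_opp. f_equal.
  apply sumR_ext; intros u _. apply sumR_ext; intros z _.
  rewrite pU_at. reflexivity.
Qed.

Lemma sumR_seq_nth {A} (F : A -> R) l a0 :
  sumR (fun i => F (nth i l a0)) (seq 0 (length l)) = sumR F l.
Proof.
  induction l as [|a l IH]; [reflexivity|].
  simpl length. rewrite <- cons_seq, sumR_cons, <- seq_shift, sumR_map, sumR_cons. simpl.
  rewrite IH. reflexivity.
Qed.

Definition kernel_of_atoms (gs : list (bool -> R)) (y : bool) (u : nat) : R :=
  nth u gs (fun _ => 0) y.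

Lemma kernel_of_atoms_spec gs : atoms 1 gs -> kernel (length gs) (kernel_of_atoms gs).
Proof.
  intros [H1 H2]. split.
  - intros y u Hu. apply H1, nth_In, Hu.
  - intros y. rewrite <- (H2 y).
    apply (sumR_seq_nth (fun g => g y) gs (fun _ => 0)).
Qed.

Lemma IUY1_of_atoms gs : atoms 1 gs ->
  IUY1 p d (length gs) (kernel_of_atoms gs) = sumR (atomI p d) gs.
Proof.
  intros H. rewrite IUY1_atoms by (apply kernel_of_atoms_spec, H).
  apply (sumR_seq_nth (atomI p d) gs (fun _ => 0)).
Qed.

Lemma HZgU_of_atoms gs :
  HZgU p d (length gs) (kernel_of_atoms gs) = sumR (atomH p d) gs.
Proof. rewrite HZgU_atoms. apply (sumR_seq_nth (atomH p d) gs (fun _ => 0)). Qed.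

End Params.

(** * Cardinality bound *)

Lemma argmin_exists {A} (f : A -> R) l : l <> nil ->
  exists a, In a l /\ forall b, In b l -> f a <= f b.
Proof.
  induction l as [|a l IH]; intros H; [congruence|].
  destruct l as [|b l].
  - exists a. split; [left; reflexivity|]. intros b [<-|[]]; lra.
  - destruct IH as (c & Hc & Hm); [discriminate|].
    destruct (Rle_dec (f a) (f c)).
    + exists a. split; [left; reflexivity|]. intros x [<-|Hx]; [lra|].
      apply Hm in Hx; lra.
    + exists c. split; [right; assumption|]. intros x [<-|Hx]; [lra|apply Hm, Hx].
Qed.

(** Gaussian elimination: a vector [i0] with nonzero coordinate [d] clears that coordinate from the
    others, and its own coefficient [s] is then forced. If all these coordinates vanish, the
    induction hypothesis applies directly. *)
Lemma linear_dependence (d : nat) : forall (V : nat -> nat -> R) (I : list nat),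
  NoDup I -> (d < length I)%nat ->
  exists c, (exists i, In i I /\ c i <> 0) /\
    forall j, (j < d)%nat -> sumR (fun i => c i * V i j) I = 0.
Proof.
  induction d as [|d IH]; intros V I HI Hl.
  - exists (fun _ => 1). split.
    + destruct I as [|i I]; [simpl in Hl; lia|]. exists i. split; [left; reflexivity|lra].
    + intros; lia.
  - destruct (Exists_dec (fun i => V i d <> 0) I) as [He|Hn].
    { intros i. destruct (Req_dec_T (V i d) 0); [right|left]; tauto. }
    + apply Exists_exists in He. destruct He as (i0 & Hi0 & Hv).
      apply in_split in Hi0. destruct Hi0 as (l1 & l2 & ->).
      assert (Hperm : Permutation (l1 ++ i0 :: l2) (i0 :: l1 ++ l2))
        by (symmetry; apply Permutation_middle).
      assert (HND : NoDup (i0 :: l1 ++ l2)) by (eapply Permutation_NoDup; eassumption).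
      inversion HND as [|? ? Hni HND']; subst.
      destruct (IH (fun i j => V i j - V i d / V i0 d * V i0 j) (l1 ++ l2) HND')
        as (c & (i1 & Hi1 & Hc1) & Hc).
      { rewrite length_app in *. simpl in Hl. lia. }
      set (s := - sumR (fun i => c i * (V i d / V i0 d)) (l1 ++ l2)).
      exists (fun i => if Nat.eq_dec i i0 then s else c i).
      assert (Hs : forall j, sumR (fun i => (if Nat.eq_dec i i0 then s else c i) * V i j)
                (l1 ++ i0 :: l2) =
                sumR (fun i => c i * (V i j - V i d / V i0 d * V i0 j)) (l1 ++ l2)).
      { intros j. rewrite (sumR_perm _ _ _ Hperm), sumR_cons.
        destruct (Nat.eq_dec i0 i0); [|congruence].
        rewrite (sumR_ext _ (fun i => c i * V i j)).
        - rewrite (sumR_ext (fun i => c i * (V i j - V i d / V i0 d * V i0 j))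
             (fun i => c i * V i j - c i * (V i d / V i0 d) * V i0 j)) by (intros; ring).
          rewrite sumR_minus, sumR_scal_r. unfold s. ring.
        - intros i Hi. destruct (Nat.eq_dec i i0); [subst; contradiction|reflexivity]. }
      split.
      * exists i1. split.
        -- apply in_app_iff in Hi1. apply in_app_iff. simpl. tauto.
        -- destruct (Nat.eq_dec i1 i0); [subst; contradiction|assumption].
      * intros j Hj. rewrite Hs.
        destruct (Nat.eq_dec j d) as [->|]; [|apply Hc; lia].
        apply sumR_0. intros i _. field. assumption.
    + destruct (IH V I HI) as (c & Hc1 & Hc); [lia|].
      exists c. split; [assumption|]. intros j Hj.
      destruct (Nat.eq_dec j d) as [->|]; [|apply Hc; lia].
      apply sumR_0. intros i Hi.
      destruct (Req_dec (V i d) 0) as [->|Hv]; [ring|].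
      exfalso. apply Hn, Exists_exists. exists i; split; assumption.
Qed.

(** While more than [d] vectors remain, the weights move along a linear relation until one of them
    reaches 0. The sums stay the same, all weights stay nonnegative, and that vector is dropped. *)
Lemma conic_caratheodory (d : nat) (V : nat -> nat -> R) : forall n I t,
  length I = n -> NoDup I -> (forall i, In i I -> 0 <= t i) ->
  exists I' t', (length I' <= d)%nat /\ incl I' I /\ (forall i, In i I' -> 0 <= t' i) /\
    forall j, (j < d)%nat -> sumR (fun i => t' i * V i j) I' = sumR (fun i => t i * V i j) I.
Proof.
  induction n as [|n IH]; intros I t Hl HI Ht.
  { exists I, t. repeat split; try assumption; [lia|apply incl_refl]. }
  destruct (Nat.le_gt_cases (length I) d) as [Hle|Hgt].
  { exists I, t. repeat split; try assumption. apply incl_refl. }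
  (* It suffices to find nonnegative weights with the same sums and one vanishing entry. *)
  assert (Hred : exists t1 i1, In i1 I /\ t1 i1 = 0 /\ (forall i, In i I -> 0 <= t1 i) /\
    forall j, (j < d)%nat -> sumR (fun i => t1 i * V i j) I = sumR (fun i => t i * V i j) I).
  { destruct (Exists_dec (fun i => t i = 0) I) as [He|Hn].
    { intros i. apply Req_dec_T. }
    { apply Exists_exists in He. destruct He as (i1 & Hi1 & H0).
      exists t, i1. repeat split; assumption. }
    assert (Hpos : forall i, In i I -> 0 < t i).
    { intros i Hi. destruct (Ht i Hi) as [|E]; [assumption|].
      exfalso. apply Hn, Exists_exists. exists i; split; [assumption|congruence]. }
    assert (Hc : exists c, (exists i, In i I /\ 0 < c i) /\
      forall j, (j < d)%nat -> sumR (fun i => c i * V i j) I = 0).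
    { destruct (linear_dependence d V I HI Hgt) as (c & (i & Hi & Hci) & Hc).
      destruct (Rlt_le_dec 0 (c i)).
      - exists c. split; [exists i; split|]; assumption.
      - exists (fun i => - c i). split; [exists i; split; [assumption|lra]|].
        intros j Hj. rewrite (sumR_ext _ (fun i => - (c i * V i j))) by (intros; ring).
        rewrite sumR_opp, Hc by assumption. ring. }
    destruct Hc as (c & (i0 & Hi0 & Hc0) & Hc).
    (* The largest [c i / t i] gives the admissible step length [t i1 / c i1]; this form never
       divides by a [c i] that may be zero or negative. *)
    destruct (argmin_exists (fun i => - (c i / t i)) I) as (i1 & Hi1 & Hm).
    { destruct I; [destruct Hi0|discriminate]. }
    assert (Hr1 : 0 < c i1 / t i1).
    { pose proof (Hm i0 Hi0). assert (0 < c i0 / t i0).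
      { apply Rdiv_lt_0_compat; [assumption|apply Hpos, Hi0]. } lra. }
    pose proof (Hpos i1 Hi1) as Ht1.
    assert (Hc1 : 0 < c i1).
    { apply Rmult_lt_reg_r with (/ t i1); [apply Rinv_0_lt_compat; assumption|].
      rewrite Rmult_0_l. exact Hr1. }
    exists (fun i => t i - t i1 / c i1 * c i), i1.
    split; [assumption|]. split; [field; lra|]. split.
    - intros i Hi. pose proof (Hm i Hi) as Hmi. pose proof (Hpos i Hi) as Hti.
      replace (t i - t i1 / c i1 * c i) with
        (t i * (t i1 / c i1) * (c i1 / t i1 - c i / t i)) by (field; lra).
      apply Rmult_le_pos; [|lra]. apply Rmult_le_pos; [lra|].
      left. apply Rdiv_lt_0_compat; assumption.
    - intros j Hj.
      rewrite (sumR_ext _ (fun i => t i * V i j - t i1 / c i1 * (c i * V i j)))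
        by (intros; ring).
      rewrite sumR_minus, sumR_scal, Hc by assumption. ring. }
  destruct Hred as (t1 & i1 & Hi1 & H0 & Ht1 & Hsum).
  apply in_split in Hi1. destruct Hi1 as (l1 & l2 & ->).
  assert (Hperm : Permutation (l1 ++ i1 :: l2) (i1 :: l1 ++ l2))
    by (symmetry; apply Permutation_middle).
  assert (Hincl : incl (l1 ++ l2) (l1 ++ i1 :: l2)).
  { intros i Hi. apply in_app_iff in Hi. apply in_app_iff. simpl. tauto. }
  destruct (IH (l1 ++ l2) t1) as (I' & t' & H1 & H2 & H3 & H4).
  - rewrite length_app in *. simpl in Hl. lia.
  - eapply NoDup_remove_1; eassumption.
  - intros i Hi. apply Ht1, Hincl, Hi.
  - exists I', t'. split; [assumption|]. split; [eapply incl_tran; eassumption|].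
    split; [assumption|]. intros j Hj.
    rewrite H4, <- Hsum by assumption.
    rewrite (sumR_perm _ _ _ Hperm), sumR_cons, H0. ring.
Qed.

Lemma atoms_reduction p d k q : 0 <= p <= 1 -> 0 <= d <= 1 -> kernel k q ->
  exists q', kernel 4 q' /\ IUY1 p d 4 q' = IUY1 p d k q /\ HZgU p d 4 q' = HZgU p d k q.
Proof.
  intros Hp Hd Hq.
  set (G := fun u y => q y u).
  set (V := fun u j => match j with
     | O => q false u | 1%nat => q true u | 2%nat => atomI p d (G u) | _ => atomH p d (G u) end).
  destruct (conic_caratheodory 4 V k (seq 0 k) (fun _ => 1)) as (I' & t & H1 & H2 & H3 & H4).
  { apply length_seq. } { apply seq_NoDup. } { intros; lra. }
  (* Fewer than four columns may survive; zero columns, on which both functionals vanish, pad the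
     list to exactly four. *)
  set (gs := map (fun i y => t i * G i y) I' ++ repeat (fun _ : bool => 0) (4 - length I')).
  assert (Hlen : length gs = 4%nat).
  { unfold gs. rewrite length_app, length_map, repeat_length. lia. }
  assert (Hz : forall F : (bool -> R) -> R, F (fun _ => 0) = 0 ->
             sumR F gs = sumR (fun i => F (fun y => t i * G i y)) I').
  { intros F HF. unfold gs. rewrite sumR_app, sumR_map.
    rewrite (sumR_0 F (repeat _ _)); [ring|].
    intros g Hg. apply repeat_spec in Hg. subst; assumption. }
  assert (Hone : forall F : nat -> R, sumR (fun i => 1 * F i) (seq 0 k) = sumR F (seq 0 k))
    by (intros; apply sumR_ext; intros; ring).
  assert (Hin : forall i, In i I' -> (i < k)%nat).
  { intros i Hi. apply H2, in_seq in Hi. lia. }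
  assert (Hat : atoms 1 gs).
  { split.
    - intros g Hg y. unfold gs in Hg. apply in_app_iff in Hg. destruct Hg as [Hg|Hg].
      + apply in_map_iff in Hg. destruct Hg as (i & <- & Hi).
        apply Rmult_le_pos; [apply H3, Hi|]. apply Hq, Hin, Hi.
      + apply repeat_spec in Hg. subst; lra.
    - intros y. rewrite Hz by reflexivity. rewrite <- (proj2 Hq y). destruct y.
      + rewrite <- (Hone (q true)). apply (H4 1%nat). lia.
      + rewrite <- (Hone (q false)). apply (H4 0%nat). lia. }
  exists (kernel_of_atoms gs).
  split; [rewrite <- Hlen at 1; apply kernel_of_atoms_spec, Hat|].
  split.
  - rewrite <- Hlen at 1. rewrite IUY1_of_atoms by assumption. rewrite IUY1_atoms by assumption.
    rewrite Hz.
    + rewrite (sumR_ext _ (fun i => t i * V i 2%nat)).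
      * rewrite H4 by lia. apply Hone.
      * intros i Hi. apply atomI_scal, H3, Hi.
    + rewrite (atomI_ext p d _ (fun y => 0 * 0)) by (intros; ring).
      rewrite (atomI_scal p d 0 (fun _ => 0)) by lra. ring.
  - rewrite <- Hlen at 1. rewrite HZgU_of_atoms. rewrite HZgU_atoms.
    rewrite Hz.
    + rewrite (sumR_ext _ (fun i => t i * V i 3%nat)).
      * rewrite H4 by lia. apply Hone.
      * intros i Hi. apply atomH_scal, H3, Hi.
    + rewrite (atomH_ext p d _ (fun y => 0 * 0)) by (intros; ring).
      rewrite (atomH_scal p d 0 (fun _ => 0)) by lra. ring.
Qed.


(** * Attainment of the maximum *)

(** Writing [x] as the square of [s = sqrt x], the tangent bound for [log2 (/ s)] gains a factor
    [s]. This gives continuity of [xlog2] at 0 with an explicit modulus. *)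
Lemma xlog2_sqrt_bound x : 0 <= x <= 1 -> Rabs (xlog2 x) <= 2 * sqrt x / ln 2.
Proof.
  intros [H0 H1]. pose proof ln2_pos.
  destruct (Req_dec x 0) as [->|Hn].
  - rewrite xlog2_mult_log2, Rmult_0_l, Rabs_R0, sqrt_0. lra.
  - assert (Hs : 0 < sqrt x) by (apply sqrt_lt_R0; lra).
    assert (Hss : sqrt x * sqrt x = x) by (apply sqrt_sqrt; lra).
    rewrite xlog2_mult_log2. rewrite <- Hss at 2. rewrite log2_mult by assumption.
    assert (Hl : log2 (sqrt x) <= 0).
    { rewrite <- log2_1. apply log2_le; [assumption|]. rewrite <- sqrt_1. apply sqrt_le_1; lra. }
    rewrite Rabs_left1 by nra.
    pose proof (log2_le_sub1 (/ sqrt x) (Rinv_0_lt_compat _ Hs)) as Hb.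
    rewrite log2_inv in Hb by assumption.
    apply Rmult_le_compat_l with (r := 2 * x) in Hb; [|lra].
    replace (2 * x * ((/ sqrt x - 1) / ln 2)) with (2 * sqrt x / ln 2 - 2 * x / ln 2) in Hb.
    + assert (0 <= 2 * x / ln 2) by (apply Rmult_le_pos; [lra|left; apply Rinv_0_lt_compat; lra]).
      lra.
    + clear - Hs Hss H. revert Hs Hss. generalize (sqrt x). intros s Hs Hss. subst x. field. lra.
Qed.

Lemma Un_cv_const c : Un_cv (fun _ => c) c.
Proof. intros e He. exists 0%nat. intros. unfold Rdist. rewrite Rminus_diag, Rabs_R0. assumption. Qed.

Lemma xlog2_continuous_seq u x : (forall n : nat, 0 <= u n) -> Un_cv u x ->
  Un_cv (fun n => xlog2 (u n)) (xlog2 x).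
Proof.
  intros Hu Hc.
  assert (Hx : 0 <= x).
  { destruct (Rle_lt_dec 0 x) as [|Hlt]; [assumption|].
    destruct (Hc (- x)) as [N HN]; [lra|]. specialize (HN N (le_n N)).
    unfold Rdist in HN. pose proof (Hu N). rewrite Rabs_pos_eq in HN; lra. }
  pose proof ln2_pos as H2.
  destruct (Req_dec x 0) as [->|Hn].
  - intros e He.
    set (e1 := Rmin 1 ((e * ln 2 / 2) ^ 2)).
    assert (Hq : 0 < e * ln 2 / 2) by nra.
    assert (He1 : 0 < e1) by (apply Rmin_glb_lt; [lra|apply pow_lt; assumption]).
    destruct (Hc e1 He1) as [N HN]. exists N. intros n Hn.
    specialize (HN n Hn). unfold Rdist in *. rewrite Rminus_0_r, Rabs_pos_eq in HN by apply Hu.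
    rewrite (xlog2_mult_log2 0), Rmult_0_l, Rminus_0_r.
    pose proof (Rmin_l 1 ((e * ln 2 / 2) ^ 2)). pose proof (Rmin_r 1 ((e * ln 2 / 2) ^ 2)).
    fold e1 in H, H0. specialize (Hu n).
    eapply Rle_lt_trans; [apply xlog2_sqrt_bound; lra|].
    assert (Hs : sqrt (u n) < e * ln 2 / 2).
    { rewrite <- (sqrt_pow2 (e * ln 2 / 2)) by lra. apply sqrt_lt_1; try lra. }
    apply Rmult_lt_reg_r with (ln 2); [assumption|].
    unfold Rdiv. rewrite Rmult_assoc, Rinv_l; lra.
  - rewrite xlog2_mult_log2. eapply Un_cv_ext; [intros n; symmetry; apply xlog2_mult_log2|].
    apply (CV_mult u (fun n => log2 (u n))); [assumption|].
    apply (CV_mult (fun n => ln (u n)) (fun _ => / ln 2)); [|apply Un_cv_const].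
    apply (continuity_seq ln u x); [|assumption].
    apply derivable_continuous_pt. exists (/ x). apply derivable_pt_lim_ln. lra.
Qed.

Lemma Un_cv_sumR {A} (f : nat -> A -> R) (g : A -> R) l :
  (forall a, In a l -> Un_cv (fun n => f n a) (g a)) ->
  Un_cv (fun n => sumR (f n) l) (sumR g l).
Proof.
  induction l as [|a l IH]; intros H; [exact (Un_cv_const 0)|].
  apply (CV_plus (fun n => f n a) (fun n => sumR (f n) l)).
  - apply H; left; reflexivity.
  - apply IH; intros; apply H; right; assumption.
Qed.

Lemma Un_cv_scal c u l : Un_cv u l -> Un_cv (fun n => c * u n) (c * l).
Proof. intros H. apply (CV_mult (fun _ => c) u); [apply Un_cv_const|assumption]. Qed.

Lemma Un_cv_le u l c : (forall n : nat, u n <= c) -> Un_cv u l -> l <= c.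
Proof.
  intros H Hc. destruct (Rle_lt_dec l c) as [|Hlt]; [assumption|].
  destruct (Hc (l - c)) as [N HN]; [lra|]. specialize (HN N (le_n N)). specialize (H N).
  unfold Rdist in HN. rewrite Rabs_left1 in HN; lra.
Qed.

Lemma Un_cv_ge u l c : (forall n : nat, c <= u n) -> Un_cv u l -> c <= l.
Proof.
  intros H Hc. destruct (Rle_lt_dec c l) as [|Hlt]; [assumption|].
  destruct (Hc (c - l)) as [N HN]; [lra|]. specialize (HN N (le_n N)). specialize (H N).
  unfold Rdist in HN. rewrite Rabs_pos_eq in HN; lra.
Qed.

Lemma Un_cv_sub u l (phi : nat -> nat) : (forall n, (n <= phi n)%nat) -> Un_cv u l ->
  Un_cv (fun n => u (phi n)) l.
Proof.
  intros Hphi H e He. destruct (H e He) as [N HN]. exists N. intros n Hn. apply HN.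
  specialize (Hphi n). lia.
Qed.

(** Extraction is recorded by [n <= phi n] instead of strict monotonicity: limits pass along such a
    [phi], and the property survives composition when several coordinates are treated in turn. *)
Lemma bounded_subseq (u : nat -> R) : (forall n, 0 <= u n <= 1) ->
  exists phi l, (forall n, (n <= phi n)%nat) /\ Un_cv (fun n => u (phi n)) l.
Proof.
  intros Hu.
  destruct (Bolzano_Weierstrass u (fun x => 0 <= x <= 1) (compact_P3 0 1) Hu) as [l Hl].
  assert (Hex : forall n, exists m, (n <= m)%nat /\ Rabs (u m - l) < / INR (S n)).
  { intros n. assert (Hpos : 0 < / INR (S n)) by (apply Rinv_0_lt_compat, lt_0_INR; lia).
    destruct (Hl (disc l (mkposreal _ Hpos)) n) as (m & Hm & Hd).
    - exists (mkposreal _ Hpos). intros x Hx; exact Hx.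
    - exists m. split; [assumption|exact Hd]. }
  exists (fun n => proj1_sig (constructive_indefinite_description _ (Hex n))), l.
  split.
  - intros n. destruct constructive_indefinite_description as [m Hm]. apply Hm.
  - intros e He. destruct (archimed_cor1 e He) as (N & HN & HN0).
    exists N. intros n Hn. destruct constructive_indefinite_description as [m Hm]. simpl.
    destruct Hm as [_ Hm]. unfold Rdist. eapply Rlt_trans; [exact Hm|].
    eapply Rle_lt_trans; [|exact HN]. apply Rinv_le_contravar; [apply lt_0_INR; lia|].
    apply le_INR. lia.
Qed.

Lemma bounded_subseq_list {A} (u : A -> nat -> R) (l : list A) :
  (forall a n, In a l -> 0 <= u a n <= 1) ->
  exists phi, (forall n, (n <= phi n)%nat) /\
    forall a, In a l -> exists x, Un_cv (fun n => u a (phi n)) x.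
Proof.
  induction l as [|a l IH]; intros H.
  - exists (fun n => n). split; [lia|]. intros ? [].
  - destruct IH as (phi & Hphi & Hcv); [intros; apply H; right; assumption|].
    destruct (bounded_subseq (fun n => u a (phi n))) as (psi & x & Hpsi & Hx).
    { intros; apply H; left; reflexivity. }
    exists (fun n => phi (psi n)). split.
    + intros n. specialize (Hpsi n). specialize (Hphi (psi n)). lia.
    + intros b [<-|Hb]; [exists x; assumption|].
      destruct (Hcv b Hb) as [y Hy]. exists y.
      apply (Un_cv_sub (fun n => u b (phi n)) y psi Hpsi Hy).
Qed.

Section Continuity.
Variables p d : R.
Hypothesis Hp : 0 <= p <= 1.
Hypothesis Hd : 0 <= d <= 1.
Variable g : nat -> bool -> R.
Variable g0 : bool -> R.
Hypothesis Hg : forall n y, 0 <= g n y.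
Hypothesis Hcv : forall y, Un_cv (fun n => g n y) (g0 y).

Lemma atom_limit_nonneg y : 0 <= g0 y.
Proof. apply Un_cv_ge with (fun n => g n y); [intros; apply Hg|apply Hcv]. Qed.

Lemma atU_continuous : Un_cv (fun n => atU p d (g n)) (atU p d g0).
Proof. apply Un_cv_sumR. intros; apply Un_cv_scal, Hcv. Qed.

Lemma atZ_continuous z : Un_cv (fun n => atZ p d (g n) z) (atZ p d g0 z).
Proof. apply Un_cv_sumR. intros; apply Un_cv_scal, Hcv. Qed.

Lemma atomI_continuous : Un_cv (fun n => atomI p d (g n)) (atomI p d g0).
Proof.
  rewrite atomI_xlog2 by (auto using atom_limit_nonneg).
  eapply Un_cv_ext.
  { intros n. symmetry. apply atomI_xlog2; auto. }
  apply CV_minus; [|apply xlog2_continuous_seq; [intros; apply atU_nonneg; auto|apply atU_continuous]].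
  apply Un_cv_sumR. intros y _.
  apply (CV_minus (fun n => xlog2 (mY p d y * g n y))).
  - apply xlog2_continuous_seq; [|apply Un_cv_scal, Hcv].
    intros; apply Rmult_le_pos; [apply mY_nonneg; assumption|apply Hg].
  - apply (CV_mult (fun n => mY p d y * g n y) (fun _ => log2 (mY p d y)));
      [apply Un_cv_scal, Hcv|apply Un_cv_const].
Qed.

Lemma atomH_continuous : Un_cv (fun n => atomH p d (g n)) (atomH p d g0).
Proof.
  rewrite atomH_xlog2 by (auto using atom_limit_nonneg).
  eapply Un_cv_ext.
  { intros n. symmetry. apply atomH_xlog2; auto. }
  apply CV_minus; [apply xlog2_continuous_seq; [intros; apply atU_nonneg; auto|apply atU_continuous]|].
  apply Un_cv_sumR. intros z _.
  apply xlog2_continuous_seq; [intros; apply atZ_nonneg; auto|apply atZ_continuous].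
Qed.

End Continuity.

(** The column of a symbol emitted with probability [c] whatever [Y_1] is. *)
Definition erasure (c : R) : bool -> R := fun _ => c.

Lemma atomI_erasure p d c : 0 <= c -> atomI p d (erasure c) = 0.
Proof.
  intros Hc. unfold atomI. apply sumR_0. intros y _.
  replace (atU p d (erasure c)) with c; [apply plog_refl|].
  unfold atU, erasure. rewrite sumR_scal_r, mY_sum. ring.
Qed.

Lemma atomH_erasure p d c : 0 <= c -> atomH p d (erasure c) = c * h p.
Proof.
  intros Hc.
  rewrite (atomH_ext p d _ (fun y => c * erasure 1 y)) by (intros; unfold erasure; ring).
  rewrite atomH_scal by assumption. f_equal. unfold atomH.
  replace (atU p d (erasure 1)) with 1 by (unfold atU, erasure; rewrite sumR_scal_r, mY_sum; ring).
  rewrite (sumR_ext _ (fun z => xlog2 (ber p z))).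
  - rewrite sumR_bools. unfold h; simpl. ring.
  - intros z _. replace (atZ p d (erasure 1) z) with (ber p z).
    + rewrite plog_mult_log2, xlog2_mult_log2. unfold Rdiv. rewrite Rinv_1, Rmult_1_r. reflexivity.
    + unfold atZ, erasure. rewrite sumR_scal_r, jZY_sum_y. ring.
Qed.

Lemma h_le_1 q : 0 <= q <= 1 -> h q <= 1.
Proof.
  intros Hq. pose proof ln2_pos.
  assert (Hl : log2 (/ 2) = -1) by (rewrite log2_inv, log2_2; lra).
  assert (Hb : forall a, 0 <= a -> (a - / 2) / ln 2 <= xlog2 a + a).
  { intros a Ha. replace (xlog2 a + a) with (plog a (/ 2)); [apply plog_ge; lra|].
    rewrite plog_xlog2, Hl by lra. ring. }
  pose proof (Hb q). pose proof (Hb (1 - q)). unfold h.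
  assert (E : (q - / 2) / ln 2 + (1 - q - / 2) / ln 2 = 0) by (field; lra).
  lra.
Qed.

Lemma kernel_le_1 k q y u : kernel k q -> (u < k)%nat -> q y u <= 1.
Proof.
  intros [H1 H2] Hu. rewrite <- (H2 y). apply sumR_term_le.
  - intros v Hv. apply in_seq in Hv. apply H1. lia.
  - apply in_seq. lia.
Qed.

Lemma HZgU_nonneg p d k q : 0 <= p <= 1 -> 0 <= d <= 1 -> kernel k q -> 0 <= HZgU p d k q.
Proof.
  intros Hp Hd Hq. rewrite HZgU_atoms. apply sumR_nonneg. intros u Hu. apply in_seq in Hu.
  apply atomH_nonneg; try assumption. intros y. apply Hq. lia.
Qed.

Lemma kernel_max_exists p d r : 0 <= p <= 1 -> 0 <= d <= 1 -> 0 <= r ->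
  exists q, kernel 4 q /\ IUY1 p d 4 q <= r /\
    forall q', kernel 4 q' -> IUY1 p d 4 q' <= r -> 1 - HZgU p d 4 q' <= 1 - HZgU p d 4 q.
Proof.
  intros Hp Hd Hr.
  set (E := fun x => exists q, kernel 4 q /\ IUY1 p d 4 q <= r /\ x = 1 - HZgU p d 4 q).
  destruct (completeness E) as [C [HC1 HC2]].
  - exists 1. intros x (q & Hq & _ & ->). pose proof (HZgU_nonneg p d 4 q Hp Hd Hq). lra.
  - set (gs := erasure 1 :: repeat (erasure 0) 3).
    assert (Hat : atoms 1 gs).
    { split.
      - intros g [<-|Hg] y; [unfold erasure; lra|]. apply repeat_spec in Hg. subst. unfold erasure; lra.
      - intros y. unfold gs, erasure, sumR; simpl. lra. }
    exists (1 - HZgU p d 4 (kernel_of_atoms gs)). exists (kernel_of_atoms gs).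
    split; [apply (kernel_of_atoms_spec gs Hat)|]. split; [|reflexivity].
    change 4%nat with (length gs). rewrite IUY1_of_atoms by assumption.
    rewrite sumR_0; [assumption|]. intros g [<-|Hg]; [apply atomI_erasure; lra|].
    apply repeat_spec in Hg. subst. apply atomI_erasure; lra.
  - assert (Hex : forall n : nat, exists q, kernel 4 q /\ IUY1 p d 4 q <= r /\
       C - / INR (S n) <= 1 - HZgU p d 4 q).
    { intros n. destruct (excluded_middle_informative (exists q, kernel 4 q /\ IUY1 p d 4 q <= r /\
       C - / INR (S n) <= 1 - HZgU p d 4 q)) as [|Hno]; [assumption|exfalso].
      assert (0 < / INR (S n)) by (apply Rinv_0_lt_compat, lt_0_INR; lia).
      assert (C <= C - / INR (S n)); [|lra].
      apply HC2. intros x (q & Hq1 & Hq2 & ->).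
      destruct (Rle_lt_dec (1 - HZgU p d 4 q) (C - / INR (S n))) as [|Hlt]; [assumption|].
      exfalso. apply Hno. exists q. split; [assumption|]. split; [assumption|lra]. }
    set (Q := fun n => proj1_sig (constructive_indefinite_description _ (Hex n))).
    assert (HQ : forall n, kernel 4 (Q n) /\ IUY1 p d 4 (Q n) <= r /\
       C - / INR (S n) <= 1 - HZgU p d 4 (Q n)).
    { intros n. unfold Q. destruct constructive_indefinite_description as [q Hq]. exact Hq. }
    destruct (bounded_subseq_list (fun yu n => Q n (fst yu) (snd yu)) (list_prod bools (seq 0 4)))
      as (phi & Hphi & Hcv).
    { intros [y u] n Hyu. apply in_prod_iff in Hyu. destruct Hyu as [_ Hu]. apply in_seq in Hu.
      destruct (HQ n) as [Hk _]. simpl. split; [apply Hk; lia|].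
      apply kernel_le_1 with 4%nat; [assumption|lia]. }
    (* Stated for all pairs so that choice yields a total function; outside the eight relevant
       entries the value is the arbitrary 0. *)
    assert (Hlim : forall yu, exists x, In yu (list_prod bools (seq 0 4)) ->
              Un_cv (fun n => Q (phi n) (fst yu) (snd yu)) x).
    { intros yu. destruct (excluded_middle_informative (In yu (list_prod bools (seq 0 4)))) as [Hi|Hn].
      - destruct (Hcv yu Hi) as [x Hx]. exists x. intros _; exact Hx.
      - exists 0. tauto. }
    set (q := fun y u => proj1_sig (constructive_indefinite_description _ (Hlim (y, u)))).
    assert (Hq : forall y u, (u < 4)%nat -> Un_cv (fun n => Q (phi n) y u) (q y u)).
    { intros y u Hu. unfold q. destruct constructive_indefinite_description as [x Hx]. simpl.
      apply Hx. apply in_prod; [destruct y; simpl; tauto|apply in_seq; lia]. }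
    assert (Hk : kernel 4 q).
    { split.
      - intros y u Hu. apply Un_cv_ge with (fun n => Q (phi n) y u); [|apply Hq, Hu].
        intros n. apply (HQ (phi n)), Hu.
      - intros y. apply UL_sequence with (fun n => sumR (Q (phi n) y) (seq 0 4)).
        + apply Un_cv_sumR. intros u Hu. apply in_seq in Hu. apply Hq. lia.
        + eapply Un_cv_ext; [|apply Un_cv_const]. intros n. symmetry. apply (HQ (phi n)). }
    exists q. split; [assumption|]. split.
    + apply Un_cv_le with (fun n => IUY1 p d 4 (Q (phi n))); [intros; apply HQ|].
      rewrite IUY1_atoms by assumption.
      eapply Un_cv_ext; [intros n; symmetry; apply IUY1_atoms, HQ|].
      apply Un_cv_sumR. intros u Hu. apply in_seq in Hu.
      apply (atomI_continuous p d Hp Hd (fun n y => Q (phi n) y u)).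
      * intros n y. apply HQ. lia.
      * intros y. apply Hq. lia.
    + intros q' Hq'1 Hq'2. apply Rle_trans with C; [apply HC1; exists q'; tauto|].
      apply Un_cv_ge with (fun n => 1 - HZgU p d 4 (Q (phi n)) + / INR (S (phi n))).
      { intros n. destruct (HQ (phi n)) as (_ & _ & H). lra. }
      rewrite <- (Rplus_0_r (1 - HZgU p d 4 q)).
      apply (CV_plus (fun n => 1 - HZgU p d 4 (Q (phi n)))).
      * apply (CV_minus (fun _ => 1)); [apply Un_cv_const|].
        rewrite HZgU_atoms. eapply Un_cv_ext; [intros n; symmetry; apply HZgU_atoms|].
        apply Un_cv_sumR. intros u Hu. apply in_seq in Hu.
        apply (atomH_continuous p d Hp Hd (fun n y => Q (phi n) y u)).
        -- intros n y. apply HQ. lia.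
        -- intros y. apply Hq. lia.
      * apply (Un_cv_sub (fun n => / INR (S n)) 0 phi Hphi).
        intros e He. destruct (archimed_cor1 e He) as (N & HN & HN0).
        exists N. intros n Hn. unfold Rdist. rewrite Rminus_0_r.
        assert (0 < / INR (S n)) by (apply Rinv_0_lt_compat, lt_0_INR; lia).
        rewrite Rabs_pos_eq by lra. eapply Rle_lt_trans; [|exact HN].
        apply Rinv_le_contravar; [apply lt_0_INR; lia|apply le_INR; lia].
Qed.


(** * Error probability after a change of variables *)

Lemma map_xorb_nth (f : nat -> bool) z n : length z = n ->
  map (fun i => xorb (f i) (nth i z false)) (seq 0 n) = xorl (map f (seq 0 n)) z.
Proof.
  revert f z; induction n; intros f [|b z] H; try discriminate; [reflexivity|].
  rewrite <- cons_seq, <- seq_shift. simpl. rewrite !map_map.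
  f_equal. apply (IHn (fun i => f (S i))). simpl in H; congruence.
Qed.

Lemma map_nth_seq {A} (z : list A) a n : length z = n -> map (fun i => nth i z a) (seq 0 n) = z.
Proof.
  revert z; induction n; intros [|b z] H; try discriminate; [reflexivity|].
  rewrite <- cons_seq, <- seq_shift. simpl. rewrite !map_map. f_equal.
  apply IHn. simpl in H; congruence.
Qed.

Definition codeword (c : code) (n w : nat) : list bool := map (enc c w) (seq 0 n).
Definition relayword (c : code) (n : nat) (y : list bool) : list bool :=
  map (fun i => relay c i (firstn i y)) (seq 0 n).

Lemma codeword_length c n w : length (codeword c n w) = n.
Proof. unfold codeword. rewrite length_map, length_seq; reflexivity. Qed.

Lemma relayword_length c n y : length (relayword c n y) = n.
Proof. unfold relayword. rewrite length_map, length_seq; reflexivity. Qed.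

Definition err_at (n : nat) (c : code) (w : nat) (z s : list bool) : R :=
  if Nat.eqb (dec c (xorl (codeword c n w) z) s) w then 0 else 1.

Lemma err_ind_xorl n c w z v nn : length z = n -> length v = n -> length nn = n ->
  err_ind n c w z v nn = err_at n c w z (xorl (relayword c n (xorl z v)) nn).
Proof.
  intros Hz Hv Hn. unfold err_ind, err_at, codeword, relayword.
  rewrite (map_xorb_nth (fun i => nth i z false) v n Hv).
  rewrite (map_nth_seq z false n Hz).
  rewrite (map_xorb_nth (enc c w) z n Hz).
  rewrite (map_xorb_nth (fun i => relay c i (firstn i (xorl z v))) nn n Hn). reflexivity.
Qed.

Lemma prodber_xorl q z y : prodber q (xorl z y) = wprod2 (fun a b => ber q (xorb a b)) z y.
Proof.
  revert y; induction z as [|a z IH]; intros [|b y]; try reflexivity.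
  simpl xorl. rewrite prodber_wprod, wprod_cons, <- prodber_wprod, IH, wprod2_cons. reflexivity.
Qed.

Lemma wprod2_jZY p d z y : length z = length y ->
  wprod2 (jZY p d) z y = prodber p z * prodber d (xorl z y).
Proof.
  intros H. rewrite prodber_xorl. apply (wprod2_mult_l (fun a b => ber d (xorb a b)) (ber p)), H.
Qed.

(** For fixed [z], the noise [v] is exchanged for the relay's observation [y]. Only then is the
    relay word a fixed word, so that the link noise can be exchanged for the received [s]. *)
Lemma Perr_change p d eps n M c : Perr p d eps n M c = / INR M * sumR (fun w =>
  sumR (fun z => sumR (fun y => sumR (fun s =>
    wprod2 (jZY p d) z y * prodber eps (xorl (relayword c n y) s) * err_at n c w z s)
    (bitseqs n)) (bitseqs n)) (bitseqs n)) (seq 0 M).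
Proof.
  unfold Perr. f_equal. apply sumR_ext; intros w _. apply sumR_ext; intros z Hz.
  apply in_bitseqs in Hz.
  etransitivity; [|apply (sumR_bitseqs_xorl _ z n Hz)].
  apply sumR_ext; intros v Hv. apply in_bitseqs in Hv.
  assert (Hzv : length (xorl z v) = n) by (rewrite xorl_length; congruence).
  etransitivity; [|apply (sumR_bitseqs_xorl _ (relayword c n (xorl z v)) n), relayword_length].
  apply sumR_ext; intros nn Hn. apply in_bitseqs in Hn.
  rewrite err_ind_xorl by assumption.
  rewrite wprod2_jZY by congruence.
  rewrite !xorl_cancel by (rewrite ?relayword_length; congruence). reflexivity.
Qed.

(** * Converse *)

Lemma sumR_indicator_le_1 (f : nat -> R) M k : (forall w, 0 <= f w <= 1) ->
  (forall w, w <> k -> f w = 0) -> sumR f (seq 0 M) <= 1.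
Proof.
  intros H1 H2. generalize 0%nat. induction M; intros a; simpl seq.
  - unfold sumR; simpl; lra.
  - rewrite sumR_cons. specialize (IHM (S a)).
    destruct (Nat.eq_dec a k) as [->|Hn]; [|rewrite (H2 a Hn); lra].
    rewrite sumR_0; [specialize (H1 k); lra|].
    intros b Hb. apply in_seq in Hb. apply H2. lia.
Qed.

(** The law of [(Z^n, S^n)]. It does not involve the message, as the relay hears only noise; thus
    [S^n] is side information about the noise alone. *)
Definition jointZS p d eps n c (z s : list bool) : R :=
  sumR (fun y => wprod2 (jZY p d) z y * prodber eps (xorl (relayword c n y) s)) (bitseqs n).
Definition margS p d eps n c (s : list bool) : R :=
  sumR (fun z => jointZS p d eps n c z s) (bitseqs n).

Section Converse.
Variables p d eps : R.
Hypothesis Hp : 0 <= p <= 1.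
Hypothesis Hd : 0 <= d <= 1.
Hypothesis He : 0 <= eps <= 1.

Lemma sumR_wprod2_jZY n : sumR (fun z => sumR (wprod2 (jZY p d) z) (bitseqs n)) (bitseqs n) = 1.
Proof.
  rewrite <- (sumR_prodber p n). apply sumR_ext; intros z Hz. apply in_bitseqs in Hz.
  rewrite <- words_bools, sumR_wprod2_r by assumption. rewrite prodber_wprod.
  apply wprod_ext; intros; apply jZY_sum_y.
Qed.

Lemma jointZS_nonneg n c z s : 0 <= jointZS p d eps n c z s.
Proof.
  apply sumR_nonneg. intros y _. apply Rmult_le_pos; [|apply prodber_nonneg, He].
  apply wprod2_nonneg; intros; apply jZY_nonneg; assumption.
Qed.

Lemma jointZS_sum n c :
  sumR (fun z => sumR (jointZS p d eps n c z) (bitseqs n)) (bitseqs n) = 1.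
Proof.
  rewrite <- (sumR_wprod2_jZY n). apply sumR_ext; intros z _. unfold jointZS.
  rewrite sumR_swap. apply sumR_ext; intros y _.
  rewrite sumR_scal, (sumR_bitseqs_xorl (prodber eps)) by apply relayword_length.
  rewrite sumR_prodber. ring.
Qed.

Lemma Perr_jointZS n M c : Perr p d eps n M c =
  / INR M * sumR (fun w => sumR (fun z => sumR (fun s =>
    jointZS p d eps n c z s * err_at n c w z s) (bitseqs n)) (bitseqs n)) (seq 0 M).
Proof.
  rewrite Perr_change. f_equal. apply sumR_ext; intros w _. apply sumR_ext; intros z _.
  rewrite sumR_swap. apply sumR_ext; intros s _. unfold jointZS.
  rewrite <- sumR_scal_r. reflexivity.
Qed.

Lemma err_at_bounds n c w z s : 0 <= err_at n c w z s <= 1.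
Proof. unfold err_at. destruct Nat.eqb; lra. Qed.

(* Under the measure where [(W, Y, S)] are independent with [W], [Y] uniform, a decoder is
   correct with probability at most [1/M]; tilting it by [M] on correct decoding at most
   doubles its mass, and Gibbs' inequality against the tilted measure gives Fano's bound. *)
Lemma fano n M c : (0 < M)%nat ->
  (1 - Perr p d eps n M c) * log2 (INR M) <= INR n + 1
    + sumR (fun s => sumR (fun z => plog (jointZS p d eps n c z s) (margS p d eps n c s))
        (bitseqs n)) (bitseqs n).
Proof.
  intros HM. assert (HMp : 0 < INR M) by (apply lt_0_INR, HM). pose proof ln2_pos as Hl2.
  set (Pj := jointZS p d eps n c). set (Ps := margS p d eps n c).
  set (B := bitseqs n). set (W := seq 0 M).
  set (E := err_at n c).
  assert (H2n : 0 < 2 ^ n) by (apply pow_lt; lra).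
  assert (HE : forall w z s, E w z s = 0 \/ E w z s = 1).
  { intros w z s. unfold E, err_at. destruct Nat.eqb; [left|right]; reflexivity. }
  set (K := fun w z s => (1 - E w z s) * INR M + E w z s).
  assert (HK : forall w z s, 0 < K w z s /\ log2 (K w z s) = (1 - E w z s) * log2 (INR M)).
  { intros w z s. unfold K. destruct (HE w z s) as [-> | ->].
    - replace ((1 - 0) * INR M + 0) with (INR M) by ring. split; [assumption|ring].
    - replace ((1 - 1) * INR M + 1) with 1 by ring. rewrite log2_1. split; [lra|ring]. }
  assert (HPj : forall z s, 0 <= Pj z s) by (intros; apply jointZS_nonneg).
  assert (HPs : forall s, 0 <= Ps s) by (intros; apply sumR_nonneg; intros; apply HPj).
  assert (H0 : forall z s, In z B -> Ps s = 0 -> Pj z s = 0).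
  { intros z s Hz Hs. apply (sumR_eq_0 (fun z => Pj z s) B z); auto. }
  assert (HlenW : INR (length W) = INR M) by (unfold W; rewrite length_seq; reflexivity).
  assert (HPs1 : sumR Ps B = 1).
  { rewrite <- (jointZS_sum n c), sumR_swap. reflexivity. }
  assert (Hb1 : sumR (fun _ : list bool => 1) B = 2 ^ n) by apply sumR_bitseqs_1.
  (* For fixed [s], translation by the codeword of [w] replaces [z] by the received word, and each
     received word is decoded to a single message. *)
  assert (Hcorr : forall s, sumR (fun w => sumR (fun z => 1 - E w z s) B) W <= 2 ^ n).
  { intros s. rewrite (sumR_ext _ (fun w => sumR (fun y => if Nat.eqb (dec c y s) w then 1 else 0) B)).
    - rewrite sumR_swap, <- Hb1. apply sumR_le; intros y _.
      apply sumR_indicator_le_1 with (dec c y s).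
      + intros w; destruct Nat.eqb; lra.
      + intros w Hw. destruct (Nat.eqb_spec (dec c y s) w); congruence.
    - intros w _. etransitivity; [|apply (sumR_bitseqs_xorl _ (codeword c n w) n), codeword_length].
      apply sumR_ext; intros z _. unfold E, err_at. destruct Nat.eqb; ring. }
  (* [/ 2 ^ n] is the uniform law of the received word and the further half undoes the doubling of
     mass by the tilt; their logarithms are the [n + 1] of the bound. *)
  assert (HQ : sumR (fun w => sumR (fun z => sumR (fun s => / 2 ^ n / 2 * K w z s * Ps s) B) B) W
      <= INR M).
  { rewrite (sumR_ext _ (fun w => sumR (fun s => sumR (fun z => / 2 ^ n / 2 * K w z s * Ps s) B) B))
      by (intros; apply sumR_swap).
    rewrite sumR_swap.
    apply Rle_trans with (sumR (fun s => INR M * Ps s) B); [|rewrite sumR_scal, HPs1; lra].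
    apply sumR_le; intros s _.
    rewrite (sumR_ext _ (fun w => / 2 ^ n / 2 * Ps s * sumR (fun z => K w z s) B)).
    2:{ intros w _. rewrite <- sumR_scal. apply sumR_ext; intros; ring. }
    rewrite sumR_scal.
    assert (HKs : sumR (fun w => sumR (fun z => K w z s) B) W <= 2 * INR M * 2 ^ n).
    { apply Rle_trans with (sumR (fun w => sumR (fun z => INR M * (1 - E w z s) + 1) B) W).
      - apply sumR_le; intros w _. apply sumR_le; intros z _. unfold K.
        destruct (HE w z s) as [-> | ->]; lra.
      - rewrite (sumR_ext _ (fun w => INR M * sumR (fun z => 1 - E w z s) B + 2 ^ n)).
        2:{ intros w _. rewrite sumR_plus, sumR_scal, Hb1. reflexivity. }
        rewrite sumR_plus, sumR_scal, sumR_const, HlenW. specialize (Hcorr s). nra. }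
    apply Rle_trans with (/ 2 ^ n / 2 * Ps s * (2 * INR M * 2 ^ n)).
    - apply Rmult_le_compat_l; [|assumption]. apply Rmult_le_pos; [|apply HPs].
      apply Rmult_le_pos; [left; apply Rinv_0_lt_compat; assumption|lra].
    - right. field. lra. }
  assert (Hg : (sumR (fun w => sumR (fun z => sumR (fun s => Pj z s) B) B) W
     - sumR (fun w => sumR (fun z => sumR (fun s => / 2 ^ n / 2 * K w z s * Ps s) B) B) W) / ln 2
     <= sumR (fun w => sumR (fun z => sumR (fun s =>
          plog (Pj z s) (Ps s) + ((INR n + 1) * Pj z s - Pj z s * (1 - E w z s) * log2 (INR M)))
          B) B) W).
  { unfold Rdiv at 1. rewrite <- sumR_minus, <- sumR_scal_r. apply sumR_le; intros w _.
    rewrite <- sumR_minus, <- sumR_scal_r. apply sumR_le; intros z Hz.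
    rewrite <- sumR_minus, <- sumR_scal_r. apply sumR_le; intros s _.
    destruct (HK w z s) as [HK1 HK2].
    assert (Hc : 0 < / 2 ^ n / 2 * K w z s).
    { apply Rmult_lt_0_compat; [|assumption]. apply Rdiv_lt_0_compat; [|lra].
      apply Rinv_0_lt_compat; assumption. }
    eapply Rle_trans; [apply (plog_ge (Pj z s) (/ 2 ^ n / 2 * K w z s * Ps s))|].
    - apply HPj.
    - apply Rmult_le_pos; [lra|apply HPs].
    - intros Hz0. apply Rmult_integral in Hz0. apply H0; [assumption|]. destruct Hz0; lra.
    - right. rewrite plog_scale_r; auto.
      assert (Hi2 : 0 < / 2 ^ n) by (apply Rinv_0_lt_compat; assumption).
      rewrite log2_mult, HK2, log2_div, log2_inv, log2_2 by lra.
      replace (log2 (2 ^ n)) with (INR n); [ring|].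
      rewrite <- Rpower_pow, log2_Rpower by lra. reflexivity. }
  assert (HPjw : sumR (fun w => sumR (fun z => sumR (fun s => Pj z s) B) B) W = INR M).
  { rewrite sumR_const, HlenW. unfold B, Pj. rewrite jointZS_sum. ring. }
  assert (Hge : 0 <= (sumR (fun w => sumR (fun z => sumR (fun s => Pj z s) B) B) W
     - sumR (fun w => sumR (fun z => sumR (fun s => / 2 ^ n / 2 * K w z s * Ps s) B) B) W) / ln 2).
  { apply Rmult_le_pos; [lra|left; apply Rinv_0_lt_compat; assumption]. }
  pose proof (Rle_trans _ _ _ Hge Hg) as Hfin. clear Hg Hge HQ.
  set (D := sumR (fun s => sumR (fun z => plog (Pj z s) (Ps s)) B) B).
  assert (Hexp : sumR (fun w => sumR (fun z => sumR (fun s =>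
          plog (Pj z s) (Ps s) + ((INR n + 1) * Pj z s - Pj z s * (1 - E w z s) * log2 (INR M)))
          B) B) W = INR M * (D + (INR n + 1) - (1 - Perr p d eps n M c) * log2 (INR M))).
  { rewrite (sumR_ext _ (fun w => D + (INR n + 1) - log2 (INR M)
       + log2 (INR M) * sumR (fun z => sumR (fun s => Pj z s * E w z s) B) B)).
    - rewrite sumR_plus, sumR_const, HlenW, sumR_scal, Perr_jointZS. fold B W Pj E.
      field. lra.
    - intros w _.
      rewrite (sumR_ext _ (fun z => sumR (fun s => plog (Pj z s) (Ps s)) B
         + ((INR n + 1 - log2 (INR M)) * sumR (fun s => Pj z s) B
         + log2 (INR M) * sumR (fun s => Pj z s * E w z s) B))).
      + rewrite !sumR_plus, !sumR_scal. unfold B at 3 4, Pj at 2. rewrite jointZS_sum.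
        rewrite (sumR_swap (fun z s => plog (Pj z s) (Ps s))). fold D. ring.
      + intros z _. rewrite <- !sumR_scal, <- !sumR_plus. apply sumR_ext; intros; ring. }
  rewrite Hexp in Hfin.
  assert (0 <= D + (INR n + 1) - (1 - Perr p d eps n M c) * log2 (INR M)); [|lra].
  apply Rmult_le_reg_l with (INR M); [assumption|lra].
Qed.

(** * Single-letterization *)

(** With [t y = P(S^n = s | Y_1^n = y)], [GZ] is [P(Z^n = z, S^n = s)] and [EU] is [P(S^n = s)];
    [blockI] and [blockH] are the shares of [s] in [I(Y_1^n; S^n)] and [H(Z^n | S^n)]. *)
Definition GZ (n : nat) (t : list bool -> R) (z : list bool) : R :=
  sumR (fun y => wprod2 (jZY p d) z y * t y) (bitseqs n).
Definition EU (n : nat) (t : list bool -> R) : R :=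
  sumR (fun y => wprod (mY p d) y * t y) (bitseqs n).
Definition blockI (n : nat) (t : list bool -> R) : R :=
  sumR (fun y => plog (wprod (mY p d) y * t y) (wprod (mY p d) y * EU n t)) (bitseqs n).
Definition blockH (n : nat) (t : list bool -> R) : R :=
  - sumR (fun z => plog (GZ n t z) (EU n t)) (bitseqs n).

(* The single-letter auxiliary variable [U_i = (Y_1^{i-1}, S^n)] of the converse, one list of
   atoms for each value [s], where [t y = P(S^n = s | Y_1^n = y)]. *)
Fixpoint chain_atoms (n : nat) (t : list bool -> R) : list (bool -> R) :=
  match n with
  | O => nil
  | S k => (fun b => EU k (fun y => t (b :: y))) ::
      flat_map (fun b => map (fun g y => mY p d b * g y) (chain_atoms k (fun y => t (b :: y)))) bools
  end.

Lemma wprod_mY_nonneg y : 0 <= wprod (mY p d) y.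
Proof. apply wprod_nonneg; intros; apply mY_nonneg; assumption. Qed.

Lemma EU_nonneg n t : (forall y, 0 <= t y) -> 0 <= EU n t.
Proof. intros H. apply sumR_nonneg; intros. apply Rmult_le_pos; [apply wprod_mY_nonneg|apply H]. Qed.

Lemma GZ_nonneg n t z : (forall y, 0 <= t y) -> 0 <= GZ n t z.
Proof.
  intros H. apply sumR_nonneg; intros. apply Rmult_le_pos; [|apply H].
  apply wprod2_nonneg; intros; apply jZY_nonneg; assumption.
Qed.

Lemma GZ_sum n t : sumR (GZ n t) (bitseqs n) = EU n t.
Proof.
  unfold GZ, EU. rewrite sumR_swap. apply sumR_ext; intros y Hy. apply in_bitseqs in Hy.
  rewrite sumR_scal_r. f_equal. rewrite <- words_bools. apply sumR_wprod2_l, Hy.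
Qed.

Lemma EU_S n t : EU (S n) t = atU p d (fun b => EU n (fun y => t (b :: y))).
Proof.
  unfold EU at 1. rewrite <- words_bools, sumR_words_S. apply sumR_ext; intros b _.
  unfold EU. rewrite words_bools, <- sumR_scal. apply sumR_ext; intros y _.
  rewrite wprod_cons. ring.
Qed.

Lemma GZ_cons n t b z :
  GZ (S n) t (b :: z) = sumR (fun a => jZY p d b a * GZ n (fun y => t (a :: y)) z) bools.
Proof.
  unfold GZ at 1. rewrite <- words_bools, sumR_words_S. apply sumR_ext; intros a _.
  unfold GZ. rewrite words_bools, <- sumR_scal. apply sumR_ext; intros y _.
  rewrite wprod2_cons. ring.
Qed.

(** The chain rule for divergences: passing from total [E] to [D] shifts every logarithm by the same
    constant. The weight [w] is the law of the remaining [Y_1] letters for information, and 1 for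
    entropy. *)
Lemma plog_chain {A} (l : list A) (X w : A -> R) D E :
  (forall a, In a l -> 0 <= X a) -> (forall a, In a l -> 0 <= w a) ->
  (forall a, In a l -> w a = 0 -> X a = 0) -> sumR X l = D -> 0 <= E -> (E = 0 -> D = 0) ->
  sumR (fun a => plog (X a) (w a * E)) l = sumR (fun a => plog (X a) (w a * D)) l + plog D E.
Proof.
  intros HX Hw H0 HD HE HE0.
  assert (HD0 : 0 <= D) by (rewrite <- HD; apply sumR_nonneg, HX).
  destruct (Req_dec D 0) as [E0|E0].
  { rewrite E0, plog_0_l, !sumR_0; [ring| |];
      intros a Ha; rewrite (sumR_eq_0 X l a HX) by (congruence || assumption); apply plog_0_l. }
  assert (0 < E) by (destruct (Req_dec E 0); [tauto|lra]).
  rewrite (plog_mult_log2 D), <- HD, <- sumR_scal_r, HD, <- sumR_plus.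
  apply sumR_ext; intros a Ha. specialize (HX a Ha). specialize (Hw a Ha). specialize (H0 a Ha).
  destruct (Req_dec (X a) 0) as [E1|E1]; [rewrite E1, !plog_0_l; ring|].
  assert (0 < w a) by (destruct (Req_dec (w a) 0); [tauto|lra]).
  assert (0 < w a * E) by (apply Rmult_lt_0_compat; lra).
  assert (0 < w a * D) by (apply Rmult_lt_0_compat; lra).
  rewrite (plog_trans (X a) (w a * D) (w a * E)) by lra.
  do 3 f_equal. field. lra.
Qed.

Lemma chain_atoms_nonneg n : forall t, (forall y, 0 <= t y) ->
  forall g, In g (chain_atoms n t) -> forall y, 0 <= g y.
Proof.
  induction n; intros t Ht g Hg y; [destruct Hg|].
  destruct Hg as [<-|Hg]; [apply EU_nonneg; intros; apply Ht|].
  apply in_flat_map in Hg. destruct Hg as (b & _ & Hg). apply in_map_iff in Hg.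
  destruct Hg as (g' & <- & Hg'). apply Rmult_le_pos; [apply mY_nonneg; assumption|].
  eapply IHn; [|eassumption]. intros; apply Ht.
Qed.

Lemma sumR_chain_atoms (F : (bool -> R) -> R) n t :
  (forall c g, 0 <= c -> F (fun y => c * g y) = c * F g) ->
  sumR F (chain_atoms (S n) t) = F (fun b => EU n (fun y => t (b :: y))) +
    sumR (fun b => mY p d b * sumR F (chain_atoms n (fun y => t (b :: y)))) bools.
Proof.
  intros HF. cbn [chain_atoms]. rewrite sumR_cons, sumR_flat_map. f_equal.
  apply sumR_ext; intros b _. rewrite sumR_map, <- sumR_scal.
  apply sumR_ext; intros g _. apply HF, mY_nonneg; assumption.
Qed.

(** An equality, because the letters of [Y_1^n] are independent: the information that [Y_1^{i-1}]
    and [S^n] give on the [i]-th letter is then the conditional information of the chain rule. *)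
Lemma blockI_chain n : forall t, (forall y, 0 <= t y) ->
  sumR (atomI p d) (chain_atoms n t) = blockI n t.
Proof.
  induction n; intros t Ht.
  - unfold blockI, EU. rewrite <- words_bools, !sumR_words_0. simpl. unfold sumR; simpl.
    unfold wprod; simpl. rewrite !Rmult_1_l. symmetry. apply plog_refl.
  - rewrite sumR_chain_atoms by (intros; apply atomI_scal; assumption).
    unfold blockI. rewrite <- words_bools, sumR_words_S, EU_S.
    set (g := fun b => EU n (fun y => t (b :: y))).
    assert (Hg : forall b, 0 <= g b) by (intros; apply EU_nonneg; intros; apply Ht).
    unfold atomI. rewrite <- sumR_plus. apply sumR_ext; intros b _.
    rewrite IHn by (intros; apply Ht). rewrite words_bools.
    destruct (Req_dec (mY p d b) 0) as [Hb|Hb].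
    { rewrite Hb, !Rmult_0_l, plog_0_l, sumR_0; [ring|].
      intros y _. rewrite wprod_cons, Hb, !Rmult_0_l. apply plog_0_l. }
    pose proof (mY_nonneg p d Hp Hd b) as Hb0.
    rewrite plog_homog by assumption. unfold blockI. rewrite <- Rmult_plus_distr_l, Rplus_comm.
    fold (g b). rewrite <- plog_chain.
    + rewrite <- sumR_scal. apply sumR_ext; intros y _.
      rewrite wprod_cons, <- plog_homog by assumption. f_equal; ring.
    + intros y _. apply Rmult_le_pos; [apply wprod_mY_nonneg|apply Ht].
    + intros; apply wprod_mY_nonneg.
    + intros y _ ->; ring.
    + reflexivity.
    + apply atU_nonneg; assumption.
    + intros H0. pose proof (atU_0 p d Hp Hd g b Hg H0) as Hz.
      apply Rmult_integral in Hz. tauto.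
Qed.

(** The chain rule conditions the remaining noise on the first letter of [Z]. Conditioning also on
    the first letter of [Y_1] lowers the entropy, by the log-sum inequality over its two values;
    after that the first letter of [Z] is irrelevant, since the relay depends on the past only
    through [Y_1]. *)
Lemma blockH_chain n : forall t, (forall y, 0 <= t y) ->
  sumR (atomH p d) (chain_atoms n t) <= blockH n t.
Proof.
  induction n; intros t Ht.
  - unfold blockH, EU, GZ. rewrite <- words_bools, !sumR_words_0. simpl. unfold sumR; simpl.
    unfold wprod2, wprod; simpl. rewrite plog_refl. lra.
  - rewrite sumR_chain_atoms by (intros; apply atomH_scal; assumption).
    unfold blockH. rewrite <- words_bools, sumR_words_S, EU_S.
    set (tb := fun b y => t (b :: y)).
    set (g := fun b => EU n (tb b)).
    assert (Hg : forall b, 0 <= g b) by (intros; apply EU_nonneg; intros; apply Ht).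
    change (fun b => EU n (fun y => t (b :: y))) with g.
    apply Rle_trans with (atomH p d g + sumR (fun b => mY p d b * blockH n (tb b)) bools).
    { apply Rplus_le_compat_l, sumR_le. intros b _.
      apply Rmult_le_compat_l; [apply mY_nonneg; assumption|]. apply IHn. intros; apply Ht. }
    unfold atomH.
    assert (Hz : forall z0, sumR (fun z => plog (GZ (S n) t (z0 :: z)) (atU p d g)) (bitseqs n)
       <= plog (atZ p d g z0) (atU p d g)
          + sumR (fun b => jZY p d z0 b * - blockH n (tb b)) bools).
    { intros z0.
      assert (Hsum : sumR (fun z => GZ (S n) t (z0 :: z)) (bitseqs n) = atZ p d g z0).
      { rewrite (sumR_ext _ (fun z => sumR (fun a => jZY p d z0 a * GZ n (tb a) z) bools))
          by (intros; apply GZ_cons).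
        rewrite sumR_swap. apply sumR_ext; intros a _. rewrite sumR_scal, GZ_sum. reflexivity. }
      rewrite (sumR_ext _ (fun z => plog (GZ (S n) t (z0 :: z)) (1 * atU p d g)))
        by (intros; rewrite Rmult_1_l; reflexivity).
      rewrite (plog_chain (bitseqs n) (fun z => GZ (S n) t (z0 :: z)) (fun _ => 1)
                 (atZ p d g z0) (atU p d g)).
      - rewrite Rplus_comm. apply Rplus_le_compat_l.
        unfold blockH.
        rewrite (sumR_ext (fun b => jZY p d z0 b * - - sumR (fun z => plog (GZ n (tb b) z) (EU n (tb b))) (bitseqs n))
          (fun b => sumR (fun z => jZY p d z0 b * plog (GZ n (tb b) z) (g b)) (bitseqs n))).
        2:{ intros b _. rewrite sumR_scal. unfold g. ring. }
        rewrite sumR_swap. apply sumR_le; intros z Hzin.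
        rewrite GZ_cons, Rmult_1_l. unfold atZ. rewrite !sumR_bools.
        assert (HG0 : forall b, g b = 0 -> GZ n (tb b) z = 0).
        { intros b Hb. apply (sumR_eq_0 (GZ n (tb b)) (bitseqs n) z); [|rewrite GZ_sum; exact Hb|assumption].
          intros; apply GZ_nonneg; intros; apply Ht. }
        assert (HG : forall b, 0 <= GZ n (tb b) z) by (intros; apply GZ_nonneg; intros; apply Ht).
        pose proof (jZY_nonneg p d Hp Hd z0) as Hj.
        rewrite <- !plog_homog by apply Hj.
        apply plog_logsum; try (apply Rmult_le_pos; auto).
        + intros Hm. apply Rmult_integral in Hm. destruct Hm as [Hm|Hm].
          * change (jZY p d z0 false * GZ n (tb false) z = 0). rewrite Hm; ring.
          * change (jZY p d z0 false * GZ n (tb false) z = 0). rewrite HG0 by assumption; ring.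
        + intros Hm. apply Rmult_integral in Hm. destruct Hm as [Hm|Hm].
          * change (jZY p d z0 true * GZ n (tb true) z = 0). rewrite Hm; ring.
          * change (jZY p d z0 true * GZ n (tb true) z = 0). rewrite HG0 by assumption; ring.
      - intros; apply GZ_nonneg, Ht.
      - intros; lra.
      - intros; lra.
      - exact Hsum.
      - apply atU_nonneg; assumption.
      - intros H0. apply atZ_0; assumption. }
    rewrite words_bools.
    assert (Htot : sumR (fun z0 => sumR (fun z => plog (GZ (S n) t (z0 :: z)) (atU p d g)) (bitseqs n)) bools
       <= sumR (fun z0 => plog (atZ p d g z0) (atU p d g)
          + sumR (fun b => jZY p d z0 b * - blockH n (tb b)) bools) bools)
      by (apply sumR_le; intros; apply Hz).
    rewrite sumR_plus, (sumR_swap (fun z0 b => jZY p d z0 b * - blockH n (tb b))) in Htot.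
    rewrite (sumR_ext (fun b => sumR (fun a => jZY p d a b * - blockH n (tb b)) bools)
               (fun b => - (mY p d b * blockH n (tb b)))) in Htot.
    + rewrite sumR_opp in Htot. lra.
    + intros b _. rewrite sumR_scal_r. unfold mY. ring.
Qed.

Lemma EU_sumR {A} n (T : A -> list bool -> R) l m :
  (forall y, length y = n -> sumR (fun a => T a y) l = m) ->
  sumR (fun a => EU n (T a)) l = m.
Proof.
  intros H. unfold EU. rewrite sumR_swap.
  rewrite (sumR_ext _ (fun y => wprod (mY p d) y * m)).
  - rewrite sumR_scal_r, <- words_bools, sumR_pow_1 by apply mY_sum. ring.
  - intros y Hy. apply in_bitseqs in Hy. rewrite sumR_scal, H by assumption. reflexivity.
Qed.

(** Each of the [n] positions contributes a full conditional law of total [m]. With [m = 1], the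
    atoms for all [s] together are [n] times a kernel. *)
Lemma chain_atoms_mass {A} n : forall (T : A -> list bool -> R) l m,
  (forall y, length y = n -> sumR (fun a => T a y) l = m) ->
  forall b, sumR (fun a => sumR (fun g => g b) (chain_atoms n (T a))) l = INR n * m.
Proof.
  induction n; intros T l m H b.
  - rewrite sumR_0 by reflexivity. simpl; ring.
  - rewrite (sumR_ext _ (fun a => EU n (fun y => T a (b :: y)) +
      sumR (fun b' => mY p d b' *
        sumR (fun g => g b) (chain_atoms n (fun y => T a (b' :: y)))) bools)).
    + rewrite sumR_plus, (EU_sumR n (fun a y => T a (b :: y)) l m).
      * rewrite sumR_swap.
        rewrite (sumR_ext _ (fun b' => mY p d b' * (INR n * m))).
        -- rewrite sumR_scal_r, mY_sum, S_INR. ring.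
        -- intros b' _. rewrite sumR_scal. f_equal.
           apply (IHn (fun a y => T a (b' :: y))). intros y Hy. apply H. simpl; congruence.
      * intros y Hy. apply H. simpl; congruence.
    + intros a _. apply (sumR_chain_atoms (fun g => g b)). reflexivity.
Qed.

Lemma xlog2_mult a b : 0 <= a -> 0 <= b -> xlog2 (a * b) = a * xlog2 b + b * xlog2 a.
Proof.
  intros Ha Hb. rewrite !xlog2_mult_log2.
  destruct (Req_dec a 0) as [->|]; [ring|]. destruct (Req_dec b 0) as [->|]; [ring|].
  rewrite log2_mult by lra. ring.
Qed.

Lemma sumR_xlog2_prodber n : sumR (fun s => xlog2 (prodber eps s)) (bitseqs n) = - INR n * h eps.
Proof.
  rewrite <- words_bools. induction n.
  - rewrite sumR_words_0. simpl. rewrite xlog2_mult_log2, log2_1. ring.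
  - rewrite sumR_words_S.
    rewrite (sumR_ext _ (fun a => ber eps a * (- INR n * h eps) + xlog2 (ber eps a))).
    + rewrite sumR_plus, sumR_scal_r, !sumR_bools, S_INR. unfold h. simpl. ring.
    + intros a _. rewrite <- IHn, <- sumR_scal.
      rewrite <- (Rmult_1_l (xlog2 (ber eps a))), <- (sumR_prodber eps n), words_bools.
      rewrite <- sumR_scal_r, <- sumR_plus. apply sumR_ext; intros s _.
      change (prodber eps (a :: s)) with (ber eps a * prodber eps s).
      rewrite xlog2_mult by (try apply ber_nonneg; try apply prodber_nonneg; assumption). reflexivity.
Qed.

(** The left side is [H(S^n) - H(S^n | Y_1^n)]. Given [Y_1^n], [S^n] is a translate of the link
    noise and has entropy [n h(eps)]. *)
Lemma blockI_relay n c :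
  sumR (fun s => blockI n (fun y => prodber eps (xorl (relayword c n y) s))) (bitseqs n)
  <= INR n * R0_bsc eps.
Proof.
  set (T := fun y s => prodber eps (xorl (relayword c n y) s)).
  set (E := fun s => EU n (fun y => T y s)).
  set (B := bitseqs n).
  assert (HT : forall y s, 0 <= T y s) by (intros; apply prodber_nonneg, He).
  assert (HE : forall s, 0 <= E s) by (intros; apply EU_nonneg; intros; apply HT).
  assert (HTs : forall F, forall y, sumR (fun s => F (T y s)) B = sumR (fun s => F (prodber eps s)) B).
  { intros F y. apply (sumR_bitseqs_xorl (fun s => F (prodber eps s))), relayword_length. }
  assert (HE1 : sumR E B = 1).
  { apply (EU_sumR n (fun s y => T y s) B 1). intros y _.
    rewrite (HTs (fun x => x)). apply sumR_prodber. }
  assert (H1 : forall s, blockI n (fun y => T y s) =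
     sumR (fun y => wprod (mY p d) y * xlog2 (T y s)) B - xlog2 (E s)).
  { intros s. unfold blockI. fold (E s). fold B.
    assert (Hx : xlog2 (E s) = sumR (fun y => wprod (mY p d) y * T y s * log2 (E s)) B).
    { rewrite sumR_scal_r. apply xlog2_mult_log2. }
    rewrite Hx, <- sumR_minus. apply sumR_ext; intros y Hy.
    rewrite plog_homog by apply wprod_mY_nonneg.
    destruct (Req_dec (wprod (mY p d) y) 0) as [->|Hw]; [ring|].
    rewrite plog_xlog2; auto; [ring|].
    intros HE0. assert (Hz : wprod (mY p d) y * T y s = 0).
    { apply (sumR_eq_0 (fun y => wprod (mY p d) y * T y s) B y); [|exact HE0|assumption].
      intros; apply Rmult_le_pos; [apply wprod_mY_nonneg|apply HT]. }
    apply Rmult_integral in Hz. tauto. }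
  rewrite (sumR_ext _ (fun s => sumR (fun y => wprod (mY p d) y * xlog2 (T y s)) B - xlog2 (E s)))
    by (intros; apply H1).
  rewrite sumR_minus, sumR_swap.
  rewrite (sumR_ext _ (fun y => wprod (mY p d) y * (- INR n * h eps))).
  2:{ intros y _. rewrite sumR_scal, HTs. unfold B. rewrite sumR_xlog2_prodber. reflexivity. }
  rewrite sumR_scal_r. unfold B at 1. rewrite <- words_bools, sumR_pow_1 by apply mY_sum.
  (* Gibbs' inequality against the uniform law on [2^n] words: the entropy of [S^n] is at most
     [n]. *)
  assert (Hent : - INR n <= sumR (fun s => xlog2 (E s)) B).
  { assert (H2n : 0 < / 2 ^ n) by (apply Rinv_0_lt_compat, pow_lt; lra).
    assert (Hg : sumR (fun s => (E s - / 2 ^ n) * / ln 2) B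
        <= sumR (fun s => xlog2 (E s) + INR n * E s) B).
    { apply sumR_le; intros s _.
      replace (xlog2 (E s) + INR n * E s) with (plog (E s) (/ 2 ^ n)).
      - apply plog_ge; [apply HE|lra|lra].
      - rewrite plog_xlog2, log2_inv by (try apply HE; try lra; apply pow_lt; lra).
        rewrite <- Rpower_pow, log2_Rpower by lra. ring. }
    rewrite sumR_scal_r, sumR_minus, sumR_plus, sumR_scal, HE1 in Hg.
    rewrite (sumR_ext (fun _ => / 2 ^ n) (fun _ => / 2 ^ n * 1)) in Hg by (intros; ring).
    rewrite sumR_scal in Hg. unfold B at 1 in Hg. rewrite sumR_bitseqs_1 in Hg.
    rewrite Rinv_l in Hg by (apply pow_nonzero; lra). lra. }
  unfold R0_bsc. lra.
Qed.

Lemma converse_bound n M c : (0 < n)%nat -> (0 < M)%nat ->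
  exists k q, kernel k q /\ IUY1 p d k q <= R0_bsc eps /\
    (1 - Perr p d eps n M c) * log2 (INR M) <= 1 + INR n * (1 - HZgU p d k q).
Proof.
  intros Hn HM. assert (Hnp : 0 < INR n) by (apply lt_0_INR, Hn).
  set (T := fun s y => prodber eps (xorl (relayword c n y) s)).
  assert (HT : forall s y, 0 <= T s y) by (intros; apply prodber_nonneg, He).
  (* The factor [1/n] is the law of a uniform position, which becomes part of the value of [U]. *)
  set (gs := map (fun g (y : bool) => / INR n * g y)
               (flat_map (fun s => chain_atoms n (T s)) (bitseqs n))).
  assert (Hin : 0 <= / INR n) by (left; apply Rinv_0_lt_compat; assumption).
  assert (Hat : atoms 1 gs).
  { split.
    - intros g Hg y. apply in_map_iff in Hg. destruct Hg as (g' & <- & Hg').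
      apply in_flat_map in Hg'. destruct Hg' as (s & _ & Hg').
      apply Rmult_le_pos; [assumption|]. eapply chain_atoms_nonneg; [|eassumption]. apply HT.
    - intros y. unfold gs. rewrite sumR_map, sumR_scal, sumR_flat_map.
      rewrite (chain_atoms_mass n T (bitseqs n) 1).
      + field. lra.
      + intros y' _. unfold T.
        rewrite (sumR_bitseqs_xorl (prodber eps)) by apply relayword_length. apply sumR_prodber. }
  exists (length gs), (kernel_of_atoms gs). split; [apply kernel_of_atoms_spec, Hat|]. split.
  - rewrite IUY1_of_atoms by assumption. unfold gs. rewrite sumR_map.
    rewrite (sumR_ext _ (fun g => / INR n * atomI p d g)) by (intros; apply atomI_scal; assumption).
    rewrite sumR_scal, sumR_flat_map.
    rewrite (sumR_ext _ (fun s => blockI n (T s))) by (intros; apply blockI_chain, HT).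
    apply Rmult_le_reg_l with (INR n); [assumption|].
    rewrite <- Rmult_assoc, Rinv_r, Rmult_1_l by lra. apply blockI_relay.
  - eapply Rle_trans; [apply fano, HM|].
    assert (HH : INR n * HZgU p d (length gs) (kernel_of_atoms gs)
       <= sumR (fun s => blockH n (T s)) (bitseqs n)).
    { rewrite HZgU_of_atoms. unfold gs. rewrite sumR_map.
      rewrite (sumR_ext _ (fun g => / INR n * atomH p d g)) by (intros; apply atomH_scal; assumption).
      rewrite sumR_scal, sumR_flat_map, <- Rmult_assoc, Rinv_r, Rmult_1_l by lra.
      apply sumR_le; intros s _. apply blockH_chain, HT. }
    unfold blockH in HH. rewrite sumR_opp in HH.
    rewrite (sumR_ext (fun s => sumR (fun z => plog (jointZS p d eps n c z s) (margS p d eps n c s)) (bitseqs n))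
      (fun s => sumR (fun z => plog (GZ n (T s) z) (EU n (T s))) (bitseqs n))).
    + lra.
    + intros s _. apply sumR_ext; intros z _. rewrite <- GZ_sum. reflexivity.
Qed.

Lemma achievable_le C Rt :
  (forall k q, kernel k q -> IUY1 p d k q <= R0_bsc eps -> 1 - HZgU p d k q <= C) ->
  achievable p d eps Rt -> Rt <= C.
Proof.
  intros HC (M & c & HM & Hcv).
  (* The case [1 < Perr] keeps the factor [1 - Perr] nonnegative in the other one; it is excluded
     later by convergence to 0. *)
  assert (Hb : forall n, (0 < n)%nat ->
    (1 - Perr p d eps n (M n) (c n)) * Rt <= / INR n + C \/ 1 < Perr p d eps n (M n) (c n)).
  { intros n Hn. destruct (Rlt_le_dec 1 (Perr p d eps n (M n) (c n))) as [|Hle]; [right; assumption|left].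
    assert (Hnp : 0 < INR n) by (apply lt_0_INR, Hn).
    pose proof (Rpower2_pos (INR n * Rt)) as Hpos. specialize (HM n).
    assert (HMn : (0 < M n)%nat) by (apply INR_lt; simpl; lra).
    destruct (converse_bound n (M n) (c n) Hn HMn) as (k & q & Hk & HI & Hq).
    specialize (HC k q Hk HI).
    assert (Hlog : INR n * Rt <= log2 (INR (M n))).
    { rewrite <- (log2_Rpower (INR n * Rt)). apply log2_le; assumption. }
    apply Rmult_le_reg_l with (INR n); [assumption|].
    rewrite Rmult_plus_distr_l, Rinv_r by lra.
    apply Rmult_le_compat_l with (r := 1 - Perr p d eps n (M n) (c n)) in Hlog; [|lra].
    apply Rmult_le_compat_l with (r := INR n) in HC; [|lra]. lra. }
  destruct (Rle_lt_dec Rt C) as [|Hlt]; [assumption|exfalso].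
  set (e := Rt - C).
  assert (Hden : 0 < 2 * (Rabs Rt + 1)) by (pose proof (Rabs_pos Rt); lra).
  destruct (Hcv (Rmin 1 (e / (2 * (Rabs Rt + 1))))) as [N1 HN1].
  { apply Rmin_glb_lt; [lra|]. apply Rdiv_lt_0_compat; [unfold e; lra|assumption]. }
  destruct (archimed_cor1 (e / 2)) as (N2 & HN2 & HN20); [unfold e; lra|].
  set (n := Nat.max N1 N2).
  specialize (HN1 n (Nat.le_max_l _ _)). unfold Rdist in HN1. rewrite Rminus_0_r in HN1.
  set (P := Perr p d eps n (M n) (c n)) in *.
  pose proof (Rmin_l 1 (e / (2 * (Rabs Rt + 1)))).
  pose proof (Rmin_r 1 (e / (2 * (Rabs Rt + 1)))).
  pose proof (Rle_abs P).
  destruct (Hb n) as [Hn|Hn]; [unfold n; lia| |fold P in Hn; lra]. fold P in Hn.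
  assert (/ INR n <= / INR N2).
  { apply Rinv_le_contravar; [apply lt_0_INR; lia|apply le_INR; unfold n; lia]. }
  assert (HPR : Rabs (P * Rt) < e / 2).
  { rewrite Rabs_mult. apply Rle_lt_trans with (Rabs P * (Rabs Rt + 1)).
    - apply Rmult_le_compat_l; [apply Rabs_pos|lra].
    - apply Rlt_le_trans with (e / (2 * (Rabs Rt + 1)) * (Rabs Rt + 1)).
      + apply Rmult_lt_compat_r; lra.
      + right. field. lra. }
  pose proof (Rle_abs (P * Rt)). unfold e in *. lra.
Qed.

End Converse.


(** * Codes for additive noise with side information *)

Definition indb (b : bool) : R := if b then 1 else 0.

Lemma indb_bounds b : 0 <= indb b <= 1.
Proof. destruct b; simpl; lra. Qed.

(** When no entry passes, the value is [length l]; as this is not a message, the event counts as an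
    error. *)
Fixpoint first_idx {A} (f : A -> bool) (l : list A) : nat :=
  match l with
  | nil => 0
  | a :: l' => if f a then 0%nat else S (first_idx f l')
  end.

Lemma first_idx_error {A} (f : A -> bool) l a0 : forall w, (w < length l)%nat ->
  indb (negb (Nat.eqb (first_idx f l) w)) <=
  indb (negb (f (nth w l a0))) + sumR (fun a => indb (f a)) (firstn w l).
Proof.
  induction l as [|a l IH]; intros w Hw; [simpl in Hw; lia|].
  destruct w as [|w].
  - simpl. unfold sumR; simpl. destruct (f a); simpl; lra.
  - simpl firstn. rewrite sumR_cons. simpl nth. simpl first_idx.
    assert (Hn : 0 <= sumR (fun a => indb (f a)) (firstn w l))
      by (apply sumR_nonneg; intros; apply indb_bounds).
    pose proof (indb_bounds (negb (f (nth w l a0)))).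
    destruct (f a).
    + simpl. lra.
    + simpl. rewrite Rplus_0_l. apply IH. simpl in Hw; lia.
Qed.

(* Codewords are chosen greedily: decoding picks the first codeword whose noise is typical,
   so the error of a codeword depends only on its predecessors, and a uniformly random
   next codeword collides with each of them with probability at most [tau / 2^m]. *)
Lemma additive_code {B} (m : nat) (Us : list B) (Q : B -> list bool -> R)
  (T : B -> list bool -> bool) (tau : R) (M : nat) :
  (forall u z, In u Us -> In z (bitseqs m) -> 0 <= Q u z) ->
  sumR (fun u => sumR (Q u) (bitseqs m)) Us = 1 ->
  (forall u, In u Us -> sumR (fun z => indb (T u z)) (bitseqs m) <= tau) ->
  exists xs, length xs = M /\ (forall x, In x xs -> length x = m) /\
    forall w, (w < M)%nat ->
      sumR (fun u => sumR (fun z => Q u z *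
        indb (negb (Nat.eqb (first_idx (fun x => T u (xorl x (xorl (nth w xs nil) z))) xs) w)))
        (bitseqs m)) Us
      <= sumR (fun u => sumR (fun z => Q u z * indb (negb (T u z))) (bitseqs m)) Us
         + INR M * (tau / 2 ^ m).
Proof.
  intros HQ HQ1 HT.
  assert (H2m : 0 < 2 ^ m) by (apply pow_lt; lra).
  set (coll := fun l x => sumR (fun u => sumR (fun z => Q u z *
     sumR (fun x' => indb (T u (xorl x' (xorl x z)))) l) (bitseqs m)) Us).
  assert (Hnext : forall l, (forall x, In x l -> length x = m) ->
    exists x, In x (bitseqs m) /\ coll l x <= INR (length l) * (tau / 2 ^ m)).
  { intros l Hl.
    apply (sumR_average_exists (fun _ => / 2 ^ m)).
    - intros; left; apply Rinv_0_lt_compat; assumption.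
    - rewrite (sumR_ext _ (fun _ => / 2 ^ m * 1)) by (intros; ring).
      rewrite sumR_scal, sumR_bitseqs_1. field. lra.
    - rewrite sumR_scal.
      apply Rmult_le_reg_l with (2 ^ m); [assumption|].
      rewrite <- Rmult_assoc, Rinv_r, Rmult_1_l by lra.
      replace (2 ^ m * (INR (length l) * (tau / 2 ^ m))) with
        (sumR (fun u => sumR (Q u) (bitseqs m)) Us * (INR (length l) * tau))
        by (rewrite HQ1; field; lra).
      unfold coll. rewrite sumR_swap, <- sumR_scal_r. apply sumR_le; intros u Hu.
      rewrite sumR_swap, <- sumR_scal_r. apply sumR_le; intros z Hz.
      rewrite sumR_scal. apply Rmult_le_compat_l; [apply HQ; assumption|].
      rewrite sumR_swap, <- sumR_const. apply sumR_le; intros x' Hx'.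
      apply in_bitseqs in Hz.
      rewrite (sumR_ext _ (fun x => indb (T u (xorl x' (xorl z x)))))
        by (intros; rewrite (xorl_comm z); reflexivity).
      rewrite (sumR_bitseqs_xorl (fun x => indb (T u (xorl x' x)))) by assumption.
      rewrite (sumR_bitseqs_xorl (fun x => indb (T u x))) by (apply Hl, Hx').
      apply HT, Hu. }
  assert (Hgreedy : exists xs, length xs = M /\ (forall x, In x xs -> length x = m) /\
    forall w, (w < M)%nat -> coll (firstn w xs) (nth w xs nil) <= INR w * (tau / 2 ^ m)).
  { clear HT. induction M as [|M (xs & Hlen & Hx & Hw)].
    - exists nil. split; [reflexivity|]. split; [intros ? []|intros; lia].
    - destruct (Hnext xs Hx) as (x & Hxin & Hcoll). apply in_bitseqs in Hxin.
      exists (xs ++ [x]). split; [rewrite length_app; simpl; lia|]. split.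
      + intros x' Hx'. apply in_app_iff in Hx'. destruct Hx' as [Hx'|[<-|[]]]; auto.
      + intros w Hw'. destruct (Nat.eq_dec w M) as [->|Hn].
        * rewrite firstn_app, <- Hlen, Nat.sub_diag, firstn_all, firstn_0, app_nil_r.
          rewrite nth_middle. assumption.
        * rewrite firstn_app, app_nth1 by lia.
          replace (w - length xs)%nat with 0%nat by lia. rewrite firstn_0, app_nil_r.
          apply Hw. lia. }
  destruct Hgreedy as (xs & Hlen & Hx & Hw).
  exists xs. split; [assumption|]. split; [assumption|].
  intros w HwM.
  assert (Hxw : length (nth w xs nil) = m) by (apply Hx, nth_In; lia).
  apply Rle_trans with
    (sumR (fun u => sumR (fun z => Q u z * indb (negb (T u z))) (bitseqs m)) Us
     + coll (firstn w xs) (nth w xs nil)).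
  - unfold coll. rewrite <- sumR_plus. apply sumR_le; intros u Hu.
    rewrite <- sumR_plus. apply sumR_le; intros z Hz.
    rewrite <- Rmult_plus_distr_l. apply Rmult_le_compat_l; [apply HQ; assumption|].
    eapply Rle_trans; [apply first_idx_error with (a0 := nil); lia|].
    apply in_bitseqs in Hz. cbv beta. rewrite xorl_cancel by congruence. lra.
  - apply Rplus_le_compat_l. eapply Rle_trans; [apply Hw, HwM|].
    apply Rmult_le_compat_r; [|apply le_INR; lia].
    assert (Ht : 0 <= tau).
    { destruct Us as [|u Us]; [unfold sumR in HQ1; simpl in HQ1; lra|].
      eapply Rle_trans; [|apply (HT u); left; reflexivity].
      apply sumR_nonneg; intros; apply indb_bounds. }
    apply Rmult_le_pos; [assumption|left; apply Rinv_0_lt_compat; assumption].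
Qed.

Lemma Rpower2_vanish gam eta : 0 < gam -> 0 < eta ->
  exists N, forall m, (N <= m)%nat -> Rpower 2 (- (INR m * gam)) <= eta.
Proof.
  intros Hg He. pose proof ln2_pos as Hl.
  assert (Hgl : 0 < gam * ln 2) by (apply Rmult_lt_0_compat; assumption).
  destruct (archimed_cor1 (eta * (gam * ln 2))) as (N & HN & HN0).
  { apply Rmult_lt_0_compat; assumption. }
  exists N. intros m Hm.
  assert (HNp : 0 < INR N) by (apply lt_0_INR; lia).
  assert (Hmp : INR N <= INR m) by (apply le_INR; assumption).
  rewrite Rpower_Ropp.
  assert (Hx : 0 < INR m * (gam * ln 2)) by (apply Rmult_lt_0_compat; lra).
  assert (Hb : INR m * (gam * ln 2) <= Rpower 2 (INR m * gam)).
  { unfold Rpower. pose proof (exp_ineq1_le (INR m * gam * ln 2)). lra. }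
  apply Rle_trans with (/ (INR m * (gam * ln 2))); [apply Rinv_le_contravar; assumption|].
  rewrite Rinv_mult.
  apply Rle_trans with (/ INR N * / (gam * ln 2)).
  - apply Rmult_le_compat_r; [left; apply Rinv_0_lt_compat; assumption|].
    apply Rinv_le_contravar; lra.
  - apply Rlt_le. apply Rmult_lt_reg_r with (gam * ln 2); [assumption|].
    rewrite Rmult_assoc, Rinv_l, Rmult_1_r by lra. assumption.
Qed.

Lemma Rpower2_mult_pow m x : Rpower 2 (INR m * x) = Rpower 2 (INR m * (x - 1)) * 2 ^ m.
Proof.
  rewrite <- Rpower_pow, <- Rpower_plus by lra. f_equal. ring.
Qed.

Section AdditiveCode.
Variable k : nat.
Variable P : bool -> nat -> R.
Hypothesis HP : forall z u, (u < k)%nat -> 0 <= P z u.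
Hypothesis HP1 : sumR (fun u => sumR (fun z => P z u) bools) (seq 0 k) = 1.
Let PU u := sumR (fun z => P z u) bools.
Let H := - sumR (fun u => sumR (fun z => plog (P z u) (PU u)) bools) (seq 0 k).

Let PU_nonneg u : (u < k)%nat -> 0 <= PU u.
Proof. intros Hu. apply sumR_nonneg; intros; apply HP, Hu. Qed.

Let PU_0 z u : (u < k)%nat -> PU u = 0 -> P z u = 0.
Proof.
  intros Hu H0. apply (sumR_eq_0 (fun z => P z u) bools z); [intros; apply HP, Hu|exact H0|].
  destruct z; simpl; tauto.
Qed.

(** A noise word is typical for [u] if its conditional probability is at least
    [thr = 2^{-m(H + gam)}]. At most [1/thr] words are typical, since conditional probabilities sum
    to at most 1. Half of the rate gap pays for typicality, the other half makes collisions
    vanish. *)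
Lemma additive_code_asymptotic r eta : 0 <= r -> r < 1 - H -> 0 < eta ->
  exists N, forall m, (N <= m)%nat -> forall M, INR M <= Rpower 2 (INR m * r) + 1 ->
  exists xs dcd, length xs = M /\ (forall x, In x xs -> length x = m) /\
    forall w, (w < M)%nat ->
      sumR (fun u => sumR (fun z => wprod2 P z u *
        indb (negb (Nat.eqb (dcd (xorl (nth w xs nil) z) u) w))) (bitseqs m))
        (words (seq 0 k) m) <= eta.
Proof.
  intros Hr0 Hr Heta.
  set (gam := (1 - H - r) / 2).
  assert (Hgam : 0 < gam) by (unfold gam; lra).
  set (kap := fun z u => P z u / PU u).
  set (l := list_prod bools (seq 0 k)).
  assert (Hl : forall zu, In zu l -> (snd zu < k)%nat).
  { intros [z u] Hzu. apply in_prod_iff in Hzu. destruct Hzu as [_ Hu]. apply in_seq in Hu.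
    simpl; lia. }
  destruct (aep_lower (fun zu => P (fst zu) (snd zu)) (fun zu => kap (fst zu) (snd zu)) l
    (- H) gam (eta / 2)) as [N1 HN1].
  - intros zu Hzu. apply HP, Hl, Hzu.
  - unfold l. rewrite sumR_list_prod, <- HP1, sumR_swap. reflexivity.
  - intros zu Hzu Hn. apply Hl in Hzu. pose proof (HP (fst zu) (snd zu) Hzu).
    pose proof (PU_nonneg _ Hzu).
    assert (PU (snd zu) <> 0) by (intros E; apply Hn, PU_0; assumption).
    apply Rdiv_lt_0_compat; lra.
  - unfold H, l. rewrite Ropp_involutive, sumR_list_prod, sumR_swap.
    apply sumR_ext; intros z _. apply sumR_ext; intros u _. simpl. apply plog_mult_log2.
  - assumption.
  - lra.
  - destruct (Rpower2_vanish gam (eta / 4) Hgam) as [N2 HN2]; [lra|].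
    exists (Nat.max N1 N2). intros m Hm M HM.
    set (thr := Rpower 2 (INR m * (- H - gam))).
    assert (Hthr : 0 < thr) by apply Rpower2_pos.
    set (T := fun (u : list nat) (z : list bool) =>
           if Rlt_dec (wprod2 kap z u) thr then false else true).
    set (Us := words (seq 0 k) m).
    assert (HUs : forall u a, In u Us -> In a u -> (a < k)%nat).
    { intros u a Hu Ha. apply in_words in Hu. destruct Hu as [_ Hf].
      rewrite Forall_forall in Hf. apply Hf, in_seq in Ha. lia. }
    destruct (additive_code m Us (fun u z => wprod2 P z u) T (/ thr) M) as (xs & Hlen & Hx & Hw).
    + intros u z Hu _. apply wprod2_nonneg. intros a b _ Hb. apply HP, (HUs u), Hb. assumption.
    + rewrite (sumR_swap (fun u z => wprod2 P z u)), <- words_bools. unfold Us.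
      rewrite (sumR_ext _ (wprod (fun z => sumR (P z) (seq 0 k)))).
      * rewrite sumR_wprod, sumR_swap, HP1. apply pow1.
      * intros z Hz. apply sumR_wprod2_r. apply words_length in Hz. assumption.
    + intros u Hu.
      assert (Hlu : length u = m) by (apply words_length in Hu; assumption).
      apply Rmult_le_reg_l with thr; [assumption|]. rewrite Rinv_r by lra.
      rewrite <- sumR_scal.
      apply Rle_trans with (sumR (fun z => wprod2 kap z u) (bitseqs m)).
      * apply sumR_le. intros z _. unfold T. destruct Rlt_dec; simpl; [|lra].
        rewrite Rmult_0_r. apply wprod2_nonneg. intros a b _ Hb.
        pose proof (HUs u b Hu Hb) as Hbk. pose proof (HP a b Hbk). pose proof (PU_nonneg b Hbk).
        destruct (Req_dec (PU b) 0) as [E|E].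
        -- unfold kap. rewrite E. unfold Rdiv. rewrite Rinv_0; lra.
        -- apply Rmult_le_pos; [assumption|]. left; apply Rinv_0_lt_compat; lra.
      * rewrite <- words_bools, sumR_wprod2_l by assumption.
        (* A letter with [PU b = 0] has conditional mass 0, division by zero giving 0; hence a bound
           and no equality. *)
        assert (Hle : forall v, (forall a, In a v -> (a < k)%nat) ->
           0 <= wprod (fun b => sumR (fun a => kap a b) bools) v <= 1).
        { induction v as [|b v IH]; intros Hv; [unfold wprod; simpl; lra|].
          rewrite wprod_cons.
          assert (Hb : sumR (fun a => kap a b) bools = 0 \/ sumR (fun a => kap a b) bools = 1).
          { unfold kap, Rdiv. rewrite sumR_scal_r. fold (PU b).
            destruct (Req_dec (PU b) 0) as [E|E]; [left|right]; [rewrite E; ring|field; assumption]. }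
          assert (IH' : 0 <= wprod (fun b => sumR (fun a => kap a b) bools) v <= 1)
            by (apply IH; intros; apply Hv; right; assumption).
          destruct Hb as [-> | ->]; lra. }
        apply Hle. intros a Ha. apply (HUs u); assumption.
    + exists xs, (fun y u => first_idx (fun x => T u (xorl x y)) xs).
      split; [assumption|]. split; [assumption|]. intros w HwM.
      eapply Rle_trans; [apply Hw, HwM|].
      assert (H1 : sumR (fun u => sumR (fun z => wprod2 P z u * indb (negb (T u z))) (bitseqs m)) Us
                   <= eta / 2).
      { eapply Rle_trans; [|apply (HN1 m); lia]. right.
        unfold Us, l. rewrite (sumR_swap (fun u z => wprod2 P z u * indb (negb (T u z)))),
          sumR_words_list_prod, words_bools.
        apply sumR_ext; intros z _. apply sumR_ext; intros u _.
        change (wprod2 P z u * indb (negb (T u z)) = wprod2 P z u * ind_lt (wprod2 kap z u) thr).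
        unfold T, ind_lt. destruct Rlt_dec; reflexivity. }
      (* [M] exceeds [2^{m r}] by at most 1, hence is at most twice it because [0 <= r]; the
         remaining exponent is [- m gam]. *)
      assert (H2 : INR M * (/ thr / 2 ^ m) <= eta / 2).
      { assert (H2m : 0 < 2 ^ m) by (apply pow_lt; lra).
        assert (Hthi : / thr / 2 ^ m = Rpower 2 (INR m * (H + gam - 1))).
        { unfold thr. rewrite <- Rpower_Ropp.
          replace (- (INR m * (- H - gam))) with (INR m * (H + gam)) by ring.
          rewrite Rpower2_mult_pow. field. lra. }
        rewrite Hthi.
        apply Rle_trans with (2 * Rpower 2 (INR m * r) * Rpower 2 (INR m * (H + gam - 1))).
        - apply Rmult_le_compat_r; [left; apply Rpower2_pos|].
          assert (1 <= Rpower 2 (INR m * r)); [|lra].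
          rewrite <- (Rpower_O 2) by lra. apply Rpower2_le.
          apply Rmult_le_pos; [apply pos_INR|assumption].
        - rewrite Rmult_assoc, <- Rpower_plus.
          replace (INR m * r + INR m * (H + gam - 1)) with (- (INR m * gam))
            by (unfold gam; field).
          assert (Rpower 2 (- (INR m * gam)) <= eta / 4) by (apply HN2; lia). lra. }
      lra.
Qed.

End AdditiveCode.


(** * Quantization at the relay *)

Section Covering.
Variables p d : R.
Hypothesis Hp : 0 <= p <= 1.
Hypothesis Hd : 0 <= d <= 1.
Variable k : nat.
Variable q : bool -> nat -> R.
Hypothesis Hq : kernel k q.

Let PU u := pU p d q u.
(* [rho y u = P(y | u) / P(y)], and [0] when [P(u) = 0]. *)
Let rho y u := q y u / PU u.

Lemma pU_nonneg u : (u < k)%nat -> 0 <= PU u.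
Proof. intros Hu. unfold PU. rewrite pU_at. apply atU_nonneg; try assumption. intros; apply Hq, Hu. Qed.

Lemma pZU_nonneg z u : (u < k)%nat -> 0 <= pZU p d q z u.
Proof. intros Hu. rewrite pZU_at. apply atZ_nonneg; try assumption. intros; apply Hq, Hu. Qed.

Lemma pU_sum : sumR PU (seq 0 k) = 1.
Proof.
  unfold PU. rewrite (sumR_ext _ (fun u => sumR (fun y => mY p d y * q y u) bools))
    by (intros; apply pU_at).
  rewrite sumR_swap. rewrite <- (mY_sum p d). apply sumR_ext; intros y _.
  rewrite sumR_scal, (proj2 Hq). ring.
Qed.

Let rho_nonneg y u : (u < k)%nat -> 0 <= rho y u.
Proof.
  intros Hu. pose proof (pU_nonneg u Hu). pose proof (proj1 Hq y u Hu).
  unfold rho, Rdiv. destruct (Req_dec (PU u) 0) as [->|]; [rewrite Rinv_0; lra|].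
  apply Rmult_le_pos; [assumption|left; apply Rinv_0_lt_compat; lra].
Qed.

Let pU_0 y u : (u < k)%nat -> PU u = 0 -> mY p d y = 0 \/ q y u = 0.
Proof.
  intros Hu H0. unfold PU in H0. rewrite pU_at in H0.
  pose proof (atU_0 p d Hp Hd (fun y => q y u) y (fun y => proj1 Hq y u Hu) H0) as Hm.
  apply Rmult_integral in Hm. exact Hm.
Qed.

Let rho_jZY z y u : (u < k)%nat -> jZY p d z y * rho y u * PU u = jZY p d z y * q y u.
Proof.
  intros Hu. destruct (Req_dec (PU u) 0) as [E|E]; [|unfold rho; field; assumption].
  rewrite E. destruct (pU_0 y u Hu E) as [Hm| ->]; [|ring].
  rewrite (jZY_mY_0 p d Hp Hd z y Hm). ring.
Qed.

Let rho_mY y u : (u < k)%nat -> mY p d y * rho y u * PU u = mY p d y * q y u.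
Proof.
  intros Hu. unfold mY. rewrite <- !sumR_scal_r. apply sumR_ext; intros; apply rho_jZY, Hu.
Qed.

(** The mass can fall below 1 when [P(Y_1 = y) = 0]: then [q y u] may be positive although
    [P(U = u) = 0]. *)
Let rho_mass y : 0 <= sumR (fun u => rho y u * PU u) (seq 0 k) <= 1.
Proof.
  split.
  - apply sumR_nonneg; intros u Hu. apply in_seq in Hu.
    apply Rmult_le_pos; [apply rho_nonneg|apply pU_nonneg]; lia.
  - rewrite <- (proj2 Hq y). apply sumR_le; intros u Hu. apply in_seq in Hu.
    unfold rho, Rdiv. destruct (Req_dec (PU u) 0) as [->|].
    + rewrite Rmult_0_r. apply Hq. lia.
    + rewrite Rmult_assoc, Rinv_l by assumption. lra.
Qed.

Lemma words_seq_lt u m a : In u (words (seq 0 k) m) -> In a u -> (a < k)%nat.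
Proof.
  intros Hu Ha. apply in_words in Hu. destruct Hu as [_ Hf].
  rewrite Forall_forall in Hf. apply Hf, in_seq in Ha. lia.
Qed.

(* The codewords are drawn i.i.d. from [P_U]. Splitting [1 = (1 - rhohat) + rhohat] with
   [rhohat] the empirical mean of the density ratios, the relay's best index costs at most
   the resolvability defect [(1 - rhohat)^+] plus the cost under the ideal joint law of
   [(Z, U)]; the defect is controlled by the second moment of the truncated ratios. *)
Lemma relay_covering r eta : IUY1 p d k q < r -> 0 < eta ->
  exists N, forall m, (N <= m)%nat -> forall L, Rpower 2 (INR m * r) <= INR L ->
  forall psi : list nat -> list bool -> R, (forall u z, 0 <= psi u z <= 1) ->
  exists (us : list (list nat)) (J : list bool -> nat), (forall y, (J y < L)%nat) /\
    sumR (fun z => sumR (fun y => wprod2 (jZY p d) z y * psi (nth (J y) us nil) z)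
      (bitseqs m)) (bitseqs m) <=
    sumR (fun u => sumR (fun z => wprod2 (pZU p d q) z u * psi u z) (bitseqs m))
      (words (seq 0 k) m) + eta.
Proof.
  intros Hr Heta.
  set (I := IUY1 p d k q) in *.
  set (gam := (r - I) / 2).
  assert (Hgam : 0 < gam) by (unfold gam; lra).
  set (th := eta / 3). assert (Hth : 0 < th) by (unfold th; lra).
  set (l := list_prod bools (seq 0 k)).
  assert (Hl : forall yu, In yu l -> (snd yu < k)%nat).
  { intros [z u] Hzu. apply in_prod_iff in Hzu. destruct Hzu as [_ Hu]. apply in_seq in Hu.
    simpl; lia. }
  set (PYU := fun y u => mY p d y * q y u).
  assert (HPYU1 : forall y, sumR (PYU y) (seq 0 k) = mY p d y).
  { intros y. unfold PYU. rewrite sumR_scal, (proj2 Hq). ring. }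
  destruct (aep_upper (fun yu => PYU (fst yu) (snd yu)) (fun yu => rho (fst yu) (snd yu)) l
    I gam th) as [N1 HN1].
  { intros yu Hyu. apply Rmult_le_pos; [apply mY_nonneg; assumption|]. apply Hq, Hl, Hyu. }
  { unfold l. rewrite sumR_list_prod. cbn [fst snd].
    rewrite (sumR_ext _ (mY p d)) by (intros; apply HPYU1). apply mY_sum. }
  { intros [y u] Hyu Hn. apply Hl in Hyu. simpl in *. unfold PYU in Hn.
    pose proof (pU_nonneg u Hyu). pose proof (proj1 Hq y u Hyu).
    assert (PU u <> 0).
    { intros E. destruct (pU_0 y u Hyu E) as [E1|E1]; rewrite E1 in Hn; lra. }
    assert (q y u <> 0) by (intros E; rewrite E in Hn; lra).
    apply Rdiv_lt_0_compat; lra. }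
  { unfold I, l. rewrite sumR_list_prod, sumR_swap. unfold IUY1.
    apply sumR_ext; intros u Hu. apply in_seq in Hu. apply sumR_ext; intros y _. cbn [fst snd].
    rewrite (pY_kernel p d k q y Hq), pYU_at, plog_mult_log2. fold (PU u). unfold PYU.
    destruct (Req_dec (mY p d y) 0) as [->|E]; [ring|].
    f_equal. f_equal. unfold rho.
    destruct (Req_dec (PU u) 0) as [->|E']; [|field; split; assumption].
    unfold Rdiv. rewrite Rmult_0_r, Rinv_0. ring. }
  { assumption. } { assumption. }
  destruct (Rpower2_vanish gam (th * th) Hgam) as [N2 HN2].
  { apply Rmult_lt_0_compat; assumption. }
  exists (Nat.max N1 N2). intros m Hm L HL psi Hpsi.
  pose proof (Rpower2_pos (INR m * r)) as HLpos.
  assert (HLp : 0 < INR L) by lra.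
  assert (HL0 : (0 < L)%nat) by (apply INR_lt; simpl; lra).
  set (B := bitseqs m). set (Us := words (seq 0 k) m).
  set (Pw := wprod PU). set (rw := wprod2 rho). set (W := wprod (mY p d)).
  set (K := Rpower 2 (INR m * (I + gam))).
  assert (HK : 0 < K) by apply Rpower2_pos.
  (* Cutting the ratio at [K] gives [f^2 <= K f], hence variance at most [K]; averaged over [y], the
     mass that is lost is the probability bounded by [aep_upper]. *)
  set (f := fun y u => if Rlt_dec K (rw y u) then 0 else rw y u).
  set (mu := fun y => sumR (fun u => Pw u * f y u) Us).
  (* The cost of answering the observation [y] with [u], weighted by the probability of [y]. The
     unseen [z] is averaged out, so the relay can evaluate it. *)
  set (g := fun u y => sumR (fun z => wprod2 (jZY p d) z y * psi u z) B).
  set (a := fun u => sumR (fun y => rw y u * g u y) B).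
  assert (HUlen : forall u, In u Us -> length u = m) by (intros u; apply words_length).
  assert (HBlen : forall y, In y B -> length y = m) by (intros y; apply in_bitseqs).
  assert (HPw : forall u, In u Us -> 0 <= Pw u).
  { intros u Hu. apply wprod_nonneg. intros b Hb. apply pU_nonneg, (words_seq_lt u m); assumption. }
  assert (HPw1 : sumR Pw Us = 1) by (apply sumR_pow_1, pU_sum).
  assert (Hrw : forall y u, In u Us -> 0 <= rw y u).
  { intros y u Hu. apply wprod2_nonneg. intros b c _ Hc. apply rho_nonneg, (words_seq_lt u m); assumption. }
  assert (HW : forall y, 0 <= W y) by (intros; apply wprod_nonneg; intros; apply mY_nonneg; assumption).
  assert (HW1 : sumR W B = 1).
  { unfold B. rewrite <- words_bools. apply sumR_pow_1, mY_sum. }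
  assert (Hj : forall z y, 0 <= wprod2 (jZY p d) z y)
    by (intros; apply wprod2_nonneg; intros; apply jZY_nonneg; assumption).
  assert (Hf : forall y u, In u Us -> 0 <= f y u <= rw y u /\ f y u ^ 2 <= K * f y u).
  { intros y u Hu. specialize (Hrw y u Hu). unfold f. destruct Rlt_dec as [|Hn]; [split; [lra|simpl; lra]|].
    split; [lra|]. simpl. rewrite Rmult_1_r. apply Rmult_le_compat_r; lra. }
  assert (Hg : forall u y, In y B -> 0 <= g u y <= W y).
  { intros u y Hy. split.
    - apply sumR_nonneg; intros z _. apply Rmult_le_pos; [apply Hj|apply Hpsi].
    - apply Rle_trans with (sumR (fun z => wprod2 (jZY p d) z y) B).
      + apply sumR_le; intros z _. rewrite <- (Rmult_1_r (wprod2 (jZY p d) z y)) at 2.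
        apply Rmult_le_compat_l; [apply Hj|apply Hpsi].
      + right. unfold B. rewrite <- words_bools. apply sumR_wprod2_l, HBlen, Hy. }
  assert (Hmu1 : forall y, In y B -> mu y <= 1).
  { intros y Hy. apply Rle_trans with (sumR (fun u => wprod2 (fun y u => rho y u * PU u) y u) Us).
    - apply sumR_le; intros u Hu.
      rewrite wprod2_mult_r by (rewrite HBlen, HUlen; auto).
      rewrite (Rmult_comm (wprod2 rho y u)). apply Rmult_le_compat_l; [apply HPw, Hu|].
      apply Hf, Hu.
    - unfold Us. rewrite sumR_wprod2_r by (apply HBlen, Hy).
      clear Hy. induction y as [|b y IH]; [unfold wprod; simpl; lra|].
      rewrite wprod_cons. pose proof (rho_mass b).
      rewrite <- (Rmult_1_l 1). apply Rmult_le_compat; try lra.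
      apply wprod_nonneg; intros; apply rho_mass. }
  assert (Hvar : forall y, In y B -> sumR (fun u => Pw u * (f y u - mu y) ^ 2) Us <= K).
  { intros y Hy.
    rewrite (sumR_ext _ (fun u => Pw u * f y u ^ 2 + (mu y ^ 2 * Pw u - 2 * mu y * (Pw u * f y u))))
      by (intros; ring).
    rewrite sumR_plus, sumR_minus, !sumR_scal, HPw1. fold (mu y).
    assert (sumR (fun u => Pw u * f y u ^ 2) Us <= K * mu y).
    { unfold mu. rewrite <- sumR_scal. apply sumR_le; intros u Hu.
      destruct (Hf y u Hu) as [_ H2]. specialize (HPw u Hu). nra. }
    specialize (Hmu1 y Hy). nra. }
  (* A majorant of the best-index cost of the codebook [cs]. With [D] the deviation of the empirical
     mean of [f] from [mu], the bound [- D <= th + D^2 / th] replaces a positive part by a square,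
     so only a mean and a variance of i.i.d. sums have to be computed. *)
  set (Phi := fun cs => / INR L * sumR a cs + sumR (fun y => W y *
     ((1 - mu y) + th + / th * (/ INR L) ^ 2 * (sumR (fun u => f y u - mu y) cs) ^ 2)) B).
  assert (Hcs : exists cs, In cs (words Us L) /\ Phi cs <=
     sumR (fun u => sumR (fun z => wprod2 (pZU p d q) z u * psi u z) B) Us + eta).
  { apply (sumR_average_exists (wprod Pw)).
    - intros cs Hcs. eapply wprod_words_nonneg; [|exact Hcs]. exact HPw.
    - apply sumR_pow_1, HPw1.
    - apply Rle_trans with (sumR (fun u => Pw u * a u) Us + sumR (fun y => W y *
        ((1 - mu y) + th + / th * / INR L * K)) B).
      + unfold Phi.
        rewrite (sumR_ext _ (fun cs => / INR L * (wprod Pw cs * sumR a cs) +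
          sumR (fun y => W y * ((1 - mu y + th) * wprod Pw cs
            + / th * (/ INR L) ^ 2 * (wprod Pw cs * (sumR (fun u => f y u - mu y) cs) ^ 2))) B)).
        2:{ intros cs _. rewrite Rmult_plus_distr_l, <- (sumR_scal (wprod Pw cs) _ B). f_equal; [ring|].
            apply sumR_ext; intros; ring. }
        rewrite sumR_plus, sumR_scal, iid_mean by assumption.
        rewrite <- Rmult_assoc, Rinv_l, Rmult_1_l by lra.
        apply Rplus_le_compat_l. rewrite sumR_swap. apply sumR_le; intros y Hy.
        rewrite sumR_scal. apply Rmult_le_compat_l; [apply HW|].
        rewrite sumR_plus, !sumR_scal, sumR_pow_1, iid_centered_variance; try assumption.
        * specialize (Hvar y Hy).
          assert (Hc : / th * (/ INR L) ^ 2 * (INR L * sumR (fun u => Pw u * (f y u - mu y) ^ 2) Us)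
            = / th * / INR L * sumR (fun u => Pw u * (f y u - mu y) ^ 2) Us) by (field; lra).
          rewrite Hc. rewrite Rmult_1_r. apply Rplus_le_compat_l.
          apply Rmult_le_compat_l; [|assumption].
          apply Rmult_le_pos; left; apply Rinv_0_lt_compat; assumption.
        * rewrite (sumR_ext _ (fun u => Pw u * f y u - Pw u * mu y)) by (intros; ring).
          rewrite sumR_minus, sumR_scal_r, HPw1. fold (mu y). ring.
      + apply Rplus_le_compat.
        * right. unfold a, g.
          apply sumR_ext; intros u Hu. rewrite <- sumR_scal.
          rewrite (sumR_ext _ (fun y => sumR (fun z => Pw u * (wprod2 (jZY p d) z y * rw y u) * psi u z) B)).
          2:{ intros y _. rewrite <- !sumR_scal. apply sumR_ext; intros; ring. }
          rewrite sumR_swap. apply sumR_ext; intros z Hz.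
          rewrite sumR_scal_r, sumR_scal. f_equal.
          unfold B. rewrite <- words_bools. unfold rw.
          rewrite sumR_wprod2_comp by auto.
          rewrite Rmult_comm. unfold Pw. rewrite <- wprod2_mult_r by (rewrite HUlen, HBlen; auto).
          apply wprod2_ext. intros z0 u0 _ Hu0. rewrite pZU_at. unfold atZ.
          rewrite <- sumR_scal_r. apply sumR_ext; intros y0 _.
          apply rho_jZY, (words_seq_lt u m); assumption.
        * rewrite (sumR_ext _ (fun y => W y * (1 - mu y) + W y * (th + / th * / INR L * K)))
            by (intros; ring).
          rewrite sumR_plus, sumR_scal_r, HW1.
          assert (Hatyp : sumR (fun y => W y * (1 - mu y)) B <= th).
          { eapply Rle_trans; [|apply (HN1 m); lia]. right.
            unfold l. rewrite sumR_words_list_prod, words_bools. fold B Us.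
            apply sumR_ext; intros y Hy.
            change (W y * (1 - mu y) = sumR (fun u => wprod2 PYU y u * ind_lt K (rw y u)) Us).
            assert (Hprod : forall u, In u Us -> W y * (Pw u * rw y u) = wprod2 PYU y u).
            { intros u Hu. unfold rw, Pw, W. rewrite (Rmult_comm (wprod PU u)), <- Rmult_assoc.
              rewrite <- wprod2_mult_l, <- wprod2_mult_r by (rewrite HBlen, HUlen; auto).
              apply wprod2_ext. intros y0 u0 _ Hu0. apply rho_mY, (words_seq_lt u m); assumption. }
            assert (HWy : W y = sumR (wprod2 PYU y) Us).
            { unfold Us. rewrite sumR_wprod2_r by (apply HBlen, Hy).
              apply wprod_ext; intros; symmetry; apply HPYU1. }
            rewrite Rmult_minus_distr_l, Rmult_1_r. unfold mu. rewrite <- sumR_scal.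
            rewrite HWy at 1. rewrite <- sumR_minus. apply sumR_ext; intros u Hu.
            rewrite <- (Hprod u Hu). unfold f, ind_lt. destruct Rlt_dec; ring. }
          assert (HKL : / th * / INR L * K <= th).
          { apply Rmult_le_reg_l with th; [assumption|].
            rewrite <- !Rmult_assoc, Rinv_r, Rmult_1_l by lra.
            apply Rle_trans with (/ Rpower 2 (INR m * r) * K).
            - apply Rmult_le_compat_r; [lra|]. apply Rinv_le_contravar; lra.
            - rewrite <- Rpower_Ropp. unfold K. rewrite <- Rpower_plus.
              replace (- (INR m * r) + INR m * (I + gam)) with (- (INR m * gam))
                by (unfold gam; field).
              apply HN2. lia. }
          unfold th in *. lra. }
  destruct Hcs as (cs & Hcsin & HPhi).
  assert (Hclen : length cs = L) by (apply words_length in Hcsin; assumption).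
  assert (HcUs : forall u, In u cs -> In u Us).
  { intros u Hu. apply in_words in Hcsin. destruct Hcsin as [_ Hfa].
    rewrite Forall_forall in Hfa. apply Hfa, Hu. }
  (* The relay's rule: minimize the conditional cost over the codebook, without any typicality
     test. *)
  assert (HJ : forall y, exists j, (j < L)%nat /\
    forall u, In u cs -> g (nth j cs nil) y <= g u y).
  { intros y. destruct (argmin_exists (fun u => g u y) cs) as (u & Hu & Hmin).
    { intros E. rewrite E in Hclen. simpl in Hclen. lia. }
    apply (In_nth cs u nil) in Hu. destruct Hu as (j & Hj' & Hju).
    exists j. split; [lia|]. rewrite Hju. exact Hmin. }
  set (J := fun y => proj1_sig (constructive_indefinite_description _ (HJ y))).
  assert (HJs : forall y, (J y < L)%nat /\ forall u, In u cs -> g (nth (J y) cs nil) y <= g u y).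
  { intros y. unfold J. destruct constructive_indefinite_description as [j Hj']. exact Hj'. }
  exists cs, J. split; [intros; apply HJs|].
  eapply Rle_trans; [|exact HPhi].
  fold B. rewrite sumR_swap.
  apply Rle_trans with (sumR (fun y => / INR L * sumR (fun u => rw y u * g u y) cs + W y *
     ((1 - mu y) + th + / th * (/ INR L) ^ 2 * (sumR (fun u => f y u - mu y) cs) ^ 2)) B).
  2:{ right. unfold Phi. rewrite sumR_plus. f_equal. rewrite sumR_scal. f_equal.
      unfold a. apply sumR_swap. }
  apply sumR_le; intros y Hy. fold (g (nth (J y) cs nil) y).
  destruct (HJs y) as [_ Hmin].
  set (gm := g (nth (J y) cs nil) y) in *.
  assert (Hgm : 0 <= gm <= W y) by (apply Hg, Hy).
  assert (HLi : 0 < / INR L) by (apply Rinv_0_lt_compat; assumption).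
  set (rh := / INR L * sumR (rw y) cs).
  assert (Hrh : gm * rh <= / INR L * sumR (fun u => rw y u * g u y) cs).
  { unfold rh. rewrite <- Rmult_assoc, (Rmult_comm gm), Rmult_assoc.
    apply Rmult_le_compat_l; [lra|]. rewrite <- sumR_scal. apply sumR_le; intros u Hu.
    rewrite Rmult_comm. apply Rmult_le_compat_l; [apply Hrw, HcUs, Hu|apply Hmin, Hu]. }
  set (D := / INR L * sumR (fun u => f y u - mu y) cs).
  assert (HD2 : / th * (/ INR L) ^ 2 * (sumR (fun u => f y u - mu y) cs) ^ 2 = / th * D ^ 2)
    by (unfold D; ring).
  rewrite HD2.
  assert (HDrh : 1 - rh <= (1 - mu y) - D).
  { assert (HDe : D = / INR L * sumR (f y) cs - mu y).
    { unfold D. rewrite sumR_minus, sumR_const, Hclen. field. lra. }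
    assert (/ INR L * sumR (f y) cs <= rh); [|lra].
    apply Rmult_le_compat_l; [lra|]. apply sumR_le; intros u Hu. apply Hf, HcUs, Hu. }
  assert (HDth : - D <= th + / th * D ^ 2).
  { apply Rmult_le_reg_l with th; [assumption|].
    rewrite Rmult_plus_distr_l, <- Rmult_assoc, Rinv_r by lra. nra. }
  specialize (Hmu1 y Hy).
  assert (HX0 : 0 <= 1 - mu y + th + / th * D ^ 2).
  { assert (0 <= / th * D ^ 2); [|lra].
    apply Rmult_le_pos; [left; apply Rinv_0_lt_compat; assumption|apply pow2_ge_0]. }
  assert (HX : 1 - rh <= 1 - mu y + th + / th * D ^ 2) by lra.
  revert HX HX0. generalize (1 - mu y + th + / th * D ^ 2). intros X HX HX0.
  (* The best cost [gm] splits as [gm * rh + gm * (1 - rh)]. The first part is below the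
     ratio-weighted empirical cost, as [gm] is the minimum; the second is the resolvability
     defect. *)
  assert (gm * (1 - rh) <= W y * X); [|lra].
  destruct (Rle_lt_dec (1 - rh) 0).
  - assert (0 <= W y * X) by (apply Rmult_le_pos; [apply HW|assumption]). nra.
  - apply Rmult_le_compat; lra.
Qed.

End Covering.


(** * Codes for one block *)

Lemma sumR_scal_swap {A B C} (c : R) (f : B -> C -> R) (g : A -> B -> C -> R) lA lB lC :
  c * sumR (fun a => sumR (fun b => sumR (fun x => f b x * g a b x) lC) lB) lA =
  sumR (fun b => sumR (fun x => f b x * (c * sumR (fun a => g a b x) lA)) lC) lB.
Proof.
  rewrite (sumR_swap (fun a b => sumR (fun x => f b x * g a b x) lC)), <- sumR_scal.
  apply sumR_ext; intros b _. rewrite (sumR_swap (fun a x => f b x * g a b x)), <- sumR_scal.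
  apply sumR_ext; intros x _. rewrite sumR_scal. ring.
Qed.

Lemma nat_ceil x : 0 <= x -> exists M, x <= INR M <= x + 1.
Proof.
  intros Hx. destruct (archimed x) as [H1 H2].
  exists (Z.to_nat (up x)). rewrite INR_IZR_INZ, Z2Nat.id; [lra|].
  apply le_IZR. lra.
Qed.

Lemma words_seq_1 m : words (seq 0 1) m = [repeat 0%nat m].
Proof. induction m; [reflexivity|]. cbn [words]. rewrite IHm. reflexivity. Qed.

(** The additive-noise code with side information of a single value. It serves the relay link and,
    when that link is useless, the source. *)
Lemma bsc_code eps r eta : 0 <= eps <= 1 -> 0 <= r -> r < 1 - h eps -> 0 < eta ->
  exists N, forall m, (N <= m)%nat -> forall M, INR M <= Rpower 2 (INR m * r) + 1 ->
  exists (xs : list (list bool)) (dcd : list bool -> nat),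
    length xs = M /\ (forall x, In x xs -> length x = m) /\
    forall w, (w < M)%nat ->
      sumR (fun z => prodber eps z * indb (negb (Nat.eqb (dcd (xorl (nth w xs nil) z)) w)))
        (bitseqs m) <= eta.
Proof.
  intros He Hr0 Hr Heta.
  destruct (additive_code_asymptotic 1 (fun z _ => ber eps z)) with (r := r) (eta := eta)
    as [N HN]; try assumption.
  - intros; apply ber_nonneg, He.
  - unfold sumR; simpl. ring.
  - replace (- _) with (h eps); [assumption|].
    unfold h, sumR; simpl. replace (1 - eps + (eps + 0)) with 1 by ring.
    rewrite !plog_mult_log2, !xlog2_mult_log2. unfold Rdiv. rewrite Rinv_1, !Rmult_1_r. ring.
  - exists N. intros m Hm M HM. destruct (HN m Hm M HM) as (xs & dcd & H1 & H2 & H3).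
    exists xs, (fun y => dcd y (repeat 0%nat m)). split; [assumption|]. split; [assumption|].
    intros w Hw. specialize (H3 w Hw). rewrite words_seq_1 in H3.
    eapply Rle_trans; [|exact H3]. right. unfold sumR at 2. simpl. rewrite Rplus_0_r.
    apply sumR_ext; intros z Hz. apply in_bitseqs in Hz. f_equal.
    clear - Hz. subst m. induction z as [|b z IH]; [reflexivity|].
    simpl repeat. rewrite wprod2_cons, <- IH. reflexivity.
Qed.

(** One block in isolation: the relay word may depend on the whole block [y], and [s] is the noise
    of the link while the index is sent. The delay of one block that makes this causal comes with
    [markov_code]. *)
Definition block_code p d eps m M e (xs : nat -> list bool) (X1 : list bool -> list bool)
  (dcd : list bool -> list bool -> nat) : Prop :=
  (forall w, (w < M)%nat -> length (xs w) = m) /\ (forall y, length (X1 y) = m) /\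
  / INR M * sumR (fun w => sumR (fun z => sumR (fun y => sumR (fun s =>
    wprod2 (jZY p d) z y * prodber eps s *
    indb (negb (Nat.eqb (dcd (xorl (xs w) z) (xorl (X1 y) s)) w)))
    (bitseqs m)) (bitseqs m)) (bitseqs m)) (seq 0 M) <= e.

Lemma block_code_no_relay p d eps r e : 0 <= p <= 1 -> 0 <= d <= 1 -> 0 <= eps <= 1 ->
  0 <= r -> r < 1 - h p -> 0 < e ->
  exists N, forall m, (N <= m)%nat -> exists M xs X1 dcd,
    Rpower 2 (INR m * r) <= INR M /\ block_code p d eps m M e xs X1 dcd.
Proof.
  intros Hp Hd He Hr0 Hr Hepos.
  destruct (bsc_code p r e Hp Hr0 Hr Hepos) as [N HN]. exists N. intros m Hm.
  destruct (nat_ceil (Rpower 2 (INR m * r))) as [M [HM1 HM2]]; [left; apply Rpower2_pos|].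
  destruct (HN m Hm M HM2) as (xs & dcd & Hlen & Hx & Hw).
  assert (HMp : 0 < INR M) by (pose proof (Rpower2_pos (INR m * r)); lra).
  exists M, (fun w => nth w xs nil), (fun _ => repeat false m), (fun y _ => dcd y).
  split; [assumption|]. split; [intros w Hw'; apply Hx, nth_In; lia|].
  split; [intros; apply repeat_length|].
  apply Rmult_le_reg_l with (INR M); [assumption|].
  rewrite <- Rmult_assoc, Rinv_r, Rmult_1_l by lra.
  rewrite <- (length_seq M 0) at 2. rewrite <- sumR_const. apply sumR_le; intros w Hw'.
  apply in_seq in Hw'. eapply Rle_trans; [|apply (Hw w); lia]. right.
  apply sumR_ext; intros z Hz. apply in_bitseqs in Hz.
  rewrite (sumR_ext _ (fun y => wprod2 (jZY p d) z y *
    indb (negb (Nat.eqb (dcd (xorl (nth w xs []) z)) w)))).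
  - rewrite sumR_scal_r. f_equal. rewrite <- words_bools, sumR_wprod2_r by assumption.
    apply wprod_ext; intros; apply jZY_sum_y.
  - intros y _. rewrite sumR_scal_r, sumR_scal, sumR_prodber. ring.
Qed.

Lemma IUY1_nonneg p d k q : 0 <= p <= 1 -> 0 <= d <= 1 -> kernel k q -> 0 <= IUY1 p d k q.
Proof.
  intros Hp Hd Hq. rewrite IUY1_atoms by assumption. apply sumR_nonneg; intros u Hu.
  apply in_seq in Hu. assert (Hqu : forall y, 0 <= q y u) by (intros; apply Hq; lia).
  set (g := fun y => q y u).
  apply Rle_trans with (sumR (fun y => (mY p d y * g y - mY p d y * atU p d g) * / ln 2) bools).
  - right. rewrite sumR_scal_r, sumR_minus, sumR_scal_r, mY_sum. fold (atU p d g). ring.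
  - apply sumR_le; intros y _. apply plog_ge.
    + apply Rmult_le_pos; [apply mY_nonneg; assumption|apply Hqu].
    + apply Rmult_le_pos; [apply mY_nonneg; assumption|apply atU_nonneg; assumption].
    + intros E. apply Rmult_integral in E. destruct E as [->|E]; [ring|].
      apply (atU_0 p d Hp Hd g y Hqu E).
Qed.

(** Both channel codes are fixed first. The quantizer is then built for the cost [psi], the error of
    the source code averaged over messages, which suits a relay ignorant of the message. The thirds
    of [e] pay for a wrong index, for source decoding under the ideal law, and for covering. *)
Lemma block_code_relay p d eps k q r e : 0 <= p <= 1 -> 0 <= d <= 1 -> 0 <= eps <= 1 ->
  kernel k q -> IUY1 p d k q < R0_bsc eps -> 0 <= r -> r < 1 - HZgU p d k q -> 0 < e ->
  exists N, forall m, (N <= m)%nat -> exists M xs X1 dcd,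
    Rpower 2 (INR m * r) <= INR M /\ block_code p d eps m M e xs X1 dcd.
Proof.
  intros Hp Hd He Hq HI Hr0 Hr Hepos.
  pose proof (IUY1_nonneg p d k q Hp Hd Hq) as HI0.
  (* Strictly between [I(U;Y_1)] and [R_0]: enough indices to cover, few enough for the link. *)
  set (r1 := (IUY1 p d k q + R0_bsc eps) / 2).
  destruct (bsc_code eps r1 (e / 3)) as [N1 HN1]; [assumption|unfold r1; lra| |lra|].
  { unfold r1, R0_bsc in *. lra. }
  destruct (additive_code_asymptotic k (pZU p d q)) with (r := r) (eta := e / 3)
    as [N2 HN2]; try assumption; [|apply pU_sum; assumption|lra|].
  { intros; apply (pZU_nonneg p d Hp Hd k q Hq); assumption. }
  destruct (relay_covering p d Hp Hd k q Hq r1 (e / 3)) as [N3 HN3]; [unfold r1; lra|lra|].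
  exists (N1 + N2 + N3)%nat. intros m Hm.
  destruct (nat_ceil (Rpower 2 (INR m * r))) as [M [HM1 HM2]]; [left; apply Rpower2_pos|].
  destruct (nat_ceil (Rpower 2 (INR m * r1))) as [L [HL1 HL2]]; [left; apply Rpower2_pos|].
  destruct (HN1 m ltac:(lia) L HL2) as (x1s & d1 & Hlen1 & Hx1 & Hw1).
  destruct (HN2 m ltac:(lia) M HM2) as (xs & d2 & Hlen2 & Hx2 & Hw2).
  assert (HMp : 0 < INR M) by (pose proof (Rpower2_pos (INR m * r)); lra).
  set (bad := fun w u z => indb (negb (Nat.eqb (d2 (xorl (nth w xs []) z) u) w))).
  set (psi := fun u z => / INR M * sumR (fun w => bad w u z) (seq 0 M)).
  assert (HMs : forall F : nat -> R, (forall w, (w < M)%nat -> F w <= e / 3) ->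
            / INR M * sumR F (seq 0 M) <= e / 3).
  { intros F HF. apply Rmult_le_reg_l with (INR M); [assumption|].
    rewrite <- Rmult_assoc, Rinv_r, Rmult_1_l by lra.
    rewrite <- (length_seq M 0) at 2. rewrite <- sumR_const. apply sumR_le; intros w Hw.
    apply in_seq in Hw. apply HF. lia. }
  assert (HMi : 0 < / INR M) by (apply Rinv_0_lt_compat; assumption).
  destruct (HN3 m ltac:(lia) L HL1 psi) as (us & J & HJ & Hcov).
  { intros u z. split.
    - apply Rmult_le_pos; [lra|]. apply sumR_nonneg; intros; apply indb_bounds.
    - apply Rmult_le_reg_l with (INR M); [assumption|].
      unfold psi. rewrite <- Rmult_assoc, Rinv_r, Rmult_1_l by lra.
      rewrite <- (length_seq M 0) at 2. rewrite <- sumR_const. apply sumR_le; intros; apply indb_bounds. }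
  exists M, (fun w => nth w xs nil), (fun y => nth (J y) x1s nil),
    (fun y s => d2 y (nth (d1 s) us nil)).
  split; [assumption|]. split; [intros w Hw'; apply Hx2, nth_In; lia|].
  split; [intros y; apply Hx1, nth_In; rewrite Hlen1; apply HJ|].
  set (B := bitseqs m) in *.
  set (bad1 := fun y s => indb (negb (Nat.eqb (d1 (xorl (nth (J y) x1s []) s)) (J y)))).
  assert (Hj : forall z y, 0 <= wprod2 (jZY p d) z y)
    by (intros; apply wprod2_nonneg; intros; apply jZY_nonneg; assumption).
  apply Rle_trans with (/ INR M * sumR (fun w => sumR (fun z => sumR (fun y => sumR (fun s =>
    wprod2 (jZY p d) z y * prodber eps s * (bad1 y s + bad w (nth (J y) us nil) z))
     B) B) B) (seq 0 M)).
  { apply Rmult_le_compat_l; [lra|].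
    apply sumR_le; intros w _. apply sumR_le; intros z _. apply sumR_le; intros y _.
    apply sumR_le; intros s _. apply Rmult_le_compat_l.
    - apply Rmult_le_pos; [apply Hj|apply prodber_nonneg, He].
    - unfold bad1, bad. destruct (Nat.eqb_spec (d1 (xorl (nth (J y) x1s []) s)) (J y)) as [-> | _].
      + simpl. lra.
      + match goal with |- indb ?a <= _ + indb ?b =>
          pose proof (indb_bounds a); pose proof (indb_bounds b) end. simpl. lra. }
  rewrite (sumR_ext _ (fun w =>
     sumR (fun z => sumR (fun y => wprod2 (jZY p d) z y * sumR (fun s => prodber eps s * bad1 y s) B) B) B
     + sumR (fun z => sumR (fun y => wprod2 (jZY p d) z y * bad w (nth (J y) us nil) z) B) B)).
  2:{ intros w _. rewrite <- sumR_plus. apply sumR_ext; intros z _.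
      rewrite <- sumR_plus. apply sumR_ext; intros y _.
      rewrite <- Rmult_plus_distr_l.
      rewrite (sumR_ext _ (fun s => wprod2 (jZY p d) z y *
        (prodber eps s * bad1 y s + prodber eps s * bad w (nth (J y) us nil) z))) by (intros; ring).
      rewrite sumR_scal, sumR_plus, sumR_scal_r. unfold B at 2. rewrite sumR_prodber. ring. }
  rewrite sumR_plus, Rmult_plus_distr_l.
  replace e with (e / 3 + (e / 3 + e / 3)) by field.
  apply Rplus_le_compat.
  - apply HMs. intros w _. rewrite <- (Rmult_1_l (e / 3)), <- (sumR_wprod2_jZY p d m).
    rewrite <- sumR_scal_r. apply sumR_le; intros z _.
    rewrite <- sumR_scal_r. apply sumR_le; intros y _.
    apply Rmult_le_compat_l; [apply Hj|]. apply Hw1, HJ.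
  - eapply Rle_trans; [|eapply Rle_trans; [exact Hcov|apply Rplus_le_compat_r]].
    + right. exact (sumR_scal_swap (/ INR M) (wprod2 (jZY p d))
        (fun w z y => bad w (nth (J y) us nil) z) (seq 0 M) B B).
    + eapply Rle_trans; [|apply (HMs _ Hw2)]. right. symmetry.
      exact (sumR_scal_swap (/ INR M) (fun u z => wprod2 (pZU p d q) z u) bad (seq 0 M)
        (words (seq 0 k) m) B).
Qed.

(** * Block Markov coding *)

Lemma sumR_words_firstn {A} (P : A -> R) l (F : list A -> R) m r : sumR P l = 1 ->
  sumR (fun w => wprod P w * F (firstn m w)) (words l (m + r)) =
  sumR (fun w => wprod P w * F w) (words l m).
Proof.
  intros H1. revert F; induction m; intros F.
  - simpl plus. rewrite sumR_words_0. simpl firstn.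
    rewrite sumR_scal_r, sumR_pow_1 by assumption. unfold wprod; simpl; ring.
  - simpl plus. rewrite !sumR_words_S. apply sumR_ext; intros a _.
    rewrite (sumR_ext _ (fun w => P a * (wprod P w * F (a :: firstn m w))))
      by (intros; rewrite wprod_cons; simpl; ring).
    rewrite (sumR_ext (fun w => wprod P (a :: w) * F (a :: w))
       (fun w => P a * (wprod P w * F (a :: w)))) by (intros; rewrite wprod_cons; ring).
    rewrite !sumR_scal. f_equal. apply (IHm (fun w => F (a :: w))).
Qed.

Definition blk {A} (m b : nat) (w : list A) : list A := firstn m (skipn (b * m) w).

Lemma sumR_words_skipn {A} (P : A -> R) l (F : list A -> R) a n : sumR P l = 1 ->
  sumR (fun w => wprod P w * F (skipn a w)) (words l (a + n)) =
  sumR (fun w => wprod P w * F w) (words l n).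
Proof.
  intros H1. induction a; [reflexivity|].
  simpl plus. rewrite sumR_words_S.
  rewrite (sumR_ext _ (fun x => P x * sumR (fun w => wprod P w * F w) (words l n))).
  - rewrite sumR_scal_r, H1. ring.
  - intros x _. rewrite <- IHa, <- sumR_scal. apply sumR_ext; intros w _.
    rewrite wprod_cons. simpl. ring.
Qed.

Lemma sumR_words_blk {A} (P : A -> R) l (F : list A -> R) m b n :
  sumR P l = 1 -> (S b * m <= n)%nat ->
  sumR (fun w => wprod P w * F (blk m b w)) (words l n) =
  sumR (fun w => wprod P w * F w) (words l m).
Proof.
  intros H1 Hn. unfold blk.
  replace n with (b * m + (m + (n - S b * m)))%nat by (simpl in *; lia).
  rewrite (sumR_words_skipn P l (fun w => F (firstn m w))) by assumption.
  apply sumR_words_firstn, H1.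
Qed.

Lemma map_fst_combine {A B} (x : list A) (y : list B) : length x = length y ->
  map fst (combine x y) = x.
Proof.
  revert y; induction x; intros [|b y] H; try discriminate; [reflexivity|].
  simpl. f_equal. apply IHx. simpl in H; congruence.
Qed.

Lemma map_snd_combine {A B} (x : list A) (y : list B) : length x = length y ->
  map snd (combine x y) = y.
Proof.
  revert y; induction x; intros [|b y] H; try discriminate; [reflexivity|].
  simpl. f_equal. apply IHx. simpl in H; congruence.
Qed.

Lemma blk_map {A B} (f : A -> B) m b w : blk m b (map f w) = map f (blk m b w).
Proof. unfold blk. rewrite skipn_map, firstn_map. reflexivity. Qed.

(** A pair of words is read as one i.i.d. word of pairs, whose marginal on a block is already
    known. *)
Lemma sumR_pairs_blk p d (F : list bool -> list bool -> R) m b n : (S b * m <= n)%nat ->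
  sumR (fun z => sumR (fun y => wprod2 (jZY p d) z y * F (blk m b z) (blk m b y))
    (bitseqs n)) (bitseqs n) =
  sumR (fun z => sumR (fun y => wprod2 (jZY p d) z y * F z y) (bitseqs m)) (bitseqs m).
Proof.
  intros Hn.
  set (P := fun zy => jZY p d (fst zy) (snd zy)).
  set (G := fun w => F (map fst w) (map snd w)).
  assert (HP : sumR P (list_prod bools bools) = 1).
  { rewrite sumR_list_prod. unfold P. cbn [fst snd]. rewrite !sumR_bools. unfold jZY; simpl. ring. }
  assert (Hconv : forall j (H : list (bool * bool) -> R) (H' : list bool -> list bool -> R),
     (forall z y, length z = j -> length y = j -> H (combine z y) = H' z y) ->
     sumR (fun z => sumR (fun y => wprod2 (jZY p d) z y * H' z y) (bitseqs j)) (bitseqs j)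
     = sumR (fun w => wprod P w * H w) (words (list_prod bools bools) j)).
  { intros j H H' HH. rewrite sumR_words_list_prod, words_bools.
    apply sumR_ext; intros z Hz. apply sumR_ext; intros y Hy.
    apply in_bitseqs in Hz. apply in_bitseqs in Hy. rewrite HH by assumption. reflexivity. }
  rewrite (Hconv n (fun w => G (blk m b w)) (fun z y => F (blk m b z) (blk m b y))).
  - rewrite (sumR_words_blk P _ G m b n HP Hn). symmetry. apply Hconv.
    intros z y Hz Hy. unfold G. rewrite map_fst_combine, map_snd_combine by congruence. reflexivity.
  - intros z y Hz Hy. unfold G. rewrite <- !blk_map.
    rewrite map_fst_combine, map_snd_combine by congruence. reflexivity.
Qed.

Lemma sumR_prodber_blk eps (F : list bool -> R) m b n : (S b * m <= n)%nat ->
  sumR (fun s => prodber eps s * F (blk m b s)) (bitseqs n) =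
  sumR (fun s => prodber eps s * F s) (bitseqs m).
Proof.
  intros Hn. rewrite <- !words_bools. apply (sumR_words_blk (ber eps)); [|assumption].
  rewrite sumR_bools. simpl. ring.
Qed.

Lemma xorl_firstn m x y : firstn m (xorl x y) = xorl (firstn m x) (firstn m y).
Proof.
  revert x y; induction m; intros x y; [reflexivity|].
  destruct x; [reflexivity|]. destruct y; [reflexivity|]. simpl. f_equal. apply IHm.
Qed.

Lemma xorl_skipn m x y : length x = length y -> skipn m (xorl x y) = xorl (skipn m x) (skipn m y).
Proof.
  revert x y; induction m; intros x y H; [reflexivity|].
  destruct x; destruct y; try discriminate; [reflexivity|]. simpl. apply IHm. simpl in H; congruence.
Qed.

Lemma blk_xorl m b x y : length x = length y -> blk m b (xorl x y) = xorl (blk m b x) (blk m b y).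
Proof. intros H. unfold blk. rewrite xorl_skipn by assumption. apply xorl_firstn. Qed.

Lemma map_seq_shift {A} (f : nat -> A) c j :
  map f (seq c j) = map (fun o => f (c + o)%nat) (seq 0 j).
Proof.
  revert f c; induction j; intros f c; [reflexivity|].
  cbn [seq map]. rewrite Nat.add_0_r, (IHj (fun o => f (c + o)%nat) 1%nat). f_equal.
  rewrite IHj. apply map_ext. intros o. f_equal. lia.
Qed.

Lemma blk_map_seq {A} (f : nat -> A) m b n : (S b * m <= n)%nat ->
  blk m b (map f (seq 0 n)) = map (fun o => f (b * m + o)%nat) (seq 0 m).
Proof.
  intros Hn. rewrite blk_map. unfold blk. rewrite skipn_seq.
  replace (n - b * m)%nat with (m + (n - S b * m))%nat by (simpl in *; lia).
  rewrite seq_app, firstn_app, length_seq, Nat.sub_diag, firstn_0, app_nil_r.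
  rewrite <- (length_seq m (0 + b * m)) at 1. rewrite firstn_all. apply map_seq_shift.
Qed.


Definition digit (M b w : nat) : nat := ((w / M ^ b) mod M)%nat.

Definition of_digits (M : nat) (l : list nat) : nat := fold_right (fun x acc => x + M * acc)%nat 0%nat l.

Lemma of_digits_digit M B : forall w, (w < M ^ B)%nat ->
  of_digits M (map (fun b => digit M b w) (seq 0 B)) = w.
Proof.
  induction B as [|B IH]; intros w Hw; [simpl in *; lia|].
  assert (HM : M <> 0%nat) by (intros ->; simpl in Hw; lia).
  rewrite <- cons_seq, <- seq_shift. cbn [map]. rewrite map_map.
  rewrite (map_ext (fun b => digit M (S b) w) (fun b => digit M b (w / M))).
  - unfold of_digits. cbn [fold_right]. fold (of_digits M (map (fun b => digit M b (w / M)) (seq 0 B))).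
    rewrite IH.
    + unfold digit. rewrite Nat.pow_0_r, Nat.div_1_r. pose proof (Nat.div_mod_eq w M). lia.
    + apply Nat.Div0.div_lt_upper_bound. simpl in Hw. assumption.
  - intros b. unfold digit. rewrite Nat.Div0.div_div. reflexivity.
Qed.

Lemma sumR_seq_mult (f : nat -> R) a c :
  sumR f (seq 0 (a * c)) = sumR (fun i => sumR (fun j => f (i * a + j)%nat) (seq 0 a)) (seq 0 c).
Proof.
  induction c.
  - rewrite Nat.mul_0_r. reflexivity.
  - rewrite Nat.mul_succ_r, seq_app, sumR_app, IHc, seq_S, sumR_app. f_equal.
    rewrite sumR_cons. rewrite (sumR_0 _ nil) by (intros ? []). rewrite Rplus_0_r.
    rewrite <- (map_id (seq (0 + a * c) a)), map_seq_shift, sumR_map.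
    apply sumR_ext; intros j _. f_equal. lia.
Qed.

(** Each block carries one base-[M] digit of the message, and a digit of a uniform message is
    uniform; so the average error of the single-block code applies in every block. *)
Lemma sumR_digit (phi : nat -> R) M B b : (0 < M)%nat -> (b < B)%nat ->
  / INR (M ^ B) * sumR (fun w => phi (digit M b w)) (seq 0 (M ^ B)) =
  / INR M * sumR phi (seq 0 M).
Proof.
  intros HM Hb.
  replace (M ^ B)%nat with (M ^ b * (M * M ^ (B - S b)))%nat.
  2:{ rewrite <- Nat.pow_succ_r', <- Nat.pow_add_r. f_equal. lia. }
  set (a := (M ^ b)%nat). set (c := (M ^ (B - S b))%nat).
  assert (Ha : (a <> 0)%nat) by (apply Nat.pow_nonzero; lia).
  assert (Hc : (c <> 0)%nat) by (apply Nat.pow_nonzero; lia).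
  rewrite sumR_seq_mult.
  rewrite (sumR_ext _ (fun i => INR a * phi (i mod M)%nat)).
  - rewrite sumR_scal, sumR_seq_mult.
    rewrite (sumR_ext _ (fun _ => sumR phi (seq 0 M))).
    + rewrite sumR_const, length_seq, !mult_INR. field.
      repeat split; apply not_0_INR; assumption || lia.
    + intros i _. apply sumR_ext; intros j Hj. apply in_seq in Hj.
      rewrite Nat.add_comm, Nat.Div0.mod_add, Nat.mod_small by lia. reflexivity.
  - intros i _. rewrite <- (length_seq a 0) at 2. rewrite <- sumR_const.
    apply sumR_ext; intros j Hj. apply in_seq in Hj.
    unfold digit. fold a. rewrite Nat.div_add_l, (Nat.div_small j a), Nat.add_0_r by lia.
    reflexivity.
Qed.

(** The relay sends 0 during block 0 and describes block [b] during block [S b], so block [b] of [y]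
    is decoded together with block [S b] of [s]. What the source sends from block [B] on is ignored
    by the decoder. *)
Definition markov_code (m M B : nat) (xs : nat -> list bool) (X1 : list bool -> list bool)
  (dcd : list bool -> list bool -> nat) : code := mkCode
  (fun w i => nth (i mod m) (xs (digit M (i / m) w)) false)
  (fun i l => match (i / m)%nat with
              | O => false
              | S b => nth (i mod m) (X1 (blk m b l)) false
              end)
  (fun y s => of_digits M (map (fun b => dcd (blk m b y) (blk m (S b) s)) (seq 0 B))).

(** Back from the received [s] to the link noise, whose blocks are independent of everything else,
    unlike those of the received word. *)
Lemma Perr_noise p d eps n M c : Perr p d eps n M c = / INR M * sumR (fun w =>
  sumR (fun z => sumR (fun y => sumR (fun s =>
    wprod2 (jZY p d) z y * prodber eps s * err_at n c w z (xorl (relayword c n y) s))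
    (bitseqs n)) (bitseqs n)) (bitseqs n)) (seq 0 M).
Proof.
  rewrite Perr_change. f_equal. apply sumR_ext; intros w _. apply sumR_ext; intros z _.
  apply sumR_ext; intros y _. symmetry.
  etransitivity; [|apply (sumR_bitseqs_xorl _ (relayword c n y) n), relayword_length].
  apply sumR_ext; intros s Hs. apply in_bitseqs in Hs.
  rewrite xorl_cancel by (rewrite relayword_length; congruence). reflexivity.
Qed.

Section BlockMarkov.
Variables p d eps : R.
Hypothesis Hp : 0 <= p <= 1.
Hypothesis Hd : 0 <= d <= 1.
Hypothesis He : 0 <= eps <= 1.
Variables m M B n : nat.
Variable e : R.
Variable xs : nat -> list bool.
Variable X1 : list bool -> list bool.
Variable dcd : list bool -> list bool -> nat.
Hypothesis Hm : (0 < m)%nat.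
Hypothesis HM : (0 < M)%nat.
Hypothesis Hn : (S B * m <= n)%nat.
Hypothesis Hcode : block_code p d eps m M e xs X1 dcd.

Let c := markov_code m M B xs X1 dcd.

Lemma blk_codeword b w : (b < B)%nat -> blk m b (codeword c n w) = xs (digit M b w).
Proof.
  intros Hb. unfold codeword. rewrite blk_map_seq by nia.
  destruct Hcode as [Hx _].
  assert (Hlen : length (xs (digit M b w)) = m) by (apply Hx, Nat.mod_upper_bound; lia).
  rewrite <- (map_nth_seq (xs (digit M b w)) false m Hlen).
  apply map_ext_in. intros o Ho. apply in_seq in Ho. simpl.
  rewrite Nat.div_add_l, (Nat.div_small o m), Nat.add_0_r by lia.
  rewrite (Nat.add_comm (b * m) o), Nat.Div0.mod_add, Nat.mod_small by lia. reflexivity.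
Qed.

Lemma blk_firstn {A} b i (y : list A) : (S b * m <= i)%nat -> blk m b (firstn i y) = blk m b y.
Proof.
  intros Hi. unfold blk. rewrite skipn_firstn_comm, firstn_firstn.
  f_equal. simpl in Hi. lia.
Qed.

Lemma blk_relayword b y : (b < B)%nat -> blk m (S b) (relayword c n y) = X1 (blk m b y).
Proof.
  intros Hb. unfold relayword. rewrite blk_map_seq by nia.
  destruct Hcode as (_ & HX & _).
  rewrite <- (map_nth_seq (X1 (blk m b y)) false m (HX _)).
  apply map_ext_in. intros o Ho. apply in_seq in Ho.
  unfold c, markov_code; cbn [relay].
  rewrite Nat.div_add_l, (Nat.div_small o m), Nat.add_0_r by lia.
  rewrite (Nat.add_comm (S b * m) o), Nat.Div0.mod_add, Nat.mod_small by lia.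
  rewrite blk_firstn by lia. reflexivity.
Qed.

Lemma markov_error_union w z y s : (w < M ^ B)%nat -> length z = n -> length s = n ->
  err_at n c w z (xorl (relayword c n y) s) <=
  sumR (fun b => indb (negb (Nat.eqb
    (dcd (xorl (xs (digit M b w)) (blk m b z)) (xorl (X1 (blk m b y)) (blk m (S b) s)))
    (digit M b w)))) (seq 0 B).
Proof.
  intros Hw Hz Hs.
  set (D := fun b => dcd (xorl (xs (digit M b w)) (blk m b z)) (xorl (X1 (blk m b y)) (blk m (S b) s))).
  assert (Hdec : dec c (xorl (codeword c n w) z) (xorl (relayword c n y) s)
     = of_digits M (map D (seq 0 B))).
  { unfold c at 1, markov_code; cbn [dec]. f_equal. apply map_ext_in. intros b Hb.
    apply in_seq in Hb. unfold D.
    rewrite !blk_xorl by (rewrite ?codeword_length, ?relayword_length; congruence).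
    rewrite blk_codeword, blk_relayword by lia. reflexivity. }
  unfold err_at. rewrite Hdec.
  destruct (Forall_Exists_dec (fun b => D b = digit M b w)) with (l := seq 0 B) as [Hall|Hex].
  { intros b. apply Nat.eq_dec. }
  - rewrite Forall_forall in Hall.
    rewrite (map_ext_in D (fun b => digit M b w)) by exact Hall.
    rewrite of_digits_digit, Nat.eqb_refl by assumption.
    apply sumR_nonneg; intros; apply indb_bounds.
  - apply Exists_exists in Hex. destruct Hex as (b & Hb & Hne).
    apply Rle_trans with 1; [destruct Nat.eqb; lra|].
    eapply Rle_trans; [|apply (sumR_term_le _ _ b); [intros; apply indb_bounds|exact Hb]].
    cbv beta. fold (D b). destruct (Nat.eqb_spec (D b) (digit M b w)); [contradiction|simpl; lra].
Qed.

(** A union bound over the [B] blocks. No independence between block errors enters, only the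
    marginal law of what block [b] uses. *)
Lemma markov_code_error : Perr p d eps n (M ^ B) c <= INR B * e.
Proof.
  destruct Hcode as (_ & _ & Hcode').
  set (E := fun v z y s => indb (negb (Nat.eqb (dcd (xorl (xs v) z) (xorl (X1 y) s)) v))).
  set (phi := fun v => sumR (fun z => sumR (fun y => sumR (fun s =>
    wprod2 (jZY p d) z y * prodber eps s * E v z y s) (bitseqs m)) (bitseqs m)) (bitseqs m)).
  assert (HMB : 0 < / INR (M ^ B)).
  { apply Rinv_0_lt_compat, lt_0_INR. apply Nat.neq_0_lt_0, Nat.pow_nonzero. lia. }
  rewrite Perr_noise.
  apply Rle_trans with (/ INR (M ^ B) * sumR (fun w => sumR (fun b => phi (digit M b w)) (seq 0 B))
    (seq 0 (M ^ B))).
  - apply Rmult_le_compat_l; [lra|]. apply sumR_le; intros w Hw. apply in_seq in Hw.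
    set (G := fun b z y s => prodber eps s * E (digit M b w) (blk m b z) (blk m b y) (blk m (S b) s)).
    apply Rle_trans with (sumR (fun b => sumR (fun z => sumR (fun y => wprod2 (jZY p d) z y *
      sumR (G b z y) (bitseqs n)) (bitseqs n)) (bitseqs n)) (seq 0 B)).
    + rewrite (sumR_swap (fun b z => sumR (fun y => wprod2 (jZY p d) z y *
        sumR (G b z y) (bitseqs n)) (bitseqs n))).
      apply sumR_le; intros z Hz. apply in_bitseqs in Hz.
      rewrite (sumR_swap (fun b y => wprod2 (jZY p d) z y * sumR (G b z y) (bitseqs n))).
      apply sumR_le; intros y _.
      rewrite (sumR_scal (wprod2 (jZY p d) z y) (fun b => sumR (G b z y) (bitseqs n))).
      rewrite (sumR_swap (fun b s => G b z y s)), <- sumR_scal.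
      apply sumR_le; intros s Hs. apply in_bitseqs in Hs. unfold G.
      rewrite sumR_scal, <- Rmult_assoc. apply Rmult_le_compat_l.
      * apply Rmult_le_pos; [|apply prodber_nonneg, He].
        apply wprod2_nonneg; intros; apply jZY_nonneg; assumption.
      * apply markov_error_union; [lia|assumption|assumption].
    + right. apply sumR_ext; intros b Hb. apply in_seq in Hb.
      rewrite (sumR_ext _ (fun z => sumR (fun y => wprod2 (jZY p d) z y *
        sumR (fun s => prodber eps s * E (digit M b w) (blk m b z) (blk m b y) s) (bitseqs m))
        (bitseqs n))).
      * rewrite (sumR_pairs_blk p d (fun z y =>
          sumR (fun s => prodber eps s * E (digit M b w) z y s) (bitseqs m))) by nia.
        apply sumR_ext; intros z _. apply sumR_ext; intros y _.
        rewrite <- sumR_scal. apply sumR_ext; intros; ring.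
      * intros z _. apply sumR_ext; intros y _. f_equal.
        apply (sumR_prodber_blk eps (E (digit M b w) (blk m b z) (blk m b y))). nia.
  - rewrite sumR_swap, <- sumR_scal. rewrite <- (length_seq B 0) at 2. rewrite <- sumR_const.
    apply sumR_le; intros b Hb. apply in_seq in Hb.
    rewrite sumR_digit by lia. exact Hcode'.
Qed.

End BlockMarkov.

(** * From block codes to achievable rates *)

Lemma Perr_nonneg p d eps n M c : 0 <= p <= 1 -> 0 <= d <= 1 -> 0 <= eps <= 1 ->
  0 <= Perr p d eps n M c.
Proof.
  intros Hp Hd He. rewrite Perr_change. apply Rmult_le_pos.
  - destruct (Req_dec (INR M) 0) as [->|]; [rewrite Rinv_0; lra|].
    pose proof (pos_INR M). left; apply Rinv_0_lt_compat; lra.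
  - apply sumR_nonneg; intros w _. apply sumR_nonneg; intros z _. apply sumR_nonneg; intros y _.
    apply sumR_nonneg; intros s _. apply Rmult_le_pos; [|apply err_at_bounds].
    apply Rmult_le_pos; [|apply prodber_nonneg, He].
    apply wprod2_nonneg; intros; apply jZY_nonneg; assumption.
Qed.

Lemma near_minimizer {A} (V : A -> Prop) (f : A -> R) dlt :
  (exists a, V a) -> (forall a, 0 <= f a) -> 0 < dlt ->
  exists a, V a /\ forall a', V a' -> f a <= f a' + dlt.
Proof.
  intros [a0 Ha0] Hf Hdlt.
  destruct (completeness (fun x => exists a, V a /\ x = - f a)) as [s [Hs1 Hs2]].
  - exists 0. intros x (a & _ & ->). specialize (Hf a). lra.
  - exists (- f a0), a0. split; [assumption|reflexivity].
  - destruct (excluded_middle_informative (exists a, V a /\ s - dlt <= - f a)) as [(a & Ha & Hle)|Hno].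
    + exists a. split; [assumption|]. intros a' Ha'.
      assert (- f a' <= s) by (apply Hs1; exists a'; split; [assumption|reflexivity]). lra.
    + exfalso. assert (s <= s - dlt); [|lra]. apply Hs2. intros x (a & Ha & ->).
      destruct (Rle_lt_dec (- f a) (s - dlt)) as [|Hlt]; [assumption|].
      exfalso. apply Hno. exists a. split; [assumption|lra].
Qed.

(** [achievable] wants one sequence of codes, whereas the hypothesis gives, for each error level,
    codes at large lengths. At every [n] a code within [1/(n+1)] of the infimum is taken, as the
    infimum over unboundedly many [M] need not be attained; this sequence beats all error levels at
    once. *)
Lemma achievable_of_eventually p d eps Rt : 0 <= p <= 1 -> 0 <= d <= 1 -> 0 <= eps <= 1 ->
  (forall e, 0 < e -> exists N, forall n, (N <= n)%nat -> exists M c,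
     Rpower 2 (INR n * Rt) <= INR M /\ Perr p d eps n M c <= e) ->
  achievable p d eps Rt.
Proof.
  intros Hp Hd He Hev.
  assert (Hex : forall n, exists Mc : nat * code, Rpower 2 (INR n * Rt) <= INR (fst Mc) /\
     forall Mc', Rpower 2 (INR n * Rt) <= INR (fst Mc') ->
       Perr p d eps n (fst Mc) (snd Mc) <= Perr p d eps n (fst Mc') (snd Mc') + / INR (S n)).
  { intros n. apply (near_minimizer (fun Mc : nat * code => Rpower 2 (INR n * Rt) <= INR (fst Mc))
      (fun Mc => Perr p d eps n (fst Mc) (snd Mc))).
    - destruct (nat_ceil (Rpower 2 (INR n * Rt))) as [M [HM _]]; [left; apply Rpower2_pos|].
      exists (M, mkCode (fun _ _ => false) (fun _ _ => false) (fun _ _ => 0%nat)). exact HM.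
    - intros; apply Perr_nonneg; assumption.
    - apply Rinv_0_lt_compat, lt_0_INR. lia. }
  set (S := fun n => proj1_sig (constructive_indefinite_description _ (Hex n))).
  assert (HS : forall n, Rpower 2 (INR n * Rt) <= INR (fst (S n)) /\
     forall Mc', Rpower 2 (INR n * Rt) <= INR (fst Mc') ->
       Perr p d eps n (fst (S n)) (snd (S n)) <= Perr p d eps n (fst Mc') (snd Mc') + / INR (Datatypes.S n)).
  { intros n. unfold S. destruct constructive_indefinite_description as [Mc HMc]. exact HMc. }
  exists (fun n => fst (S n)), (fun n => snd (S n)). split; [intros; apply HS|].
  intros e Hepos. destruct (Hev (e / 2)) as [N1 HN1]; [lra|].
  destruct (archimed_cor1 (e / 2)) as (N2 & HN2 & HN20); [lra|].
  exists (N1 + N2)%nat. intros n Hn.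
  destruct (HN1 n) as (M & c & HM & Hc); [lia|].
  destruct (HS n) as [_ HS2]. specialize (HS2 (M, c) HM). simpl fst in HS2 at 2. simpl snd in HS2 at 2.
  unfold Rdist. rewrite Rminus_0_r, Rabs_pos_eq by (apply Perr_nonneg; assumption).
  assert (/ INR (Datatypes.S n) <= / INR N2).
  { apply Rinv_le_contravar; [apply lt_0_INR; lia|apply le_INR; lia]. }
  cbn [fst snd] in HS2. lra.
Qed.

Lemma achievable_of_block_codes p d eps Rt r : 0 <= p <= 1 -> 0 <= d <= 1 -> 0 <= eps <= 1 ->
  0 <= Rt -> Rt < r ->
  (forall e, 0 < e -> exists N, forall m, (N <= m)%nat -> exists M xs X1 dcd,
    Rpower 2 (INR m * r) <= INR M /\ block_code p d eps m M e xs X1 dcd) ->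
  achievable p d eps Rt.
Proof.
  intros Hp Hd He HR0 HR Hblocks. apply achievable_of_eventually; try assumption.
  intros e Hepos.
  (* with [B] blocks carrying messages out of [B + 1], the rate loss is small enough *)
  destruct (archimed_cor1 ((r - Rt) / (Rt + 1))) as (B & HB & HB0).
  { apply Rdiv_lt_0_compat; lra. }
  assert (HBp : 0 < INR B) by (apply lt_0_INR; assumption).
  assert (Hgap : 0 < INR B * r - (INR B + 1) * Rt).
  { apply Rmult_lt_compat_l with (r := INR B * (Rt + 1)) in HB; [|apply Rmult_lt_0_compat; lra].
    replace (INR B * (Rt + 1) * / INR B) with (Rt + 1) in HB by (field; lra).
    replace (INR B * (Rt + 1) * ((r - Rt) / (Rt + 1))) with (INR B * (r - Rt)) in HB by (field; lra).
    lra. }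
  set (gap := INR B * r - (INR B + 1) * Rt) in *.
  assert (HBR : 0 <= (INR B + 1) * Rt) by (apply Rmult_le_pos; lra).
  (* Rounding [n] to a multiple of [B + 1] costs up to [(B + 1) Rt] further bits, which [m * gap]
     exceeds once [m >= m0]. *)
  destruct (archimed_cor1 (gap / ((INR B + 1) * Rt + 1))) as (m0 & Hm0 & Hm00).
  { apply Rdiv_lt_0_compat; lra. }
  (* The union bound over [B] blocks multiplies the block error by [B]. *)
  destruct (Hblocks (e / INR B)) as [N HN]; [apply Rdiv_lt_0_compat; assumption|].
  exists (S B * (m0 + N))%nat. intros n Hn.
  set (m := (n / S B)%nat).
  assert (Hm : (m0 + N <= m)%nat) by (apply Nat.div_le_lower_bound; lia).
  assert (Hmn : (S B * m <= n)%nat) by apply Nat.Div0.mul_div_le.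
  assert (Hnm : (n < S B * S m)%nat) by (apply Nat.mul_succ_div_gt; lia).
  destruct (HN m ltac:(lia)) as (M & xs & X1 & dcd & HM & Hcode).
  assert (HMp : (0 < M)%nat).
  { apply INR_lt. simpl. pose proof (Rpower2_pos (INR m * r)). lra. }
  exists (M ^ B)%nat, (markov_code m M B xs X1 dcd). split.
  - rewrite pow_INR.
    apply Rle_trans with (Rpower 2 (INR m * r) ^ B).
    + rewrite <- Rpower_pow by apply Rpower2_pos. rewrite Rpower_mult. apply Rpower2_le.
      assert (HnR : INR n <= (INR B + 1) * (INR m + 1)).
      { rewrite <- !S_INR, <- mult_INR. apply le_INR. lia. }
      apply Rle_trans with ((INR B + 1) * (INR m + 1) * Rt); [apply Rmult_le_compat_r; assumption|].
      assert (Hm0p : 0 < INR m0) by (apply lt_0_INR; assumption).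
      assert (Hmm : INR m0 <= INR m) by (apply le_INR; lia).
      apply Rmult_lt_compat_l with (r := INR m0 * ((INR B + 1) * Rt + 1)) in Hm0;
        [|apply Rmult_lt_0_compat; lra].
      replace (INR m0 * ((INR B + 1) * Rt + 1) * / INR m0) with ((INR B + 1) * Rt + 1) in Hm0
        by (field; lra).
      replace (INR m0 * ((INR B + 1) * Rt + 1) * (gap / ((INR B + 1) * Rt + 1))) with
        (INR m0 * gap) in Hm0 by (field; lra).
      assert (INR m0 * gap <= INR m * gap) by (apply Rmult_le_compat_r; lra).
      replace (INR m * r * INR B) with (INR m * gap + INR m * ((INR B + 1) * Rt)) by (unfold gap; ring).
      lra.
    + apply pow_incr. split; [left; apply Rpower2_pos|assumption].
  - eapply Rle_trans; [eapply markov_code_error; try eassumption; lia|].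
    right. field. lra.
Qed.

(** A single message, decoded as 0, is enough; the coding construction above starts from
    [0 <= Rt]. *)
Lemma achievable_negative p d eps Rt : Rt < 0 -> achievable p d eps Rt.
Proof.
  intros HR. exists (fun _ => 1%nat),
    (fun _ => mkCode (fun _ _ => false) (fun _ _ => false) (fun _ _ => 0%nat)).
  split.
  - intros n. cbv beta. rewrite INR_1, <- (Rpower_O 2) by lra. apply Rpower2_le.
    pose proof (pos_INR n). nra.
  - intros e Hepos. exists 0%nat. intros n _.
    replace (Perr p d eps n 1 _) with 0.
    + unfold Rdist. rewrite Rminus_diag, Rabs_R0. assumption.
    + unfold Perr. symmetry. apply Rmult_eq_0_compat_l.
      apply sumR_0; intros w Hw. apply in_seq in Hw. assert (w = 0)%nat by lia. subst w.
      apply sumR_0; intros z _. apply sumR_0; intros v _. apply sumR_0; intros s _.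
      unfold err_ind. simpl. ring.
Qed.

Lemma atomH_independent p d g : (forall y, 0 <= g y) -> 0 <= p <= 1 -> 0 <= d <= 1 ->
  (forall y, mY p d y * g y = mY p d y * atU p d g) -> atomH p d g = atU p d g * h p.
Proof.
  intros Hg Hp Hd H.
  rewrite <- (atomH_erasure p d) by (apply atU_nonneg; assumption).
  unfold atomH at 1 2. f_equal. apply sumR_ext; intros z _. f_equal.
  - unfold atZ. apply sumR_ext; intros y _.
    destruct (Req_dec (mY p d y) 0) as [E|E].
    + rewrite (jZY_mY_0 p d Hp Hd z y E). ring.
    + f_equal. apply Rmult_eq_reg_l with (mY p d y); [apply H|assumption].
  - unfold atU at 2, erasure. rewrite sumR_scal_r, mY_sum. ring.
Qed.

(** [gap] is the excess of each term over its tangent bound. It is nonnegative and sums to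
    [I(U;Y_1)], so it vanishes everywhere, and the equality case gives [P(y,u) = P(y) P(u)]. *)
Lemma HZgU_of_IUY1_0 p d k q : 0 <= p <= 1 -> 0 <= d <= 1 -> kernel k q ->
  IUY1 p d k q <= 0 -> HZgU p d k q = h p.
Proof.
  intros Hp Hd Hq HI. rewrite IUY1_atoms in HI by assumption. rewrite HZgU_atoms.
  pose proof (pU_sum p d k q Hq) as H1.
  rewrite <- (Rmult_1_l (h p)), <- H1, <- sumR_scal_r. apply sumR_ext; intros u Hu.
  rewrite pU_at. set (G := fun u y => q y u). fold (G u).
  assert (HG : forall u, In u (seq 0 k) -> forall y, 0 <= G u y).
  { intros u' Hu' y. apply in_seq in Hu'. apply Hq. lia. }
  apply atomH_independent; try assumption; [apply HG, Hu|].
  set (gap := fun u y => plog (mY p d y * G u y) (mY p d y * atU p d (G u))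
      - (mY p d y * G u y - mY p d y * atU p d (G u)) / ln 2).
  assert (Hgap : forall u, In u (seq 0 k) -> forall y, 0 <= gap u y).
  { intros u' Hu' y. unfold gap.
    assert (Hge : (mY p d y * G u' y - mY p d y * atU p d (G u')) / ln 2 <=
      plog (mY p d y * G u' y) (mY p d y * atU p d (G u'))); [|lra].
    apply plog_ge.
    - apply Rmult_le_pos; [apply mY_nonneg; assumption|apply HG, Hu'].
    - apply Rmult_le_pos; [apply mY_nonneg; assumption|apply atU_nonneg; try assumption; apply HG, Hu'].
    - intros E. apply Rmult_integral in E. destruct E as [->|E]; [ring|].
      apply (atU_0 p d Hp Hd (G u') y (HG u' Hu') E). }
  assert (Hsum : forall u, sumR (gap u) bools = atomI p d (G u)).
  { intros u'. unfold gap, Rdiv. rewrite sumR_minus, sumR_scal_r, sumR_minus, sumR_scal_r, mY_sum.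
    unfold atomI. fold (atU p d (G u')). ring. }
  assert (Htot : sumR (fun u => sumR (gap u) bools) (seq 0 k) = 0).
  { apply Rle_antisym.
    - rewrite (sumR_ext _ (fun u => atomI p d (G u))) by (intros; apply Hsum). exact HI.
    - apply sumR_nonneg; intros; apply sumR_nonneg; intros; apply Hgap; assumption. }
  intros y.
  assert (Hz : gap u y = 0).
  { apply (sumR_eq_0 (gap u) bools y); [intros; apply Hgap, Hu| |destruct y; simpl; tauto].
    apply (sumR_eq_0 (fun u => sumR (gap u) bools) (seq 0 k) u); try assumption.
    intros; apply sumR_nonneg; intros; apply Hgap; assumption. }
  apply plog_le_eq.
  - apply Rmult_le_pos; [apply mY_nonneg; assumption|apply HG, Hu].
  - apply Rmult_le_pos; [apply mY_nonneg; assumption|apply atU_nonneg; try assumption; apply HG, Hu].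
  - intros E. apply Rmult_integral in E. destruct E as [->|E]; [ring|].
    apply (atU_0 p d Hp Hd (G u) y (HG u Hu) E).
  - unfold gap in Hz. lra.
Qed.

Lemma kernel_erasure p d k q lam : 0 <= lam <= 1 -> kernel k q ->
  exists k' q', kernel k' q' /\ IUY1 p d k' q' = (1 - lam) * IUY1 p d k q /\
    HZgU p d k' q' = (1 - lam) * HZgU p d k q + lam * h p.
Proof.
  intros Hlam Hq.
  set (gs := erasure lam :: map (fun u y => (1 - lam) * q y u) (seq 0 k)).
  assert (Hat : atoms 1 gs).
  { split.
    - intros g [<-|Hg] y; [unfold erasure; lra|]. apply in_map_iff in Hg.
      destruct Hg as (u & <- & Hu). apply in_seq in Hu. apply Rmult_le_pos; [lra|]. apply Hq. lia.
    - intros y. unfold gs. rewrite sumR_cons, sumR_map, sumR_scal, (proj2 Hq y).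
      unfold erasure. ring. }
  exists (length gs), (kernel_of_atoms gs). split; [apply kernel_of_atoms_spec, Hat|]. split.
  - rewrite IUY1_of_atoms, IUY1_atoms by assumption. unfold gs.
    rewrite sumR_cons, sumR_map, atomI_erasure, Rplus_0_l, <- sumR_scal by lra.
    apply sumR_ext; intros u _. apply (atomI_scal p d (1 - lam) (fun y => q y u)). lra.
  - rewrite HZgU_of_atoms, HZgU_atoms. unfold gs.
    rewrite sumR_cons, sumR_map, atomH_erasure, <- sumR_scal by lra.
    rewrite Rplus_comm. f_equal.
    apply sumR_ext; intros u _. apply (atomH_scal p d (1 - lam) (fun y => q y u)). lra.
Qed.

Lemma achievable_below p d eps k q Rt : 0 <= p <= 1 -> 0 <= d <= 1 -> 0 <= eps <= 1 ->
  kernel k q -> IUY1 p d k q <= R0_bsc eps -> Rt < 1 - HZgU p d k q -> achievable p d eps Rt.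
Proof.
  intros Hp Hd He Hq HI HR.
  destruct (Rlt_le_dec Rt 0) as [Hneg|HR0]; [apply achievable_negative, Hneg|].
  destruct (Rle_lt_dec (R0_bsc eps) 0) as [Hr0|Hr0].
  (* No kernel has [I < R_0] here, so the relay is given up and the source codes against [Z]
     alone. *)
  - rewrite (HZgU_of_IUY1_0 p d k q) in HR by (assumption || lra).
    apply achievable_of_block_codes with ((Rt + (1 - h p)) / 2); try assumption; [lra|].
    intros e Hepos. apply block_code_no_relay; try assumption; lra.
  - pose proof (HZgU_nonneg p d k q Hp Hd Hq) as HH. pose proof (h_le_1 p Hp) as Hh.
    (* Erasing adds at most [lam] to [H(Z|U)], since [h p <= 1], so half of the gap leaves [Rt]
       strictly below the new value; the minimum with 1 keeps [lam] a probability. *)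
    set (lam := Rmin 1 ((1 - HZgU p d k q - Rt) / 2)).
    assert (Hl1 : lam <= 1) by apply Rmin_l.
    assert (Hl2 : lam <= (1 - HZgU p d k q - Rt) / 2) by apply Rmin_r.
    assert (Hl0 : 0 < lam) by (apply Rmin_glb_lt; lra).
    destruct (kernel_erasure p d k q lam) as (k' & q' & Hq' & HI' & HH'); [lra|assumption|].
    assert (HR' : Rt < 1 - HZgU p d k' q') by (rewrite HH'; nra).
    apply achievable_of_block_codes with ((Rt + (1 - HZgU p d k' q')) / 2); try assumption; [lra|].
    intros e Hepos. apply block_code_relay with k' q'; try assumption; try lra.
    rewrite HI'. nra.
Qed.

Theorem theorem1 (p delta eps : R) :
  0 <= p <= 1 -> 0 <= delta <= 1 -> 0 <= eps <= 1 ->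
  exists C : R,
    is_lub (achievable p delta eps) C /\
    (exists q : bool -> nat -> R,
        kernel 4 q /\ IUY1 p delta 4 q <= R0_bsc eps /\ 1 - HZgU p delta 4 q = C) /\
    (forall (k : nat) (q : bool -> nat -> R),
        kernel k q -> IUY1 p delta k q <= R0_bsc eps -> 1 - HZgU p delta k q <= C).
Proof.
  intros Hp Hd He.
  destruct (kernel_max_exists p delta (R0_bsc eps)) as (q & Hq & HI & Hmax); try assumption.
  { unfold R0_bsc. pose proof (h_le_1 eps He). lra. }
  assert (Hall : forall k q', kernel k q' -> IUY1 p delta k q' <= R0_bsc eps ->
     1 - HZgU p delta k q' <= 1 - HZgU p delta 4 q).
  { intros k q' Hq' HI'. destruct (atoms_reduction p delta k q' Hp Hd Hq') as (q4 & Hq4 & E1 & E2).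
    rewrite <- E2. apply Hmax; [assumption|]. rewrite E1. assumption. }
  exists (1 - HZgU p delta 4 q). split; [split|split].
  - intros Rt HR. apply (achievable_le p delta eps Hp Hd He); assumption.
  - intros b Hb. destruct (Rle_lt_dec (1 - HZgU p delta 4 q) b) as [|Hlt]; [assumption|exfalso].
    assert (Hm : (b + (1 - HZgU p delta 4 q)) / 2 <= b); [|lra].
    apply Hb. apply achievable_below with 4%nat q; try assumption. lra.
  - exists q. split; [assumption|]. split; [assumption|reflexivity].
  - exact Hall.
Qed.
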